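(* Let $s\in(0,1)$, let $N\ge 1$ be an integer with $N>2s$, and let $B$ be a ball of $\mathbb{R}^N$ centered at $0$. Let $\alpha\in\left[0,\frac{N-2s}{2}\right]$ and $1<p<\frac{N+2s-2\alpha}{N-2s-2\alpha}$ (read as $1<p<\infty$ if $\alpha=\frac{N-2s}{2}$). Then there exists a function $u\in\mathcal{L}^1_s\cap L^p(B)$ satisfying $u>0$ in $B$ and $$(-\Delta)^s u-\gamma_\alpha|x|^{-2s}u=u^p\quad\text{in }\mathcal{D}'(B).$$
   Context: $\mathcal{L}^1_s=\{u:\mathbb{R}^N\to\mathbb{R}:\int_{\mathbb{R}^N}\frac{|u|}{1+|x|^{N+2s}}dx<\infty\}$. For $\varphi\in C^\infty_c(\mathbb{R}^N)$, $(-\Delta)^s\varphi(x)=(2\pi)^{-N/2}\int_{\mathbb{R}^N}|\zeta|^{2s}\widehat{\varphi}(\zeta)e^{i\zeta\cdot x}d\zeta$ with $\widehat{\varphi}(\zeta)=(2\pi)^{-N/2}\int_{\mathbb{R}^N}e^{-i\zeta\cdot x}\varphi(x)dx$. For an open set $G\subset\mathbb{R}^N$ and $u\in\mathcal{L}^1_s$, the distribution $(-\Delta)^su\in\mathcal{D}'(G)$ is defined by $\langle(-\Delta)^su,\varphi\rangle=\int_{\mathbb{R}^N}u\,(-\Delta)^s\varphi\,dx$ for all $\varphi\in C^\infty_c(G)$; the equation is understood in the sense of distributions. $$\gamma_\alpha=2^{2s}\frac{\Gamma\left(\frac{N+2s+2\alpha}{4}\right)}{\Gamma\left(\frac{N-2s-2\alpha}{4}\right)}\frac{\Gamma\left(\frac{N+2s-2\alpha}{4}\right)}{\Gamma\left(\frac{N-2s+2\alpha}{4}\right)}\quad\text{for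 }\alpha\in\left[0,\tfrac{N-2s}{2}\right),$$ and $\gamma_\alpha=0$ for $\alpha=\frac{N-2s}{2}$. *)

(* Defs.v *)
From HB Require Import structures.
From mathcomp Require Import all_boot all_order all_algebra.
From mathcomp Require Import complex.
From mathcomp Require Import all_classical all_reals all_analysis.

Set Implicit Arguments.
Unset Strict Implicit.
Unset Printing Implicit Defensive.

Import Order.TTheory GRing.Theory Num.Theory.
Import numFieldNormedType.Exports.

Local Open Scope classical_set_scope.
Local Open Scope ring_scope.
Local Open Scope complex_scope.

Definition measure_rV_display : measure_display -> measure_display.
Proof. exact. Qed.

(* Product sigma-algebra, as in the library's instance for [n.-tuple T]. *)
Section measurable_rV.
Context {d} {T : sigmaRingType d}.
Variable n : nat.

Let coors : 'I_n -> 'rV[T]_n -> T := fun i x => x ord0 i.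

Let rV_set0 : g_sigma_preimage coors set0.
Proof. exact: sigma_algebra0. Qed.

Let rV_setC A : g_sigma_preimage coors A -> g_sigma_preimage coors (~` A).
Proof. exact: sigma_algebraC. Qed.

Let rV_bigcup (F : _^nat) : (forall i, g_sigma_preimage coors (F i)) ->
  g_sigma_preimage coors (\bigcup_i (F i)).
Proof. exact: sigma_algebra_bigcup. Qed.

HB.instance Definition _ := @isMeasurable.Build (measure_rV_display d)
  'rV[T]_n (g_sigma_preimage coors) rV_set0 rV_setC rV_bigcup.

End measurable_rV.

Lemma measurable_coord d (T : measurableType d) n (i : 'I_n) :
  measurable_fun [set: 'rV[T]_n] (fun x => x ord0 i).
Proof.
move=> _ Y mY; rewrite setTI; apply: sub_sigma_algebra => /=.
rewrite -bigcup_seq/=; exists i => /=; first by rewrite mem_index_enum.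
by exists Y => //; rewrite setTI.
Qed.

Lemma measurable_fun_coordP d1 d2 (T1 : measurableType d1)
    (T2 : measurableType d2) n (f : T1 -> 'rV[T2]_n) :
  (forall i, measurable_fun [set: T1] (fun x => f x ord0 i)) ->
  measurable_fun [set: T1] f.
Proof.
move=> mf.
have sub : g_sigma_preimage (fun i => (fun v : 'rV[T2]_n => v ord0 i) \o f)
    `<=` measurable.
  apply: smallest_sub; first exact: sigma_algebra_measurable.
  rewrite -bigcup_seq; apply: bigcup_sub => i _.
  by move=> A [B mB <-]; exact: mf.
move: sub; rewrite g_sigma_preimage_comp => sub _ A mA.
by apply: sub; exists A.
Qed.

Section lebesgue_rV.
Context {R : realType}.

Definition rV_cons n (x : R * 'rV[R]_n) : 'rV[R]_n.+1 :=
  \row_i (if unlift ord0 i is Some j then x.2 ord0 j else x.1).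

Definition rV_uncons n (v : 'rV[R]_n.+1) : R * 'rV[R]_n :=
  (v ord0 ord0, \row_j v ord0 (lift ord0 j)).

Lemma rV_consK n : cancel (@rV_cons n) (@rV_uncons n).
Proof.
move=> [x v]; rewrite /rV_uncons mxE unlift_none; congr (_, _).
by apply/rowP => j; rewrite !mxE liftK.
Qed.

Lemma measurable_rV_cons n : measurable_fun setT (@rV_cons n).
Proof.
apply: measurable_fun_coordP => i; rewrite /rV_cons.
case: (unliftP ord0 i) => [j|] ->.
  under eq_fun do rewrite mxE liftK.
  apply: (measurableT_comp (measurable_coord j)); exact: measurable_snd.
under eq_fun do rewrite mxE unlift_none.
exact: measurable_fst.
Qed.

Lemma measurable_rV_uncons n : measurable_fun setT (@rV_uncons n).
Proof.
apply/measurable_fun_pairP; split; first exact: measurable_coord.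
apply: measurable_fun_coordP => i.
by under eq_fun do rewrite mxE; exact: measurable_coord.
Qed.

(* The image of [dx \x mu] under [R * R^n = R^(n+1)]. *)
Definition cons_measure n (mu : set 'rV[R]_n -> \bar R) :
    set 'rV[R]_n.+1 -> \bar R :=
  pushforward (lebesgue_measure \x mu)%E (@rV_cons n).

Section cons_measure_sigma_finite.
Variables (n : nat) (mu : {sigma_finite_measure set 'rV[R]_n -> \bar R}).

Let cons0 : cons_measure mu set0 = 0%E.
Proof. by rewrite /cons_measure /pushforward preimage_set0 measure0. Qed.

Let cons_ge0 A : (0 <= cons_measure mu A)%E.
Proof. apply: measure_ge0; exact: measurable_rV_cons. Qed.

Let cons_sigma_additive : semi_sigma_additive (cons_measure mu).
Proof. apply: measure_semi_sigma_additive; exact: measurable_rV_cons. Qed.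

HB.instance Definition _ := isMeasure.Build _ _ _ (cons_measure mu)
  cons0 cons_ge0 cons_sigma_additive.

Let cons_sigma_finite : sigma_finite setT (cons_measure mu).
Proof.
have /sigma_finiteP[F [TF ndF Foo]] := sigma_finiteT (@lebesgue_measure R).
have /sigma_finiteP[G [TG ndG Goo]] := sigma_finiteT mu.
exists (fun i => @rV_uncons n @^-1` (F i `*` G i)).
  rewrite -preimage_bigcup (_ : \bigcup_i _ = setT) ?preimage_setT//.
  rewrite -subTset => -[x v] _.
  have [i _ Fx] : (\bigcup_i F i) x by rewrite -TF.
  have [j _ Gv] : (\bigcup_i G i) v by rewrite -TG.
  exists (maxn i j) => //; split => /=.
    by move: x Fx; exact/subsetPset/ndF/leq_maxl.
  by move: v Gv; exact/subsetPset/ndG/leq_maxr.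
move=> i; have [? ?] := Foo i; have [? ?] := Goo i; split.
  rewrite -[X in measurable X]setTI; apply: measurable_rV_uncons => //.
  exact: measurableX.
rewrite /cons_measure /pushforward -comp_preimage (_ : _ \o _ = id).
  by rewrite preimage_id product_measure1E// lte_mul_pinfty// ge0_fin_numE.
by apply/funext => x; exact: rV_consK.
Qed.

HB.instance Definition _ := Measure_isSigmaFinite.Build _ _ _ (cons_measure mu)
  cons_sigma_finite.

End cons_measure_sigma_finite.

Fixpoint lebesgue_rV (n : nat) :
    {sigma_finite_measure set 'rV[R]_n -> \bar R} :=
  if n is m.+1 then cons_measure (lebesgue_rV m) else \d_(0 : 'rV[R]_0).

End lebesgue_rV.
Arguments lebesgue_rV R n : clear implicits.

Section euclidean.
Context {R : realType} {N : nat}.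
Implicit Types x y : 'rV[R]_N.

Definition dot x y : R := \sum_i x ord0 i * y ord0 i.

(* The library norm on ['rV[R]_N] is the sup norm. *)
Definition enorm x : R := Num.sqrt (dot x x).

Definition eball (r : R) : set 'rV[R]_N := [set x | enorm x < r].

End euclidean.

Section test_functions.
Context {R : realType} {N : nat}.
Implicit Types (f : 'rV[R]_N -> R) (G : set 'rV[R]_N).

Definition partial (i : 'I_N) f : 'rV[R]_N -> R :=
  fun x => 'D_(delta_mx ord0 i) f x.

Definition iter_partial (l : seq 'I_N) f : 'rV[R]_N -> R := foldr partial f l.

Definition smooth f := forall l : seq 'I_N,
  continuous (iter_partial l f) /\
  forall i x, derivable (iter_partial l f) x (delta_mx ord0 i).

Definition supp f : set 'rV[R]_N := closure [set x | f x != 0].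

Definition test_function G f :=
  [/\ smooth f, compact (supp f) & supp f `<=` G].

End test_functions.

Section function_spaces.
Context {R : realType} {N : nat}.
Implicit Types (u : 'rV[R]_N -> R) (G : set 'rV[R]_N).
Local Notation mu := (lebesgue_rV R N).

Definition L1s (s : R) u := measurable_fun setT u /\
  (\int[mu]_x (`|u x| / (1 + enorm x `^ (N%:R + 2 * s)))%:E < +oo)%E.

Definition Lp_on G (p : R) u := measurable_fun G u /\
  (\int[mu]_(x in G) (`|u x| `^ p)%:E < +oo)%E.

Definition L1loc G u := measurable_fun G u /\
  forall K, K `<=` G -> compact K -> (\int[mu]_(x in K) `|u x|%:E < +oo)%E.

End function_spaces.

Section fractional_laplacian.
Context {R : realType} {N : nat}.
Implicit Types (u phi : 'rV[R]_N -> R) (G : set 'rV[R]_N).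
Local Notation mu := (lebesgue_rV R N).

Definition cintegral (f : 'rV[R]_N -> R[i]) : R[i] :=
  (\int[mu]_x complex.Re (f x)) +i* (\int[mu]_x complex.Im (f x)).

Definition expi (t : R) : R[i] := cos t +i* sin t.

Definition fourier phi (zeta : 'rV[R]_N) : R[i] :=
  ((2 * pi) `^ (- (N%:R / 2)))%:C *
  cintegral (fun x => expi (- dot zeta x) * (phi x)%:C).

Definition fraclap (s : R) phi (x : 'rV[R]_N) : R[i] :=
  ((2 * pi) `^ (- (N%:R / 2)))%:C *
  cintegral (fun zeta =>
    (enorm zeta `^ (2 * s))%:C * fourier phi zeta * expi (dot zeta x)).

(* Distributions are tested against real functions; values are complex because
   [fraclap s phi] is complex by definition. *)
Definition distr_fraclap (s : R) u phi : R[i] :=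
  cintegral (fun x => (u x)%:C * fraclap s phi x).

Definition distr_fun G u phi : R[i] := (\int[mu]_(x in G) (u x * phi x))%:C.

End fractional_laplacian.

Section hardy_constant.
Context {R : realType}.

(* Euler's integral, meaningful for [0 < x] only. *)
Definition Gamma (x : R) : R :=
  \int[lebesgue_measure]_(t in `]0, +oo[) (t `^ (x - 1) * expR (- t)).

Definition hardy_gamma (N : nat) (s alpha : R) : R :=
  if alpha == (N%:R - 2 * s) / 2 then 0 else
  2 `^ (2 * s) *
  (Gamma ((N%:R + 2 * s + 2 * alpha) / 4) /
   Gamma ((N%:R - 2 * s - 2 * alpha) / 4)) *
  (Gamma ((N%:R + 2 * s - 2 * alpha) / 4) /
   Gamma ((N%:R - 2 * s + 2 * alpha) / 4)).

End hardy_constant.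

(* Main.v *)
Require Import Defs.
From HB Require Import structures.
From mathcomp Require Import all_boot all_order all_algebra.
From mathcomp Require Import complex.
From mathcomp Require Import all_classical all_reals all_analysis.
From mathcomp Require Import measurable_realfun.
From mathcomp Require Import ring lra.
Import Order.TTheory GRing.Theory Num.Theory.
Import numFieldNormedType.Exports.
Local Open Scope classical_set_scope.
Local Open Scope ring_scope.

Set Implicit Arguments.
Unset Strict Implicit.
Unset Printing Implicit Defensive.

(** Why the theorem holds. Write Q = N - 2s and b = Q/2 - alpha. The solution has the form
    u = eps + K(S(u)), where eps > 0 is a constant, S(u) is the function equal to
    gamma_alpha |y|^-2s u + u^p for 0 < |y| < r and to 0 elsewhere (hardy_source), and K is
    convolution with the Riesz kernel, the inverse of the fractional Laplacian. Constants are
    annihilated by the fractional Laplacian, so such a u solves the equation in the ball, and it is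
    positive because it is at least eps.

    The integral equation is solved by monotone iteration from the constant eps below a
    supersolution (hardy_solutionE). Two facts on powers provide the supersolutions. First,
    K(|y|^-(2s+a)) = (riesz_factor s a / Gamma s) |x|^-a for 0 < a < Q (riesz_potential_power);
    at a = b the factor is 1/gamma_alpha (hardy_gammaE), so |x|^-b solves the linear equation in
    the whole space. Second, the factor increases strictly when a decreases below Q/2
    (riesz_factor_lt), so that subtracting a small multiple of |x|^-c, with c slightly below b, turns
    |x|^-b into a strict supersolution. The gain absorbs the constant eps, the effect of cutting the
    source off outside the ball and, if the amplitude is small, the term u^p: its singularity
    |x|^-bp is no worse than that of |x|^-(2s+c), and b p < 2s + b is exactly the upper bound on p
    (riesz_hardy_solution_pos). For alpha = Q/2 the constant gamma_alpha vanishes and a small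
    multiple of one power is enough (riesz_hardy_solution_gamma0).

    It remains to pass from the integral equation to distributions. Let phi be a test function and
    L its fractional Laplacian, given as a Fourier integral. Integration by parts makes the Fourier
    transform of phi decay fast enough for all integrals to converge (cos_transform_decay). Writing
    |zeta|^2s as an integral of 1 - exp(-t |zeta|^2) against t^(-1-s) dt expresses L through the heat
    flow of phi (frac_multiplier_heat); this shows that L is real and decays like |x|^-(N+2s)
    (frac_multiplier_far), hence is integrable against u. Integrating the heat flow of L in time
    gives K(L) = phi (riesz_frac_multiplier), and testing L against wide Gaussians shows that its
    integral is 0 (integral_frac_multiplier). By Fubini the integral of u L is then that of S(u) phi
    (integral_hardy_u_frac), which is the equation.

    All the integrals over times and scales are written on the whole line, with t = exp(tau): scaling
    becomes a translation, and the Gamma and Beta integrals become integrals over the line. *)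

(** * Integrals over the real line *)

Section real_line.
Context {R : realType}.
Local Notation leb := (@lebesgue_measure R).
Implicit Types (f : R -> \bar R) (g : R -> R).

Let shift (c : R) : measurableTypeR R -> measurableTypeR R := fun x => x + c.

Let measurable_shift c : measurable_fun setT (shift c).
Proof. by apply: measurable_funD. Qed.

HB.instance Definition _ c :=
  @isMeasurableFun.Build _ _ _ _ (shift c) (measurable_shift c).

Lemma lebesgue_measureD (c : R) (A : set R) : measurable A ->
  pushforward leb (shift c) A = leb A.
Proof.
move=> mA; apply/esym.
apply: lebesgue_measure_unique => //= _ [[a b]] _ <-.
rewrite /pushforward /= (_ : _ @^-1` _ = `]a - c, b - c]%classic).
  by rewrite !lebesgue_measure_itv/= !lte_fin ltrD2r -!EFinD; case: ifP => // _; congr (_%:E); ring.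
by apply/seteqP; split => x /=; rewrite !in_itv/= ltrBlDr lerBrDr.
Qed.

Lemma integral_shift (c : R) f : measurable_fun setT f -> (forall x, 0 <= f x)%E ->
  (\int[leb]_x f (x + c)%R = \int[leb]_x f x)%E.
Proof.
move=> mf f0.
have := @ge0_integral_pushforward _ _ _ _ R _ (measurable_shift c) leb setT f measurableT mf (fun y _ => f0 y).
rewrite preimage_setT => <-.
by apply: eq_measure_integral => //= A mA _; exact/lebesgue_measureD.
Qed.

Lemma integral_opp f : measurable_fun setT f -> (forall x, 0 <= f x)%E ->
  (\int[leb]_x f (- x)%R = \int[leb]_x f x)%E.
Proof.
move=> mf f0; have ms : measurable_fun setT (fun x : measurableTypeR R => (- x : measurableTypeR R)).
  exact: oppr_measurable.
have := @ge0_integral_pushforward _ _ _ _ R _ ms leb setT f measurableT mf (fun y _ => f0 y).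
rewrite preimage_setT => <-.
by apply: eq_measure_integral => //= A mA _; exact/lebesgue_measureN.
Qed.

(** The normal density has integral 1. *)
Lemma integral_gauss (a y : R) : 0 < a ->
  (\int[leb]_x (expR (- (a * (x - y) ^+ 2)))%R%:E = (Num.sqrt (pi / a))%:E)%E.
Proof.
move=> a0; set s := Num.sqrt (1 / (2 * a)).
have s0 : 0 < s by rewrite sqrtr_gt0 divr_gt0// mulr_gt0.
have s2 : s ^+ 2 = 1 / (2 * a) by rewrite sqr_sqrtr// ltW// divr_gt0// mulr_gt0.
have pk : (s ^+ 2 * pi *+ 2) = pi / a by rewrite s2 -mulr_natl; field; rewrite gt_eqF.
have P0 : 0 < Num.sqrt (pi / a) by rewrite sqrtr_gt0 divr_gt0// pi_gt0.
have := integral_normal_pdf y s.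
have -> : normal_pdf y s = (fun x => normal_peak s * normal_fun y s x).
  by rewrite normal_pdfE ?gt_eqF.
rewrite /normal_peak pk.
under eq_integral do rewrite EFinM.
rewrite ge0_integralZl//=; last 2 first.
- by apply/measurable_EFinP; exact: measurable_normal_fun.
- by move=> x _; rewrite lee_fin normal_fun_ge0.
have -> : (\int[leb]_x (normal_fun y s x)%:E = \int[leb]_x (expR (- (a * (x - y) ^+ 2)))%R%:E)%E.
  apply: eq_integral => x _; rewrite /normal_fun s2; congr ((expR _)%:E).
  by rewrite -[_ *+ 2]mulr_natl; field; rewrite gt_eqF.
move=> H; rewrite -[LHS]mul1e -(@divff _ (Num.sqrt (pi / a))) ?gt_eqF//.
by rewrite EFinM -muleA H mule1.
Qed.

Lemma integral_oneDsqrV : (\int[leb]_x ((1 + x ^+ 2)^-1)%R%:E = pi%:E)%E.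
Proof.
rewrite (@ge0_symfun_integralT R (fun x => (1 + x ^+ 2)^-1))//=.
- rewrite (_ : [set x | _] = `[0, +oo[%classic); last first.
    by apply/seteqP; split => x/=; rewrite in_itv/= andbT.
  by have := @integral0y_oneDsqr R; rewrite /oneDsqr => ->; rewrite -EFinM; congr (_%:E); field.
- by move=> x; rewrite invr_ge0 addr_ge0// sqr_ge0.
- exact: continuous_oneDsqrV.
- by move=> x/=; rewrite sqrrN.
Qed.

Lemma integral_gt0 f : measurable_fun setT f -> (forall x, 0 < f x)%E ->
  (0 < \int[leb]_x f x)%E.
Proof.
move=> mf f0; rewrite lt0e integral_ge0 ?andbT; last by move=> x _; exact: ltW.
apply/eqP => I0.
have [+ _] := ae_eq_integral_abs leb measurableT mf.
have -> : (\int[leb]_x `|f x| = 0)%E.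
  by rewrite -[RHS]I0; apply: eq_integral => x _; rewrite gee0_abs// ltW.
move=> /(_ erefl) [A [mA A0 sA]].
have AT : A = setT.
  rewrite -subTset => x _; apply: sA => /= /(_ I) fx0.
  by have := f0 x; rewrite fx0 ltxx.
have : (leb (`[0%R, 1%R]%classic : set R) <= leb A)%E by apply: le_measure; rewrite ?inE// AT.
by rewrite A0 lebesgue_measure_itv/= lte01 oppr0 adde0 leNgt lte01.
Qed.

End real_line.

(** Proves measurability of an explicit expression by recursion on its syntax, using measurability
    hypotheses of the context for the remaining atoms. *)
Ltac mfun := repeat first
  [ exact: measurable_cst | exact: measurable_id | exact: measurable_fst | exact: measurable_snd
  | assumption | exact: measurable_expR | exact: measurable_ln
  | exact: (continuous_measurable_fun (@continuous_cos _))
  | exact: (continuous_measurable_fun (@continuous_sin _))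
  | exact: oppr_measurable | exact: normr_measurable | exact: measurable_powR
  | exact: mulrl_measurable | exact: exprn_measurable
  | lazymatch goal with
    | |- measurable_fun _ (fun x => (_)%:E) => apply/measurable_EFinP
    | |- measurable_fun _ ( *%R _) => exact: mulrl_measurable
    | |- measurable_fun _ ( +%R ?a) => apply: (@measurable_funD _ _ _ _ (cst a) id)
    | |- measurable_fun _ (EFin \o _) => apply/measurable_EFinP
    | |- measurable_fun _ (fun x => (_ + _)%R) => apply: measurable_funD
    | |- measurable_fun _ (fun x => (- _)%R) => apply: measurable_funN
    | |- measurable_fun _ (fun x => (_ * _)%R) => apply: measurable_funM
    | |- measurable_fun _ (fun x => (_ ^+ _)%R) => apply: measurable_funX
    | |- measurable_fun _ (fun x => expR _) => apply: (measurableT_comp (@measurable_expR _))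
    | |- measurable_fun _ (fun x => cos _) => apply: (measurableT_comp (continuous_measurable_fun (@continuous_cos _)))
    | |- measurable_fun _ (fun x => sin _) => apply: (measurableT_comp (continuous_measurable_fun (@continuous_sin _)))
    | |- measurable_fun _ (fun x => ln _) => apply: (measurableT_comp (@measurable_ln _))
    | |- measurable_fun _ (fun x => (_ `^ _)%R) => apply: (measurableT_comp (measurable_powR _))
    | |- measurable_fun _ (fun x => (`| _ |)%R) => apply: (measurableT_comp (@normr_measurable _ _))
    | |- measurable_fun _ (fun x => (_ + _)%E) => apply: emeasurable_funD
    | |- measurable_fun _ (fun x => (_ * _)%E) => apply: emeasurable_funM
    end
  | match goal with H : measurable_fun setT ?f |- measurable_fun _ (fun x => ?f _) => apply: (measurableT_comp H) end ].

Section log_time.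
Context {R : realType}.
Local Notation leb := (@lebesgue_measure R).

(** The workhorse for the finiteness of integrals over logarithmic times: in that variable powers
    become exponentials. *)
Lemma integral_lt_pinfty_decay (f : R -> R) (C r : R) : 0 < r ->
  measurable_fun setT f -> (forall x, 0 <= f x <= C * expR (- (r * `|x|))) ->
  (\int[leb]_x (f x)%:E < +oo)%E.
Proof.
move=> r0 mf fb.
have C0 : 0 <= C.
  have /andP[h1 h2] := fb 0; have := le_trans h1 h2.
  by rewrite pmulr_lge0// expR_gt0.
pose K := C * (1 + 2 / r ^+ 2).
have r20 : 0 < r ^+ 2 by rewrite exprn_gt0.
apply: (@le_lt_trans _ _ (\int[leb]_x (K%:E * ((1 + x ^+ 2)^-1)%R%:E))%E).
  apply: ge0_le_integral => //=.
  - by move=> x _; rewrite lee_fin; have /andP[] := fb x.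
  - exact/measurable_EFinP.
  - apply/measurable_EFinP/measurable_funM => //.
    exact: (continuous_measurable_fun (@continuous_oneDsqrV R)).
  move=> x _; rewrite -EFinM lee_fin; have /andP[_ h] := fb x.
  apply: (le_trans h); rewrite /K -mulrA ler_wpM2l// expRN.
  have x20 : 0 < 1 + x ^+ 2 by rewrite ltr_pwDl// sqr_ge0.
  rewrite ler_pdivlMr// mulrC ler_pdivrMr ?expR_gt0//.
  have h0 : 0 <= r * `|x| by rewrite mulr_ge0// ltW.
  have := expR_ge1Dxn 1 h0; rewrite exprMn real_normK ?num_real// => h1.
  have h2 : 1 + x ^+ 2 <= (1 + 2 / r ^+ 2) * (1 + r ^+ 2 * x ^+ 2 / 2).
    rewrite [leRHS](_ : _ = 1 + x ^+ 2 + (2 / r ^+ 2 + r ^+ 2 * x ^+ 2 / 2)); last first.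
      by field; rewrite gt_eqF.
    rewrite lerDl; apply: addr_ge0; first by rewrite divr_ge0// sqr_ge0.
    by rewrite divr_ge0// mulr_ge0// sqr_ge0.
  apply: (le_trans h2); rewrite ler_wpM2l// ?addr_ge0// ?divr_ge0 ?sqr_ge0//.
rewrite ge0_integralZl//; last 3 first.
- apply/measurable_EFinP; exact: (continuous_measurable_fun (@continuous_oneDsqrV R)).
- by move=> x _; rewrite lee_fin invr_ge0 addr_ge0// sqr_ge0.
- by rewrite lee_fin /K mulr_ge0// addr_ge0// divr_ge0// sqr_ge0.
by rewrite integral_oneDsqrV -EFinM ltry.
Qed.

(** Passage from a time t > 0 to its logarithm. *)
Lemma integral_expR_subst (g : R -> R) : (forall t, 0 < t -> {for t, continuous g}) ->
  (forall t, 0 < t -> 0 <= g t) ->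
  (\int[leb]_(t in `]0%R, +oo[) (g t)%:E = \int[leb]_x (g (expR x) * expR x)%R%:E)%E.
Proof.
move=> cg g0.
pose F n : set R := `[expR (- n%:R), expR n%:R]%classic.
pose G n : set R := `[- n%:R, n%:R]%classic.
have mg : measurable_fun (`]0, +oo[%classic : set R) g.
  apply: open_continuous_measurable_fun; first exact: interval_open.
  by move=> t; rewrite inE/= in_itv/= andbT => t0; exact: cg.
have FU : \bigcup_n F n = `]0, +oo[%classic.
  apply/seteqP; split => [t [n _]|t].
    by rewrite /F/= !in_itv/= andbT => /andP[h _]; exact: lt_le_trans h.
  rewrite /= in_itv/= andbT => t0; have := archi_boundP (normr_ge0 (ln t)).
  set n := Num.Def.archi_bound _ => h; exists n => //; rewrite /F/= in_itv/=.
  by move: (ltW h); rewrite ler_norml -{3 4}(lnK t0) => /andP[? ?]; rewrite !ler_expR; apply/andP.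
have GU : \bigcup_n G n = [set: R].
  rewrite -subTset => t _; have := archi_boundP (normr_ge0 t).
  set n := Num.Def.archi_bound _ => h; exists n => //; rewrite /G/= in_itv/=.
  by move: (ltW h); rewrite ler_norml.
have ndF : {homo F : n m / (n <= m)%N >-> (n <= m)%O}.
  move=> n m nm; apply/subsetPset => t; rewrite /F/= !in_itv/= => /andP[h1 h2].
  by rewrite (le_trans _ h1) ?(le_trans h2)// ler_expR ?lerN2 ler_nat.
have ndG : {homo G : n m / (n <= m)%N >-> (n <= m)%O}.
  move=> n m nm; apply/subsetPset => t; rewrite /G/= !in_itv/= => /andP[h1 h2].
  by rewrite (le_trans _ h1) ?(le_trans h2)// ?lerN2 ler_nat.
have FS n : F n `<=` `]0, +oo[ by rewrite -FU; exact: bigcup_sup.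
have mgO : measurable_fun (`]0, +oo[%classic : set R) (EFin \o g) by exact/measurable_EFinP.
have mgE : measurable_fun setT (fun x => g (expR x) * expR x).
  apply: continuous_measurable_fun => x; apply: cvgM; last exact: continuous_expR.
  apply: continuous_comp; first exact: continuous_expR.
  by apply: cg; exact: expR_gt0.
have cF := @ge0_nondecreasing_set_cvg_integral _ (measurableTypeR R) R F (EFin \o g) leb ndF.
have cG := @ge0_nondecreasing_set_cvg_integral _ (measurableTypeR R) R G (fun x => (g (expR x) * expR x)%:E) leb ndG.
have {}cF := cF (fun n => measurable_itv _) (fun n => measurable_funS (measurable_itv _) (FS n) mgO).
have {}cG := cG (fun n => measurable_itv _) (fun n => measurable_funTS (measurableT_comp (@EFin_measurable _ _) mgE)).
rewrite -FU -[in RHS]GU.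
have E : (fun n => \int[leb]_(x in F n) (EFin \o g) x)%E =
         (fun n => \int[leb]_(x in G n) (g (expR x) * expR x)%R%:E)%E.
  apply/funext => n.
  have nn : - n%:R <= n%:R :> R by rewrite lerNl (le_trans _ (ler0n _ n))// oppr_le0.
  have dE : (@expR R)^`()%classic = expR by apply/funext => x; rewrite derive1E derive_val.
  rewrite /F /G (integration_by_substitution_increasing (F := @expR R) nn)//.
  - by apply: eq_integral => x _; rewrite dE.
  - by move=> x y _ _; rewrite ltr_expR.
  - by rewrite dE => x _; exact: continuous_expR.
  - by rewrite dE; apply: cvgP; exact/cvg_at_right_filter/continuous_expR.
  - by rewrite dE; apply: cvgP; exact/cvg_at_left_filter/continuous_expR.
  - split.
    + by move=> x _; exact: derivable_expR.
    + exact/cvg_at_right_filter/continuous_expR.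
    + exact/cvg_at_left_filter/continuous_expR.
  - apply: continuous_in_subspaceT => t; rewrite inE/= => /(FS n).
    by rewrite /= in_itv/= andbT => t0; exact: cg.

rewrite E in cF; apply: (cvg_unique (@ereal_hausdorff R) (cF _) (cG _)).
  by move=> n t /FS; rewrite /= in_itv/= andbT lee_fin => t0; exact: g0.
by move=> n x _; rewrite lee_fin mulr_ge0 ?expR_ge0 ?g0 ?expR_gt0.
Qed.

(** * Gamma and Beta integrals in logarithmic variables *)

(** Divides an identity between extended reals by a positive real; the finiteness of the unknown
    integral comes out of the identity. *)
Lemma mule_eq_EFin (a b : R) (I : \bar R) : 0 < a -> (a%:E * I = b%:E)%E -> I = (b / a)%:E.
Proof.
move=> a0 H; have : (a^-1%:E * (a%:E * I) = a^-1%:E * b%:E)%E by rewrite H.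
by rewrite muleA -!EFinM mulVf ?gt_eqF// mul1e [b * _]mulrC.
Qed.

Lemma ge0_integralZl_real d (T : measurableType d) (mu : {measure set T -> \bar R})
    (f : T -> R) (k : R) : measurable_fun setT f -> (forall x, 0 <= f x) -> 0 <= k ->
  (\int[mu]_x (k * f x)%R%:E = k%:E * \int[mu]_x (f x)%:E)%E.
Proof.
move=> mf f0 k0; under eq_integral do rewrite EFinM.
by rewrite ge0_integralZl//; [exact/measurable_EFinP|move=> x _; rewrite lee_fin].
Qed.

Lemma expR_ge_sqr (x : R) : 0 <= x -> x ^+ 2 / 2 <= expR x.
Proof.
move=> x0; have := expR_ge1Dxn 1 x0; apply: le_trans.
by rewrite lerDr.
Qed.

Lemma Gamma_log_lt_pinfty (m : R) : 0 < m ->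
  (\int[leb]_x (expR (m * x - expR x))%:E < +oo)%E.
Proof.
move=> m0; apply: (@integral_lt_pinfty_decay _ (expR (2 * m ^+ 2)) m) => //; first by mfun.
move=> x; rewrite expR_ge0 -expRD ler_expR/=.
have e0 := expR_gt0 x; have m2 := sqr_ge0 m.
have [x0|x0] := lerP 0 x.
  rewrite ger0_norm//; have := expR_ge_sqr x0; have := sqr_ge0 (2 * m - x); nra.
by rewrite ltr0_norm//; nra.
Qed.

(** Euler's integral after t = exp(x). *)
Lemma Gamma_logE (m : R) : 0 < m ->
  (\int[leb]_x (expR (m * x - expR x))%:E = (Gamma m)%:E)%E.
Proof.
move=> m0; rewrite /Gamma /Rintegral.
have -> : (\int[leb]_(t in `]0%R, +oo[) (t `^ (m - 1) * expR (- t))%:E =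
          \int[leb]_x (expR (m * x - expR x))%:E)%E.
  rewrite (@integral_expR_subst (fun t => t `^ (m - 1) * expR (- t))).
  - apply: eq_integral => x _; congr (_%:E).
    rewrite /powR gt_eqF ?expR_gt0// expRK -expRD -expRD; congr expR; ring.
  - move=> t t0; apply: cvgM.
      apply: (@cvg_trans _ ((fun t => expR ((m - 1) * ln t)) @ t)).
        apply: near_eq_cvg; near=> u; rewrite /powR gt_eqF//.
        by near: u; exact: lt_nbhsr.
      rewrite /powR gt_eqF//; apply: (@continuous_comp _ _ _ (fun t => (m - 1) * ln t) expR).
        by apply: cvgM; [exact: cvg_cst|exact: continuous_ln].
      exact: continuous_expR.
    by apply: continuous_comp; [exact: opp_continuous|exact: continuous_expR].
  - by move=> t t0; rewrite mulr_ge0// ?powR_ge0 ?expR_ge0.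
by rewrite fineK// ge0_fin_numE ?Gamma_log_lt_pinfty// integral_ge0.
Unshelve. all: by end_near. Qed.

Lemma Gamma_gt0 (m : R) : 0 < m -> 0 < Gamma m.
Proof.
move=> m0; rewrite -lte_fin -Gamma_logE//; apply: integral_gt0; first by mfun.
by move=> x; rewrite lte_fin expR_gt0.
Qed.

(** A translation of x by ln c replaces the scaling t -> c t. *)
Lemma Gamma_log_scale (m c : R) : 0 < m -> 0 < c ->
  (\int[leb]_x (expR (m * x - c * expR x))%:E = (c `^ (- m) * Gamma m)%:E)%E.
Proof.
move=> m0 c0; rewrite EFinM -Gamma_logE// -ge0_integralZl_real; [|mfun|by move=> x; exact: expR_ge0|exact: powR_ge0].
rewrite -[RHS](integral_shift (ln c) (f := fun x => (c `^ (- m) * expR (m * x - expR x))%:E)); last 2 first.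
- by mfun.
- by move=> x; rewrite lee_fin mulr_ge0 ?powR_ge0 ?expR_ge0.
apply: eq_integral => x _; rewrite /powR gt_eqF// -expRD.
by congr ((expR _)%:E); rewrite expRD lnK//; ring.
Qed.

Lemma Gamma_log_scaleV (m c : R) : 0 < m -> 0 < c ->
  (\int[leb]_x (expR (- (m * x) - c * expR (- x)))%:E = (c `^ (- m) * Gamma m)%:E)%E.
Proof.
move=> m0 c0; apply: etrans (Gamma_log_scale m0 c0).
rewrite -(integral_opp (f := fun x => (expR (m * x - c * expR x))%:E)); last 2 first.
- by mfun.
- by move=> x; rewrite lee_fin ?expR_ge0.
by apply: eq_integral => x _; congr ((expR _)%:E); rewrite mulrN.
Qed.

(** Euler's Beta integral: (1 + e^x)^-q is itself a Gamma integral, and after Tonelli the inner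
    integral is another one. *)
Lemma Beta_log (s q : R) : 0 < s -> s < q ->
  (\int[leb]_x (expR (s * x) * (1 + expR x) `^ (- q))%:E =
   (Gamma s * Gamma (q - s) / Gamma q)%:E)%E.
Proof.
move=> s0 sq; have q0 := lt_trans s0 sq.
have mf : measurable_fun setT (fun z : R * R =>
    (expR (s * z.1 + q * z.2 - (1 + expR z.1) * expR z.2))%:E) by mfun.
have H1 : (\int[leb]_x \int[leb]_y (expR (s * x + q * y - (1 + expR x) * expR y))%:E =
   (Gamma q)%:E * \int[leb]_x (expR (s * x) * (1 + expR x) `^ (- q))%:E)%E.
  rewrite -ge0_integralZl_real; last 3 first.
  - apply: measurable_funM; first by mfun.
    apply: (measurableT_comp (measurable_powR _)); mfun.
  - by move=> x; rewrite mulr_ge0 ?expR_ge0 ?powR_ge0.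
  - by rewrite ltW// Gamma_gt0.
  apply: eq_integral => x _.
  under eq_integral do rewrite -addrA expRD.
  rewrite ge0_integralZl_real; [|mfun|by move=> ?; exact: expR_ge0|exact: expR_ge0].
  rewrite Gamma_log_scale; [|by []|by rewrite ltr_pwDl// expR_ge0].
  by rewrite -EFinM; congr (_%:E); ring.
have H2 : (\int[leb]_y \int[leb]_x (expR (s * x + q * y - (1 + expR x) * expR y))%:E =
   (Gamma s)%:E * (Gamma (q - s))%:E)%E.
  have qs : 0 < q - s by rewrite subr_gt0.
  apply: esym; rewrite -(Gamma_logE qs) -ge0_integralZl_real;
    [|mfun|by move=> ?; exact: expR_ge0|by rewrite ltW// Gamma_gt0].
  apply: esym.
  apply: eq_integral => y _.
  under eq_integral => x _.
    rewrite (_ : s * x + _ - _ = (q * y - expR y) + (s * x - expR y * expR x)); last by ring.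
    rewrite expRD; over.
  rewrite ge0_integralZl_real; [|mfun|by move=> ?; exact: expR_ge0|exact: expR_ge0].
  rewrite Gamma_log_scale ?expR_gt0// -!EFinM; congr (_%:E).
  rewrite /powR gt_eqF ?expR_gt0// expRK mulrA -expRD mulrC; congr (_ * expR _); ring.
have := @fubini_tonelli _ _ _ _ _ leb leb _ mf (fun z => expR_ge0 _).
move=> H3; have H := etrans (esym H1) (etrans H3 H2).
have G0 := Gamma_gt0 q0.
by apply: mule_eq_EFin => //; rewrite H EFinM.
Qed.

(** The normalising constant of the subordination formula
    |zeta|^2s = c^-1 int_0^oo (1 - exp(-t |zeta|^2)) t^(-1-s) dt, with t = exp(x). *)
Definition heat_multiplier_const (s : R) : R :=
  fine (\int[leb]_x (expR (- (s * x)) * (1 - expR (- expR x)))%:E)%E.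

Let heat_multiplier_ge0 (s x : R) : 0 <= expR (- (s * x)) * (1 - expR (- expR x)).
Proof. by rewrite mulr_ge0 ?expR_ge0// subr_ge0 expR_le1 oppr_le0 expR_ge0. Qed.

Lemma heat_multiplier_constE (s : R) : 0 < s < 1 ->
  (\int[leb]_x (expR (- (s * x)) * (1 - expR (- expR x)))%:E =
   (heat_multiplier_const s)%:E)%E.
Proof.
move=> /andP[s0 s1]; rewrite fineK// ge0_fin_numE; last first.
  by apply: integral_ge0 => x _; rewrite lee_fin heat_multiplier_ge0.
have r0 : 0 < Num.min s (1 - s) by rewrite lt_min s0 subr_gt0.
apply: (@integral_lt_pinfty_decay _ 1 (Num.min s (1 - s))) => //; first by mfun.
move=> x; rewrite heat_multiplier_ge0 mul1r/=.
have [x0|x0] := lerP 0 x.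
  rewrite ger0_norm//; apply: (@le_trans _ _ (expR (- (s * x)))).
    by rewrite ler_piMr ?expR_ge0// gerBl expR_ge0.
  by rewrite ler_expR lerN2 ler_wpM2r// ge_min lexx.
rewrite ltr0_norm//; apply: (@le_trans _ _ (expR (- (s * x)) * expR x)).
  by rewrite ler_wpM2l ?expR_ge0// lerBlDr -lerBlDl; have := expR_ge1Dx (- expR x); lra.
rewrite -expRD ler_expR; have : Num.min s (1 - s) <= 1 - s by rewrite ge_min lexx orbT.
by nra.
Qed.

Lemma heat_multiplier_const_gt0 (s : R) : 0 < s < 1 -> 0 < heat_multiplier_const s.
Proof.
move=> s01; rewrite -lte_fin -heat_multiplier_constE//; apply: integral_gt0; first by mfun.
by move=> x; rewrite lte_fin mulr_gt0 ?expR_gt0// subr_gt0 expR_lt1 oppr_lt0 expR_gt0.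
Qed.

Lemma heat_multiplierE (s c : R) : 0 < s < 1 -> 0 <= c ->
  (\int[leb]_x (expR (- (s * x)) * (1 - expR (- (c * expR x))))%:E =
   (c `^ s * heat_multiplier_const s)%:E)%E.
Proof.
move=> s01; rewrite le_eqVlt => /predU1P[<-|c0].
  under eq_integral do rewrite mul0r oppr0 expR0 subrr mulr0.
  by rewrite integral0 powR0 ?mul0r// gt_eqF//; case/andP: s01.
rewrite EFinM -heat_multiplier_constE// -ge0_integralZl_real; [|mfun|exact: heat_multiplier_ge0|exact: powR_ge0].
rewrite -[RHS](integral_shift (ln c) (f := fun x => (c `^ s * (expR (- (s * x)) * (1 - expR (- expR x))))%:E)); last 2 first.
- by mfun.
- by move=> x; rewrite lee_fin mulr_ge0 ?powR_ge0 ?heat_multiplier_ge0.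
apply: eq_integral => x _; congr (_%:E).
rewrite /powR gt_eqF// mulrA -expRD [expR (x + _)]expRD lnK// [c * _]mulrC; congr (expR _ * _).
by ring.
Qed.

(** * The Fourier transform of a Gaussian *)

Lemma integral_shift_signed (c : R) (f : R -> \bar R) : measurable_fun setT f ->
  (\int[leb]_x f (x + c)%R = \int[leb]_x f x)%E.
Proof.
move=> mf; rewrite integralE [RHS]integralE; congr (_ - _)%E.
  rewrite -(@integral_shift R c (fun y => f^\+ y)%E (measurable_funepos mf)) => [|y]; last exact: funepos_ge0.
  apply: eq_integral => y _. by rewrite !funeposE.
by rewrite -(@integral_shift R c (fun y => f^\- y)%E (measurable_funeneg mf)) => [|y]; [by apply: eq_integral => y _; rewrite !funenegE|exact: funeneg_ge0].
Qed.

Lemma integral_opp_signed (f : R -> \bar R) : measurable_fun setT f ->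
  (\int[leb]_x f (- x)%R = \int[leb]_x f x)%E.
Proof.
move=> mf; rewrite integralE [RHS]integralE; congr (_ - _)%E.
  by rewrite -(@integral_opp R (fun y => f^\+ y)%E (measurable_funepos mf)) => [|y]; [by apply: eq_integral => y _; rewrite !funeposE|exact: funepos_ge0].
by rewrite -(@integral_opp R (fun y => f^\- y)%E (measurable_funeneg mf)) => [|y]; [by apply: eq_integral => y _; rewrite !funenegE|exact: funeneg_ge0].
Qed.

Lemma integrable_le d (T : measurableType d) (mu : {measure set T -> \bar R}) (f g : T -> R) :
  measurable_fun setT f -> (forall x, `|f x| <= g x) ->
  mu.-integrable setT (EFin \o g) -> mu.-integrable setT (EFin \o f).
Proof.
move=> mf fg ig; apply: le_integrable ig => //; first exact/measurable_EFinP.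
move=> x _; rewrite /= lee_fin; apply: (le_trans (fg x)); exact: ler_norm.
Qed.

Lemma leb_integrable_le (f g : R -> R) : measurable_fun setT f -> (forall x, `|f x| <= g x) ->
  leb.-integrable setT (EFin \o g) -> leb.-integrable setT (EFin \o f).
Proof. move=> mf fg ig; exact: (@integrable_le _ (measurableTypeR R) leb f g mf fg ig). Qed.

Lemma ge0_integrable d (T : measurableType d) (mu : {measure set T -> \bar R}) (f : T -> R) :
  measurable_fun setT f -> (forall x, 0 <= f x) -> (\int[mu]_x (f x)%:E < +oo)%E ->
  mu.-integrable setT (EFin \o f).
Proof.
move=> mf f0 fi; apply/integrableP; split; first exact/measurable_EFinP.
by under eq_integral do rewrite /= ger0_norm//.
Qed.

Lemma integrable_expR_norm (C : R) : 0 <= C ->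
  leb.-integrable setT (EFin \o (fun x => C * expR (- `|x|))).
Proof.
move=> C0; apply: ge0_integrable; first by mfun.
  by move=> x; rewrite mulr_ge0 ?expR_ge0.
apply: (@integral_lt_pinfty_decay _ C 1) => //; first by mfun.
by move=> x; rewrite mul1r lexx mulr_ge0 ?expR_ge0.
Qed.

(** Completing the square: a t^2 - 2 |t| + 1/a >= 0. *)
Lemma gauss_decay (a A B t : R) : 0 < a -> 0 <= A -> 0 <= B ->
  (A * `|t| + B) * expR (- (a * t ^+ 2)) <= (A + B) * expR a^-1 * expR (- `|t|).
Proof.
move=> a0 A0 B0; have t0 := normr_ge0 t.
have h1 : A * `|t| + B <= (A + B) * expR `|t|.
  have := expR_ge1Dx `|t|; set e := expR _ => he; nra.
apply: (le_trans (ler_wpM2r (expR_ge0 _) h1)).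
rewrite -!mulrA ler_wpM2l ?addr_ge0// -!expRD ler_expR.
rewrite -(real_normK (num_real t)); set z := `|t| in t0 *.
rewrite -subr_ge0 (_ : _ - _ = a * (z - a^-1) ^+ 2); first by rewrite mulr_ge0 ?sqr_ge0// ltW.
by field; rewrite gt_eqF.
Qed.

Lemma is_derive_gauss (a x h : R) :
  is_derive h (1 : R) (fun h : R => expR (- (a * (x + h) ^+ 2)))
    (- (2 * a) * (x + h) * expR (- (a * (x + h) ^+ 2))).
Proof.
have d1 : is_derive h (1 : R) (fun h : R => - (a * (x + h) ^+ 2)) (- (2 * a * (x + h))).
  have := is_deriveN (is_deriveM (is_derive_cst a h (1 : R))
    (is_deriveX 2 (is_deriveD (is_derive_cst x h (1 : R)) (is_derive_id h (1 : R))))).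
  move=> /is_derive_eq; apply; rewrite /GRing.scale/= /cst/=.
  by rewrite !fctE/=; ring.
have := is_derive1_comp (is_derive_expR _) d1.
by move=> /is_derive_eq; apply; ring.
Qed.

Lemma is_derive_lin (a x h : R) : is_derive h (1 : R) (fun h : R => a * (x + h)) a.
Proof.
have := is_deriveM (is_derive_cst a h (1 : R))
    (is_deriveD (is_derive_cst x h (1 : R)) (is_derive_id h (1 : R))).
by move=> /is_derive_eq; apply; rewrite /GRing.scale/= !fctE/=; ring.
Qed.

(** Integration by parts on the whole line; it is obtained without boundary terms, as the
    derivative at h = 0 of an integral that translation by h leaves unchanged. *)
Lemma integral_gauss_parts (a xi : R) : 0 < a ->
  \int[leb]_x (x * expR (- (a * x ^+ 2)) * sin (xi * x)) =
  xi / (2 * a) * \int[leb]_x (expR (- (a * x ^+ 2)) * cos (xi * x)).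
Proof.
move=> a0.
pose f (h x : R) := expR (- (a * (x + h) ^+ 2)) * sin (xi * (x + h)).
pose g (h x : R) := xi * (expR (- (a * (x + h) ^+ 2)) * cos (xi * (x + h)))
   - 2 * a * ((x + h) * expR (- (a * (x + h) ^+ 2)) * sin (xi * (x + h))).
have df h x : is_derive h (1 : R) (f^~ x) (g h x).
  have := is_deriveM (is_derive_gauss a x h)
     (is_derive1_comp (is_derive_sin _) (is_derive_lin xi x h)).
  by move=> /is_derive_eq; apply; rewrite /g /GRing.scale/=; ring.
have dE h x : partial1of2 f h x = g h x.
  by rewrite partial1of2E; have [_] := df h x.
pose G (x : R) := (2 * a + `|xi|) * expR a^-1 * expR 1 * expR (- `|x|).
have bnd (A B h x : R) : 0 <= A -> 0 <= B -> `|h| <= 1 ->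
    (A * `|x + h| + B) * expR (- (a * (x + h) ^+ 2)) <= (A + B) * expR a^-1 * expR 1 * expR (- `|x|).
  move=> A0 B0 h1; apply: (le_trans (gauss_decay _ a0 A0 B0)).
  rewrite -[leRHS]mulrA ler_wpM2l ?mulr_ge0 ?addr_ge0 ?expR_ge0//.
  rewrite -expRD ler_expR; have := ler_normB (x + h) h; rewrite addrK => h2.
  lra.
have G0 x : 0 <= G x by rewrite !mulr_ge0 ?expR_ge0 ?addr_ge0 ?mulr_ge0// ltW.
have fb h x : `|h| <= 1 -> `|f h x| <= expR a^-1 * expR 1 * expR (- `|x|).
  move=> h1; have := bnd 0 1 h x (lexx _) ler01 h1.
  rewrite mul0r add0r !mul1r; apply: le_trans.
  by rewrite normrM ger0_norm ?expR_ge0// ler_piMr ?expR_ge0// ler_norml sin_geN1 sin_le1.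
have gb h x : `|h| <= 1 -> `|g h x| <= G x.
  move=> h1; apply: (le_trans _ (bnd (2 * a) `|xi| h x _ (normr_ge0 _) h1)); last by rewrite mulr_ge0// ltW.
  rewrite mulrDl addrC; apply: (le_trans (ler_normB _ _)); apply: lerD.
    rewrite !normrM ler_wpM2l// ger0_norm ?expR_ge0// ler_piMr ?expR_ge0//.
    by rewrite ler_norml cos_geN1 cos_le1.
  rewrite -[leRHS]mulrA normrM ger0_norm; last by rewrite mulr_ge0// ltW.
  rewrite ler_wpM2l; [by []|by rewrite mulr_ge0// ltW|].
  rewrite normrM normrM [`|expR _|]ger0_norm ?expR_ge0// ler_piMr ?mulr_ge0 ?expR_ge0//.
  by rewrite ler_norml sin_geN1 sin_le1.
have iG : leb.-integrable setT (EFin \o G).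
  by apply: integrable_expR_norm; rewrite !mulr_ge0 ?expR_ge0 ?addr_ge0 ?mulr_ge0// ltW.
have i1 h : `](-1), 1[%classic h -> `|h| <= 1 :> R.
  by rewrite /= in_itv/= ler_norml => /andP[? ?]; rewrite !ltW.
have if_ h : `](-1), 1[%classic h -> leb.-integrable setT (EFin \o f h).
  move=> /i1 h1; apply: (@leb_integrable_le (f h) (fun x => expR a^-1 * expR 1 * expR (- `|x|))).
  - by rewrite /f; mfun.
  - by move=> x; exact: fb.
  by apply: integrable_expR_norm; rewrite mulr_ge0 ?expR_ge0.
have I0 : `](-1), 1[%classic (0 : R) by rewrite /= in_itv/= ltrN10 ltr01.
have D := @differentiation_under_integral R _ _ leb f setT measurableT 0 (-1) 1 I0 if_
  (fun h x _ _ => @ex_derive _ _ _ _ _ _ _ (df h x)) G G0 iG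
  (fun h x Ih _ => ltac:(rewrite dE; exact: gb (i1 _ Ih))).
rewrite derive1E in D.
have cF h : \int[leb]_y f h y = \int[leb]_y f 0 y.
  rewrite /Rintegral; congr fine.
  have mf0 : measurable_fun setT (fun x => (f 0 x)%:E) by rewrite /f; mfun.
  by rewrite -(integral_shift_signed h mf0); apply: eq_integral => x _; rewrite /f addr0.
have D0 : 'D_1 (fun h => \int[leb]_y f h y) 0 = 0.
  by rewrite (_ : (fun h => _) = cst (\int[leb]_y f 0 y)) ?derive_cst//; apply/funext => h; exact: cF.
rewrite D0 in D.
have i1' : leb.-integrable setT (EFin \o (fun x => expR (- (a * x ^+ 2)) * cos (xi * x))).
  apply: (@leb_integrable_le _ (fun x => expR a^-1 * expR 1 * expR (- `|x|))); first by mfun.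
    move=> x; have := bnd 0 1 0 x (lexx _) ler01; rewrite normr0 ler01 => /(_ isT).
    rewrite mul0r add0r !mul1r addr0; apply: le_trans.
    by rewrite normrM ger0_norm ?expR_ge0// ler_piMr ?expR_ge0// ler_norml cos_geN1 cos_le1.
  by apply: integrable_expR_norm; rewrite mulr_ge0 ?expR_ge0.
have i2 : leb.-integrable setT (EFin \o (fun x => x * expR (- (a * x ^+ 2)) * sin (xi * x))).
  apply: (@leb_integrable_le _ (fun x => expR a^-1 * expR 1 * expR (- `|x|))); first by mfun.
    move=> x; have := bnd 1 0 0 x ler01 (lexx _); rewrite normr0 ler01 => /(_ isT).
    rewrite mul1r !addr0 mul1r; apply: le_trans.
    rewrite !normrM [`|expR _|]ger0_norm ?expR_ge0// ler_piMr ?mulr_ge0 ?expR_ge0//.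
    by rewrite ler_norml sin_geN1 sin_le1.
  by apply: integrable_expR_norm; rewrite mulr_ge0 ?expR_ge0.
have DE : \int[leb]_y partial1of2 f 0 y = xi * \int[leb]_x (expR (- (a * x ^+ 2)) * cos (xi * x))
   - 2 * a * \int[leb]_x (x * expR (- (a * x ^+ 2)) * sin (xi * x)).
  rewrite -RintegralZl// -RintegralZl// -RintegralB//.
  - by apply: eq_Rintegral => x _; rewrite dE /g !addr0.
  - by have := integrableZl measurableT xi i1'.
  - by have := integrableZl measurableT (2 * a) i2.
move: D; rewrite DE => /esym/eqP; rewrite subr_eq0 => /eqP H.
by rewrite mulrAC H; field; rewrite gt_eqF.
Qed.

Lemma integral_gauss_sin0 (a xi : R) : 0 < a ->
  \int[leb]_x (expR (- (a * x ^+ 2)) * sin (xi * x)) = 0.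
Proof.
move=> a0.
have mf : measurable_fun setT (fun x : R => (expR (- (a * x ^+ 2)) * sin (xi * x))%:E) by mfun.
have : \int[leb]_x (expR (- (a * x ^+ 2)) * sin (xi * x)) =
  - \int[leb]_x (expR (- (a * x ^+ 2)) * sin (xi * x)).
  rewrite {1}/Rintegral -integral_opp_signed//.
  under eq_integral => x _ do rewrite sqrrN mulrN sinN mulrN EFinN.
  rewrite integralN/= ?fineN//; apply: fin_num_adde_defl.
  rewrite fin_numN; apply: integrable_neg_fin_num => //.
  apply: (@leb_integrable_le _ (fun x => expR a^-1 * expR (- `|x|))); first by mfun.
    move=> x; have := gauss_decay x a0 (lexx 0) ler01; rewrite mul0r add0r !mul1r; apply: le_trans.
    by rewrite normrM ger0_norm ?expR_ge0// ler_piMr ?expR_ge0// ler_norml sin_geN1 sin_le1.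
  by apply: integrable_expR_norm; rewrite expR_ge0.
lra.
Qed.

(** As a function of xi the integral I satisfies I' = - xi I / (2 a), by differentiation under the
    integral sign and integral_gauss_parts. *)
Lemma integral_gauss_cos0 (a xi : R) : 0 < a ->
  \int[leb]_x (expR (- (a * x ^+ 2)) * cos (xi * x)) =
  Num.sqrt (pi / a) * expR (- (xi ^+ 2 / (4 * a))).
Proof.
move=> a0.
pose f (z x : R) := expR (- (a * x ^+ 2)) * cos (z * x).
pose F z := \int[leb]_x f z x.
pose h0 (x : R) := expR a^-1 * expR (- `|x|).
have ih0 : leb.-integrable setT (EFin \o h0) by apply: integrable_expR_norm; rewrite expR_ge0.
have fb z x : `|f z x| <= h0 x.
  have := gauss_decay x a0 (lexx 0) ler01; rewrite mul0r add0r !mul1r; apply: le_trans.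
  by rewrite normrM ger0_norm ?expR_ge0// ler_piMr ?expR_ge0// ler_norml cos_geN1 cos_le1.
have df z x : is_derive z (1 : R) (f^~ x) (- (x * expR (- (a * x ^+ 2)) * sin (z * x))).
  have d1 : is_derive z (1 : R) (fun z : R => z * x) x.
    have := is_deriveM (is_derive_id z (1 : R)) (is_derive_cst x z (1 : R)).
    by move=> /is_derive_eq; apply; rewrite /GRing.scale/= /cst/=; ring.
  have := is_deriveM (is_derive_cst (expR (- (a * x ^+ 2))) z (1 : R))
     (is_derive1_comp (is_derive_cos _) d1).
  by move=> /is_derive_eq; apply; rewrite /GRing.scale/= /cst/=; ring.
have gb x z : `|partial1of2 f z x| <= h0 x.
  rewrite partial1of2E; have [_ ->] := df z x.
  have := gauss_decay x a0 ler01 (lexx 0); rewrite mul1r !addr0 mul1r; apply: le_trans.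
  rewrite normrN !normrM [`|expR _|]ger0_norm ?expR_ge0// ler_piMr ?mulr_ge0 ?expR_ge0//.
  by rewrite ler_norml sin_geN1 sin_le1.
have if_ z : leb.-integrable setT (EFin \o f z).
  apply: (@leb_integrable_le (f z) h0) => //; rewrite /f; mfun.
have dF z : is_derive z (1 : R) F (- (z / (2 * a)) * F z).
  have I0 : `](z - 1), (z + 1)[%classic (z : R) by rewrite /= in_itv/= ltrBlDr ltrDl ltr01.
  have h0ge x : 0 <= h0 x by rewrite mulr_ge0 ?expR_ge0.
  have D := @differentiation_under_integral R _ _ leb f setT measurableT z _ _ I0 (fun h _ => if_ h)
    (fun h x _ _ => @ex_derive _ _ _ _ _ _ _ (df h x)) h0 h0ge ih0 (fun h x _ _ => gb x h).
  have D' := @derivable_under_integral R _ _ leb f setT measurableT z _ _ I0 (fun h _ => if_ h)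
    (fun h x _ _ => @ex_derive _ _ _ _ _ _ _ (df h x)) h0 h0ge ih0 (fun h x _ _ => gb x h).
  apply: DeriveDef; first exact: D'.
  rewrite -derive1E D mulNr -integral_gauss_parts//.
  rewrite -mulN1r -RintegralZl//; last first.
    apply: (@leb_integrable_le _ h0) => //; first by mfun.
    by move=> x; have := gb x z; rewrite partial1of2E; have [_ ->] := df z x; rewrite normrN.
  by apply: eq_Rintegral => x _; rewrite partial1of2E mulN1r; have [_ ->] := df z x.
pose E z := F z * expR (z ^+ 2 / (4 * a)).
have dE z : is_derive z (1 : R) E 0.
  have d1 : is_derive z (1 : R) (fun z : R => z ^+ 2 / (4 * a)) (z / (2 * a)).
    have := is_deriveM (is_deriveX 2 (is_derive_id z (1 : R))) (is_derive_cst (4 * a)^-1 z (1 : R)).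
    move=> /is_derive_eq; apply; rewrite /GRing.scale/= !fctE/= expr1.
    by field; rewrite gt_eqF.
  have := is_deriveM (dF z) (is_derive1_comp (is_derive_expR _) d1).
  by move=> /is_derive_eq; apply; rewrite /GRing.scale/=; ring.
have : E xi = E 0 by apply: is_derive_0_is_cst.
rewrite /E expr0n/= mul0r expR0 mulr1 => EE.
have F0 : F 0 = Num.sqrt (pi / a).
  rewrite /F /f /Rintegral; under eq_integral do rewrite mul0r cos0 mulr1.
  rewrite -[RHS](congr1 fine (integral_gauss 0 a0)); congr fine.
  by apply: eq_integral => x _; rewrite subr0.
by rewrite -F0 -EE -/(F xi) -mulrA -expRD subrr expR0 mulr1.
Qed.

Lemma integrable_gauss (a y : R) : 0 < a ->
  leb.-integrable setT (EFin \o (fun x => expR (- (a * (x - y) ^+ 2)))).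
Proof.
move=> a0; apply: (@ge0_integrable _ (measurableTypeR R)); first by mfun.
  by move=> x; exact: expR_ge0.
by rewrite integral_gauss// ltry.
Qed.

Lemma Rintegral_shift (c : R) (f : R -> R) : measurable_fun setT f ->
  \int[leb]_x f (x + c) = \int[leb]_x f x.
Proof.
move=> mf; rewrite /Rintegral; congr fine.
by apply: (@integral_shift_signed c (EFin \o f)); exact/measurable_EFinP.
Qed.

Let integrable_gauss_trig (a y xi : R) (trig : R -> R) : 0 < a -> measurable_fun setT trig ->
  (forall x, `|trig x| <= 1) ->
  leb.-integrable setT (EFin \o (fun x => expR (- (a * (x - y) ^+ 2)) * trig (xi * x))).
Proof.
move=> a0 mt tb; apply: leb_integrable_le (integrable_gauss y a0); first by mfun.
by move=> x; rewrite normrM ger0_norm ?expR_ge0// ler_piMr ?expR_ge0.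
Qed.

Let integral_gauss_trig (a xi A B : R) : 0 < a ->
  \int[leb]_x (A * (expR (- (a * x ^+ 2)) * cos (xi * x)) + B * (expR (- (a * x ^+ 2)) * sin (xi * x))) =
  A * (Num.sqrt (pi / a) * expR (- (xi ^+ 2 / (4 * a)))).
Proof.
move=> a0.
have tc : forall x : R, `|cos x| <= 1 by move=> x; rewrite ler_norml cos_geN1 cos_le1.
have ts : forall x : R, `|sin x| <= 1 by move=> x; rewrite ler_norml sin_geN1 sin_le1.
have mc : measurable_fun setT (@cos R) by mfun.
have ms : measurable_fun setT (@sin R) by mfun.
have e0 : (fun x : R => expR (- (a * x ^+ 2))) = (fun x : R => expR (- (a * (x - 0) ^+ 2))).
  by apply/funext => x; rewrite subr0.
have ic : leb.-integrable setT (EFin \o (fun x => expR (- (a * x ^+ 2)) * cos (xi * x))).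
  have := @integrable_gauss_trig a 0 xi _ a0 mc tc.
  by rewrite (_ : (fun x => _ * _) = (fun x : R => expR (- (a * x ^+ 2)) * cos (xi * x)))//; apply/funext => x; rewrite subr0.
have is_ : leb.-integrable setT (EFin \o (fun x => expR (- (a * x ^+ 2)) * sin (xi * x))).
  have := @integrable_gauss_trig a 0 xi _ a0 ms ts.
  by rewrite (_ : (fun x => _ * _) = (fun x : R => expR (- (a * x ^+ 2)) * sin (xi * x)))//; apply/funext => x; rewrite subr0.
rewrite RintegralD//; last 2 first.
- by have := integrableZl measurableT A ic.
- by have := integrableZl measurableT B is_.
by rewrite !RintegralZl// integral_gauss_sin0// mulr0 addr0 integral_gauss_cos0.
Qed.

(** The phase theta covers the cosine and the sine transforms at once. *)
Lemma integral_gauss_cos (a y xi theta : R) : 0 < a ->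
  \int[leb]_x (expR (- (a * (x - y) ^+ 2)) * cos (xi * x + theta)) =
  Num.sqrt (pi / a) * expR (- (xi ^+ 2 / (4 * a))) * cos (xi * y + theta).
Proof.
move=> a0; rewrite -(Rintegral_shift y); last by mfun.
rewrite mulrC -(integral_gauss_trig xi (cos (xi * y + theta)) (- sin (xi * y + theta)))//.
apply: eq_Rintegral => x _; rewrite addrK mulrDr -addrA cosD; ring.
Qed.

(** Completing the square: the product of two Gaussians in y is a Gaussian in y. *)
Lemma integral_gauss_conv (a b x : R) : 0 < a -> 0 < b ->
  (\int[leb]_y (expR (- (a * (x - y) ^+ 2)) * expR (- (b * y ^+ 2)))%R%:E =
   (Num.sqrt (pi / (a + b)) * expR (- (a * b / (a + b) * x ^+ 2)))%:E)%E.
Proof.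
move=> a0 b0; have ab : 0 < a + b by rewrite addr_gt0.
rewrite mulrC EFinM -(integral_gauss (a * x / (a + b)) ab).
rewrite -ge0_integralZl_real; [|by mfun|by move=> y; exact: expR_ge0|exact: expR_ge0].
apply: eq_integral => y _; rewrite -!expRD; congr ((expR _)%:E).
by field; rewrite gt_eqF.
Qed.

End log_time.

(** * Integrals depending on a parameter *)

Section parametric.
Context d1 d2 (T1 : measurableType d1) (T2 : measurableType d2) (R : realType).
Variables (m2 : {sigma_finite_measure set T2 -> \bar R}).

Lemma measurable_integral_param (f : T1 * T2 -> \bar R) : measurable_fun setT f ->
  measurable_fun setT (fun x => \int[m2]_y f (x, y))%E.
Proof.
move=> mf; under eq_fun do rewrite integralE.
apply: emeasurable_funB.
  rewrite (_ : (fun x => _) = (fun x => \int[m2]_y (f^\+)%E (x, y)))%E.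
    apply: (@measurable_fun_fubini_tonelli_F _ _ _ _ _ m2 (f^\+)%E (measurable_funepos mf)).
    by move=> x; exact: funepos_ge0.
  by apply/funext => x; apply: eq_integral => y _; rewrite !funeposE.
rewrite (_ : (fun x => _) = (fun x => \int[m2]_y (f^\-)%E (x, y)))%E.
  apply: (@measurable_fun_fubini_tonelli_F _ _ _ _ _ m2 (f^\-)%E (measurable_funeneg mf)).
  by move=> x; exact: funeneg_ge0.
by apply/funext => x; apply: eq_integral => y _; rewrite !funenegE.
Qed.

Lemma measurable_Rintegral_param (f : T1 * T2 -> R) : measurable_fun setT f ->
  measurable_fun setT (fun x => \int[m2]_y f (x, y)).
Proof.
move=> mf; rewrite /Rintegral.
apply: (measurableT_comp (@fine_measurable R setT measurableT)).
by apply: (measurable_integral_param (f := EFin \o f)); exact/measurable_EFinP.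
Qed.

End parametric.

Section parametric_fubini.
Context d1 d2 (T1 : measurableType d1) (T2 : measurableType d2) (R : realType).
Variables (m1 : {sigma_finite_measure set T1 -> \bar R}) (m2 : {sigma_finite_measure set T2 -> \bar R}).

Lemma integrable_Rintegral_param (f : T1 * T2 -> R) : measurable_fun setT f ->
  (\int[m1]_x \int[m2]_y `|f (x, y)|%:E < +oo)%E ->
  m1.-integrable setT (EFin \o (fun x => \int[m2]_y f (x, y))).
Proof.
move=> mf fi.
have mg : measurable_fun setT (fun z => `|f z|%:E) by apply/measurable_EFinP/measurableT_comp.
apply/integrableP; split.
  by apply/measurable_EFinP; exact: measurable_Rintegral_param.
apply: le_lt_trans fi; apply: ge0_le_integral => //.
- apply/measurableT_comp => //.
  by apply/measurable_EFinP; exact: measurable_Rintegral_param.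
- exact: (measurable_integral_param m2 mg).
move=> x _ /=.
have [fin|] := boolP ((\int[m2]_y `|f (x, y)|%:E)%E < +oo)%E; last by rewrite -leNgt leye_eq => /eqP ->; rewrite leey.
have ix : m2.-integrable setT (EFin \o (fun y => f (x, y))).
  apply/integrableP; split => //; apply/measurable_EFinP.
  exact: (measurableT_comp mf (measurable_pair1 x)).
apply: (@le_trans _ _ (`| \int[m2]_y (f (x, y))%:E |)%E); last first.
  by apply: (le_trans (le_abse_integral _ _ _)) => //; exact: (measurable_int _ ix).
by rewrite /Rintegral -abse_EFin fineK//; exact: integrable_fin_num.
Qed.

(** Fubini for real-valued integrals, from the finiteness of one iterated integral of the absolute
    value. *)
Lemma Rintegral_fubini (f : T1 * T2 -> R) : measurable_fun setT f ->
  (\int[m1]_x \int[m2]_y `|f (x, y)|%:E < +oo)%E ->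
  \int[m1]_x \int[m2]_y f (x, y) = \int[m2]_y \int[m1]_x f (x, y).
Proof.
move=> mf fi.
have mE : measurable_fun setT (EFin \o f) by exact/measurable_EFinP.
have mi : (m1 \x m2)%E.-integrable setT (EFin \o f) by apply/(integrable12ltyP m1 m2 mE).
have HF := @Fubini _ _ _ _ _ m1 m2 _ mi.
rewrite {1}/Rintegral [RHS]/Rintegral.
transitivity (fine (\int[m1]_x \int[m2]_y (EFin \o f) (x, y))%E).
  congr fine; apply: ae_eq_integral => //.
  - by apply/measurable_EFinP; exact: measurable_Rintegral_param.
  - exact: (measurable_integral_param m2 mE).
  have := ae_integrable1 mi; apply: filterS => x ix _.
  by rewrite /= fineK//; exact: (integrable_fin_num _ ix).
rewrite HF; congr fine; apply/esym.
have mS : measurable_fun setT (fun z : T2 * T1 => f (z.2, z.1)).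
  apply: (measurableT_comp mf).
  exact: (measurable_fun_pair (@measurable_snd _ _ T2 T1) (@measurable_fst _ _ T2 T1)).
apply: ae_eq_integral => //.
- apply/measurable_EFinP. exact: (measurable_Rintegral_param m1 mS).
- apply: (measurable_integral_param m1 (f := fun z => (f (z.2, z.1))%:E)). exact/measurable_EFinP.
have := ae_integrable2 mi; apply: filterS => x ix _.
by rewrite /= fineK//; exact: (integrable_fin_num _ ix).
Qed.

End parametric_fubini.

Section lebesgue_rV_integral.
Context {R : realType}.
Local Notation leb := (@lebesgue_measure R).
Local Notation mu n := (lebesgue_rV R n).

Lemma rV_cons0 n (x : R) (v : 'rV[R]_n) : rV_cons (x, v) ord0 ord0 = x.
Proof. by rewrite mxE unlift_none. Qed.

Lemma rV_consS n (x : R) (v : 'rV[R]_n) j : rV_cons (x, v) ord0 (lift ord0 j) = v ord0 j.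
Proof. by rewrite mxE liftK. Qed.

Lemma ge0_integral_rVS n (f : 'rV[R]_n.+1 -> \bar R) : measurable_fun setT f -> (forall x, 0 <= f x)%E ->
  (\int[mu n.+1]_x f x = \int[leb]_x \int[mu n]_v f (rV_cons (x, v)))%E.
Proof.
move=> mf f0.
rewrite -(@fubini_tonelli1 _ _ _ _ _ leb (mu n) (f \o @rV_cons R n)) => [||x]; last exact: f0.
  have := @ge0_integral_pushforward _ _ (measurableTypeR R * 'rV[R]_n)%type _ R _ (@measurable_rV_cons R n) (leb \x mu n)%E setT f measurableT mf (fun y _ => f0 y).
  by rewrite preimage_setT.
exact: (measurableT_comp mf (@measurable_rV_cons R n)).
Qed.

Lemma integral_rV0 (f : 'rV[R]_0 -> \bar R) : measurable_fun setT f ->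
  (\int[mu 0]_x f x = f 0%R)%E.
Proof. by move=> mf; rewrite /= integral_dirac// diracT mul1e. Qed.

(** Tonelli, by induction on the dimension. *)
Lemma integral_prod_coord n (f : 'I_n -> R -> R) (c : 'I_n -> R) :
  (forall i, measurable_fun setT (f i)) -> (forall i x, 0 <= f i x) ->
  (forall i, \int[leb]_x (f i x)%:E = (c i)%:E)%E ->
  (\int[mu n]_x (\prod_i f i (x ord0 i))%:E = (\prod_i c i)%:E)%E.
Proof.
have mprod m (g : 'I_m -> R -> R) : (forall i, measurable_fun setT (g i)) ->
    measurable_fun setT (fun x : 'rV[R]_m => \prod_i g i (x ord0 i)).
  move=> mg; apply: measurable_prod => i _.
  exact: (measurableT_comp (mg i) (measurable_coord i)).
elim: n f c => [|n IH] f c mf f0 fc.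
  by rewrite integral_rV0 ?big_ord0//; apply/measurable_EFinP; exact: mprod.
rewrite ge0_integral_rVS; last 2 first.
- by apply/measurable_EFinP; exact: mprod.
- by move=> x; rewrite lee_fin prodr_ge0.
rewrite big_ord_recl mulrC EFinM -fc -ge0_integralZl_real; [|exact: (mf ord0)|exact: f0|]; last first.
  rewrite prodr_ge0// => i _; rewrite -lee_fin -fc integral_ge0// => x _.
  by rewrite lee_fin.
apply: eq_integral => x _.
under eq_integral => v _.
  rewrite big_ord_recl rV_cons0; under eq_bigr do rewrite rV_consS; over.
rewrite ge0_integralZl_real//; last 2 first.
- by apply: (mprod n (fun i => f (lift ord0 i))) => i.
- by move=> v; rewrite prodr_ge0.
by rewrite (IH (fun i => f (lift ord0 i)) (fun i => c (lift ord0 i)))// -EFinM mulrC.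
Qed.

Lemma integrable_rV_cons n (f : 'rV[R]_n.+1 -> R) : (mu n.+1).-integrable setT (EFin \o f) ->
  (leb \x mu n)%E.-integrable setT (EFin \o (f \o @rV_cons R n)).
Proof.
move=> fi; have mf := measurable_int _ fi.
have mfc : measurable_fun setT ((EFin \o f) \o @rV_cons R n).
  exact: (measurableT_comp mf (@measurable_rV_cons R n)).
apply/integrableP; split => //.
have /integrableP[_] := fi.
rewrite -[X in (_ -> X < _)%E](_ : \int[mu n.+1]_x `|(EFin \o f) x| = _)%E//.
have mfa : measurable_fun setT (abse \o (EFin \o f)) by exact: measurableT_comp.
have := @ge0_integral_pushforward _ _ (measurableTypeR R * 'rV[R]_n)%type _ R _ (@measurable_rV_cons R n) (leb \x mu n)%E setT _ measurableT mfa (fun y _ => abse_ge0 _).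
by rewrite preimage_setT.
Qed.

Lemma integral_rVS n (f : 'rV[R]_n.+1 -> R) : (mu n.+1).-integrable setT (EFin \o f) ->
  \int[mu n.+1]_x f x = \int[leb]_x \int[mu n]_v f (rV_cons (x, v)).
Proof.
move=> fi; have ic := integrable_rV_cons fi.
have mf := measurable_int _ fi.
have := @integral_pushforward _ _ (measurableTypeR R * 'rV[R]_n)%type _ R _ (@measurable_rV_cons R n) (leb \x mu n)%E setT (EFin \o f) mf.
rewrite preimage_setT => /(_ ic measurableT) H.
rewrite /Rintegral; transitivity (fine (\int[(leb \x mu n)]_z (EFin \o (f \o @rV_cons R n)) z)%E).
  by congr fine.
rewrite -(integral12_prod_meas1 ic); congr fine; apply: ae_eq_integral => //.
- apply: (measurable_integral_param (mu n)); exact: (measurable_int _ ic).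
- apply/measurable_EFinP; apply: (measurable_Rintegral_param (mu n) (f := f \o @rV_cons R n)).
  apply/measurable_EFinP; exact: (measurable_int _ ic).
have := ae_integrable1 ic; apply: filterS => x ix _.
by rewrite /= fineK//; exact: (integrable_fin_num _ ix).
Qed.

(** * Gaussians in Euclidean space *)

Lemma measurable_dot d (T : measurableType d) n (f g : T -> 'rV[R]_n) :
  measurable_fun setT f -> measurable_fun setT g ->
  measurable_fun setT (fun x => dot (f x) (g x)).
Proof.
move=> mf mg; apply: measurable_sum => i; apply: measurable_funM.
- exact: (measurableT_comp (measurable_coord i) mf).
- exact: (measurableT_comp (measurable_coord i) mg).
Qed.

Lemma measurable_subrV d (T : measurableType d) n (f g : T -> 'rV[R]_n) :
  measurable_fun setT f -> measurable_fun setT g ->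
  measurable_fun setT (fun x => f x - g x).
Proof.
move=> mf mg; apply: measurable_fun_coordP => i; under eq_fun do rewrite !mxE.
apply: measurable_funB.
- exact: (measurableT_comp (measurable_coord i) mf).
- exact: (measurableT_comp (measurable_coord i) mg).
Qed.

Lemma measurable_enorm d (T : measurableType d) n (f : T -> 'rV[R]_n) :
  measurable_fun setT f -> measurable_fun setT (fun x => enorm (f x)).
Proof.
move=> mf; apply: (measurableT_comp (continuous_measurable_fun (@sqrt_continuous R))).
exact: measurable_dot.
Qed.

Lemma dot_ge0 n (x : 'rV[R]_n) : 0 <= dot x x.
Proof. by apply: sumr_ge0 => i _; rewrite -expr2 sqr_ge0. Qed.

Lemma enorm_ge0 n (x : 'rV[R]_n) : 0 <= enorm x.
Proof. exact: sqrtr_ge0. Qed.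

Lemma sqr_enorm n (x : 'rV[R]_n) : enorm x ^+ 2 = dot x x.
Proof. by rewrite sqr_sqrtr// dot_ge0. Qed.

Lemma enorm_eq0 n (x : 'rV[R]_n) : (enorm x == 0) = (x == 0).
Proof.
rewrite sqrtr_eq0; apply/idP/eqP => [x0|->]; last first.
  by rewrite /dot big1// => i _; rewrite mxE mul0r.
apply/rowP => i; rewrite mxE.
have : dot x x = 0 by apply/eqP; rewrite eq_le x0 dot_ge0.
move/psumr_eq0P => /(_ (fun i _ => sqr_ge0 (x ord0 i))) /(_ i isT)/eqP.
by rewrite -expr2 sqrf_eq0 => /eqP.
Qed.

Lemma enorm_gt0 n (x : 'rV[R]_n) : (0 < enorm x) = (x != 0).
Proof. by rewrite lt0r enorm_eq0 enorm_ge0 andbT. Qed.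

Lemma enormZ n (a : R) (x : 'rV[R]_n) : enorm (a *: x) = `|a| * enorm x.
Proof.
rewrite /enorm (_ : dot _ _ = a ^+ 2 * dot x x).
  by rewrite sqrtrM ?sqr_ge0// sqrtr_sqr.
by rewrite /dot mulr_sumr; apply: eq_bigr => i _; rewrite !mxE; ring.
Qed.

Lemma dotBC n (x y : 'rV[R]_n) : dot (x - y) (x - y) = dot (y - x) (y - x).
Proof. by apply: eq_bigr => i _; rewrite !mxE; ring. Qed.

Lemma dot_le2 n (x y : 'rV[R]_n) : dot x x <= 2 * dot (x - y) (x - y) + 2 * dot y y.
Proof.
rewrite /dot !mulr_sumr -big_split/=; apply: ler_sum => i _; rewrite !mxE.
by have := sqr_ge0 (x ord0 i - 2 * y ord0 i); nra.
Qed.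

Lemma dotB_le2 n (x y : 'rV[R]_n) : dot (x - y) (x - y) <= 2 * dot x x + 2 * dot y y.
Proof.
rewrite /dot !mulr_sumr -big_split/=; apply: ler_sum => i _; rewrite !mxE.
by have := sqr_ge0 (x ord0 i + y ord0 i); nra.
Qed.

Lemma expR_dot n (a : R) (x y : 'rV[R]_n) :
  expR (- (a * dot (x - y) (x - y))) = \prod_i expR (- (a * (x ord0 i - y ord0 i) ^+ 2)).
Proof.
rewrite -expR_sum; congr expR; rewrite /dot mulr_sumr -sumrN.
by apply: eq_bigr => i _; rewrite !mxE expr2.
Qed.

Lemma integral_gauss_rV n (a : R) (y : 'rV[R]_n) : 0 < a ->
  (\int[mu n]_x (expR (- (a * dot (x - y) (x - y))))%:E = (Num.sqrt (pi / a) ^+ n)%:E)%E.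
Proof.
move=> a0; under eq_integral do rewrite expR_dot.
rewrite (@integral_prod_coord n (fun i t => expR (- (a * (t - y ord0 i) ^+ 2))) (fun=> Num.sqrt (pi / a))).
- by rewrite prodr_const card_ord.
- by move=> i; mfun.
- by move=> i x; exact: expR_ge0.
- by move=> i; exact: integral_gauss.
Qed.

Lemma integral_gauss_conv_rV n (a b : R) (x : 'rV[R]_n) : 0 < a -> 0 < b ->
  (\int[mu n]_y (expR (- (a * dot (x - y) (x - y))) * expR (- (b * dot y y)))%R%:E =
   (Num.sqrt (pi / (a + b)) ^+ n * expR (- (a * b / (a + b) * dot x x)))%:E)%E.
Proof.
move=> a0 b0.
have E (c : R) (z : 'rV[R]_n) : expR (- (c * dot z z)) = \prod_i expR (- (c * z ord0 i ^+ 2)).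
  rewrite -[z in LHS]subr0 expR_dot; apply: eq_bigr => i _.
  by rewrite !mxE subr0.
under eq_integral do rewrite expR_dot E -big_split/=.
rewrite (@integral_prod_coord n (fun i t => expR (- (a * (x ord0 i - t) ^+ 2)) * expR (- (b * t ^+ 2)))
  (fun i => Num.sqrt (pi / (a + b)) * expR (- (a * b / (a + b) * x ord0 i ^+ 2)))).
- by rewrite big_split/= prodr_const card_ord -E.
- by move=> i; mfun.
- by move=> i t; rewrite mulr_ge0 ?expR_ge0.
- by move=> i; exact: integral_gauss_conv.
Qed.

Lemma measurable_gauss_rV d (T : measurableType d) n (a : R) (f : T -> 'rV[R]_n) :
  measurable_fun setT f -> measurable_fun setT (fun x => expR (- (a * dot (f x) (f x)))).
Proof. by move=> mf; have := measurable_dot mf mf; move=> ?; mfun. Qed.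

Lemma integrable_gauss_rV n (a : R) (y : 'rV[R]_n) : 0 < a ->
  (mu n).-integrable setT (EFin \o (fun x => expR (- (a * dot (x - y) (x - y))))).
Proof.
move=> a0; apply: ge0_integrable.
- apply: measurable_gauss_rV; apply: measurable_subrV; [exact: measurable_id|exact: measurable_cst].
- by move=> x; exact: expR_ge0.
- by rewrite integral_gauss_rV// ltry.
Qed.

(** By induction on the dimension: integrating over the first coordinate only shifts the phase of
    the remaining cosine, which is why the statement carries a phase. *)
Lemma integral_gauss_cos_rV n (a : R) (y z : 'rV[R]_n) (theta : R) : 0 < a ->
  \int[mu n]_x (expR (- (a * dot (x - y) (x - y))) * cos (dot z x + theta)) =
  Num.sqrt (pi / a) ^+ n * expR (- (dot z z / (4 * a))) * cos (dot z y + theta).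
Proof.
move=> a0; elim: n y z theta => [|n IH] y z theta.
  rewrite /Rintegral integral_rV0.
    by rewrite /dot !big_ord0 mulr0 oppr0 expR0 mul0r oppr0 expR0 expr0 !mul1r.
  apply/measurable_EFinP; apply: measurable_funM.
    by apply: measurable_gauss_rV; apply: measurable_subrV; [exact: measurable_id|exact: measurable_cst].
  have := measurable_dot (@measurable_cst _ _ _ _ setT z) (@measurable_id _ _ setT).
  by move=> ?; mfun.
pose y' : 'rV[R]_n := \row_j y ord0 (lift ord0 j).
pose z' : 'rV[R]_n := \row_j z ord0 (lift ord0 j).
have cE (x : R) (v : 'rV[R]_n) : dot (rV_cons (x, v) - y) (rV_cons (x, v) - y) =
    (x - y ord0 ord0) ^+ 2 + dot (v - y') (v - y').
  rewrite /dot big_ord_recl !mxE unlift_none expr2; congr (_ + _).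
  by apply: eq_bigr => j _; rewrite !mxE liftK.
have zE (x : R) (v : 'rV[R]_n) : dot z (rV_cons (x, v)) = z ord0 ord0 * x + dot z' v.
  rewrite /dot big_ord_recl !mxE unlift_none; congr (_ + _).
  by apply: eq_bigr => j _; rewrite !mxE liftK.
have zzE : dot z z = z ord0 ord0 ^+ 2 + dot z' z'.
  by rewrite /dot big_ord_recl expr2; congr (_ + _); apply: eq_bigr => j _; rewrite !mxE.
have zyE : dot z y = z ord0 ord0 * y ord0 ord0 + dot z' y'.
  by rewrite /dot big_ord_recl; congr (_ + _); apply: eq_bigr => j _; rewrite !mxE.
rewrite integral_rVS; last first.
  apply: integrable_le (integrable_gauss_rV y a0).
    apply: measurable_funM.
      by apply: measurable_gauss_rV; apply: measurable_subrV; [exact: measurable_id|exact: measurable_cst].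
    have := measurable_dot (@measurable_cst _ _ _ _ setT z) (@measurable_id _ _ setT).
    by move=> ?; mfun.
  move=> x; rewrite normrM ger0_norm ?expR_ge0// ler_piMr ?expR_ge0//.
  by rewrite ler_norml cos_geN1 cos_le1.
transitivity (\int[leb]_x (Num.sqrt (pi / a) ^+ n * expR (- (dot z' z' / (4 * a))) *
  (expR (- (a * (x - y ord0 ord0) ^+ 2)) * cos (z ord0 ord0 * x + (dot z' y' + theta))))).
  apply: eq_Rintegral => x _.
  transitivity (\int[mu n]_v (expR (- (a * (x - y ord0 ord0) ^+ 2)) *
    (expR (- (a * dot (v - y') (v - y'))) * cos (dot z' v + (z ord0 ord0 * x + theta))))).
    apply: eq_Rintegral => v _; rewrite cE zE mulrDr opprD expRD mulrA.
    by congr (_ * cos _); ring.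
  rewrite RintegralZl//; last first.
    apply: integrable_le (integrable_gauss_rV y' a0).
      apply: measurable_funM.
        by apply: measurable_gauss_rV; apply: measurable_subrV; [exact: measurable_id|exact: measurable_cst].
      have := measurable_dot (@measurable_cst _ _ _ _ setT z') (@measurable_id _ _ setT).
      by move=> ?; mfun.
    move=> v; rewrite normrM ger0_norm ?expR_ge0// ler_piMr ?expR_ge0//.
    by rewrite ler_norml cos_geN1 cos_le1.
  rewrite IH mulrCA; congr (_ * (_ * cos _)); ring.
rewrite RintegralZl//; last first.
  apply: (@leb_integrable_le R (fun x => expR (- (a * (x - y ord0 ord0) ^+ 2)) * cos (z ord0 ord0 * x + (dot z' y' + theta))) (fun x => expR (- (a * (x - y ord0 ord0) ^+ 2)))).
  - by mfun.
  - move=> v; rewrite normrM ger0_norm ?expR_ge0// ler_piMr ?expR_ge0//.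
    by rewrite ler_norml cos_geN1 cos_le1.
  - exact: integrable_gauss.
rewrite integral_gauss_cos// zzE zyE -addrA.
have -> : expR (- ((z ord0 ord0 ^+ 2 + dot z' z') / (4 * a))) =
    expR (- (dot z' z' / (4 * a))) * expR (- (z ord0 ord0 ^+ 2 / (4 * a))).
  by rewrite -expRD; congr expR; ring.
by rewrite [_ ^+ n.+1]exprSr; ring.
Qed.

Lemma lebesgue_rV_set1 n (a : 'rV[R]_n.+1) : mu n.+1 [set a] = 0%E.
Proof.
pose a0 := a ord0 ord0; pose a' : 'rV[R]_n := \row_j a ord0 (lift ord0 j).
rewrite /= /cons_measure /pushforward.
rewrite (_ : _ @^-1` _ = [set a0] `*` [set a']); last first.
  apply/seteqP; split => -[x v] /=.
    move=> /rowP h; split; first by have := h ord0; rewrite rV_cons0.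
    by apply/rowP => j; have := h (lift ord0 j); rewrite rV_consS !mxE.
  by move=> [-> ->]; apply/rowP => j; rewrite !mxE; case: unliftP => [k|] ->; rewrite ?mxE.
have m0 : measurable [set a'].
  rewrite (_ : [set _] = \bigcap_(i in [set: 'I_n]) ((fun v : 'rV[R]_n => v ord0 i) @^-1` [set a' ord0 i])).
    apply: fin_bigcap_measurable => // i _; rewrite -[X in measurable X]setTI.
    exact: measurable_coord.
  apply/seteqP; split => v /=.
    by move=> -> i _.
  by move=> h; apply/rowP => i; exact: (h i).
rewrite product_measure1E// [X in (X * _)%E](_ : _ = 0%E) ?mul0e//.
exact: lebesgue_measure_set1.
Qed.

(** Links the topology of row vectors to the product sigma-algebra: an open set is a countable
    union of boxes with rational centres and rational sizes. *)
Lemma open_measurable_rV n (A : set 'rV[R]_n) : open A -> measurable A.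
Proof.
move=> oA.
pose box (qk : 'rV[rat]_n * nat) : set 'rV[R]_n :=
  [set v | forall i, `|ratr (qk.1 ord0 i) - v ord0 i| < (qk.2.+1%:R)^-1].
have mbox qk : measurable (box qk).
  rewrite (_ : box qk = \bigcap_(i in [set: 'I_n])
     ((fun v : 'rV[R]_n => v ord0 i) @^-1` (ball (ratr (qk.1 ord0 i) : R) (qk.2.+1%:R)^-1))).
    apply: fin_bigcap_measurable => // i _; rewrite -[X in measurable X]setTI.
    by apply: measurable_coord => //; exact: measurable_ball.
  apply/seteqP; split => v /=.
    by move=> h i _; exact: h.
  by move=> h i; exact: (h i).
have -> : A = \bigcup_(qk : 'rV[rat]_n * nat) (if `[< box qk `<=` A >] then box qk else set0).
  apply/seteqP; split => v; last first.
    by move=> [qk _]; case: ifPn => // /asboolP; apply.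
  move=> Av; have /nbhs_ballP[e /= e0 be] := oA v Av.
  have e2 : 0 < e / 2 by rewrite divr_gt0.
  have [k hk] : exists k : nat, (k.+1%:R)^-1 < e / 2.
    exists (Num.Def.archi_bound (e / 2)^-1).
    rewrite invf_plt ?posrE//; apply: (lt_trans (archi_boundP _)); first by rewrite invr_ge0 ltW.
    by rewrite ltr_nat.
  have k0 : 0 < (k.+1%:R : R)^-1 by rewrite invr_gt0.
  have hq i : exists q : rat, `|ratr q - v ord0 i| < (k.+1%:R)^-1.
    move: k0; move: (k.+1%:R)^-1 => d d0.
    have : v ord0 i - d < v ord0 i + d by lra.
    move=> /rat_in_itvoo[q]; rewrite in_itv/= => /andP[h1 h2]; exists q.
    by rewrite ltr_norml; apply/andP; split; lra.
  pose q : 'rV[rat]_n := \row_i xget 0 [set q | `|ratr q - v ord0 i| < (k.+1%:R)^-1].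
  have qP i : `|ratr (q ord0 i) - v ord0 i| < (k.+1%:R)^-1.
    rewrite mxE; case: xgetP => [y -> //|/=]; case: (hq i) => x hx /(_ x) []; exact: hx.
  exists (q, k) => //; case: ifPn => [_|/asboolP]; first by move=> i; exact: qP.
  case => w hw; apply: be; split => // i j; rewrite ord1.
  rewrite /ball/= (_ : _ - _ = (ratr (q ord0 j) - w ord0 j) - (ratr (q ord0 j) - v ord0 j)); last by ring.
  apply: (le_lt_trans (ler_normB _ _)); rewrite [e]splitr ltrD//.
    exact: lt_trans (hw j) hk.
  exact: lt_trans (qP j) hk.
apply: countable_bigcupT_measurable; first exact: countableP.
by move=> qk; case: ifP.
Qed.

Lemma continuous_measurable_rV n (f : 'rV[R]_n -> R) : continuous f -> measurable_fun setT f.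
Proof.
move=> /continuousP cf; apply: (measurability _ (RGenOpens.measurableE R)).
move=> _ [_ [a [b ->] <-]]; rewrite setTI; apply: open_measurable_rV.
exact/cf/interval_open.
Qed.

Lemma compact_measurable_rV n (K : set 'rV[R]_n) : compact K -> measurable K.
Proof.
move=> cK; rewrite -[K]setCK; apply: measurableC; apply: open_measurable_rV.
by apply: closed_openC; apply: compact_closed => //; exact: norm_hausdorff.
Qed.

End lebesgue_rV_integral.

(** * The heat kernel and the Riesz kernel *)

Section gauss_kernel.
Context {R : realType} {n : nat}.
Local Notation leb := (@lebesgue_measure R).
Local Notation mu := (lebesgue_rV R n).
Implicit Types (x y z : 'rV[R]_n) (a b tau sigma : R).

Definition gauss_kernel a z : R := Num.sqrt (a / pi) ^+ n * expR (- (a * dot z z)).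

(** The heat kernel (4 pi t)^(-n/2) exp(-|z|^2 / 4t) at the time t = exp(tau). *)
Definition heat_kernel tau z : R := gauss_kernel (expR (- tau) / 4) z.

(** The integral of the heat kernel against t^(sigma-1) dt. For sigma = s it is Gamma s times the
    Riesz kernel, and it keeps the value +oo at the origin; for sigma = -s it is the jump kernel of
    the fractional Laplacian up to a constant. *)
Definition heat_integral sigma z : \bar R :=
  (\int[leb]_tau (expR (sigma * tau) * heat_kernel tau z)%:E)%E.

Lemma sqrtr_expn (c : R) : 0 < c -> Num.sqrt c ^+ n = expR (n%:R / 2 * ln c).
Proof.
move=> c0; rewrite -{1}(lnK c0) (_ : expR (ln c) = expR (ln c / 2) ^+ 2); last first.
  by rewrite expr2 -expRD; congr expR; field.
rewrite sqrtr_sqr ger0_norm ?expR_ge0// -expRM_natl; congr expR; ring.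
Qed.

Lemma heat_kernelE tau z : heat_kernel tau z =
  expR (- (n%:R / 2 * ln (4 * pi))) *
  expR (- (n%:R / 2 * tau) - dot z z / 4 * expR (- tau)).
Proof.
have p0 := pi_gt0 R.
rewrite /heat_kernel /gauss_kernel sqrtr_expn; last by rewrite divr_gt0// divr_gt0// expR_gt0.
have -> : ln (expR (- tau) / 4 / pi) = - tau - ln (4 * pi).
  rewrite -mulrA -invfM lnM ?posrE ?expR_gt0 ?invr_gt0 ?mulr_gt0//.
  by rewrite expRK lnV ?posrE ?mulr_gt0// mulrC.
by rewrite -!expRD; congr expR; ring.
Qed.

Lemma gauss_kernel_ge0 a z : 0 <= gauss_kernel a z.
Proof. by rewrite mulr_ge0 ?expR_ge0// exprn_ge0// sqrtr_ge0. Qed.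

Lemma heat_kernel_ge0 tau z : 0 <= heat_kernel tau z.
Proof. exact: gauss_kernel_ge0. Qed.

Lemma heat_integral_ge0 sigma z : (0 <= heat_integral sigma z)%E.
Proof. by apply: integral_ge0 => x _; rewrite lee_fin mulr_ge0 ?expR_ge0 ?heat_kernel_ge0. Qed.

Lemma measurable_heat_kernel d (T : measurableType d) (f : T -> R) (g : T -> 'rV[R]_n) :
  measurable_fun setT f -> measurable_fun setT g ->
  measurable_fun setT (fun t => heat_kernel (f t) (g t)).
Proof.
move=> mf mg; under eq_fun do rewrite heat_kernelE.
have mgg := measurable_dot mg mg. apply: measurable_funM; first exact: measurable_cst. apply: (measurableT_comp (@measurable_expR R)). apply: measurable_funD. mfun. mfun.
Qed.

Lemma measurable_heat_integral d (T : measurableType d) (sigma : R) (g : T -> 'rV[R]_n) :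
  measurable_fun setT g -> measurable_fun setT (fun t => heat_integral sigma (g t)).
Proof.
move=> mg; apply: (measurable_integral_param leb (f := fun z : T * measurableTypeR R => (expR (sigma * z.2) * heat_kernel z.2 (g z.1))%:E)).
apply/measurable_EFinP/measurable_funM; first by mfun.
by apply: measurable_heat_kernel => //; exact: (measurableT_comp mg).
Qed.

Lemma integral_gauss_kernel a y : 0 < a -> (\int[mu]_x (gauss_kernel a (x - y))%:E = 1)%E.
Proof.
move=> a0; have p0 := pi_gt0 R.
rewrite ge0_integralZl_real; last 3 first.
- apply: measurable_gauss_rV; apply: measurable_subrV; [exact: measurable_id|exact: measurable_cst].
- by move=> x; exact: expR_ge0.
- by rewrite exprn_ge0// sqrtr_ge0.
rewrite integral_gauss_rV// -EFinM -exprMn -sqrtrM ?divr_ge0 1?ltW//.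
rewrite (_ : a / pi * (pi / a) = 1) ?sqrtr1 ?expr1n//.
by rewrite mulrACA [X in X * _]mulrC mulrACA; rewrite mulfV ?mulfV ?mulr1 ?gt_eqF//.
Qed.

Lemma heat_integral_le sigma z w : dot z z <= dot w w ->
  (heat_integral sigma w <= heat_integral sigma z)%E.
Proof.
move=> zw; apply: ge0_le_integral => //.
- by move=> x _; rewrite lee_fin mulr_ge0 ?expR_ge0 ?heat_kernel_ge0.
- by apply/measurable_EFinP/measurable_funM; [mfun|exact: measurable_heat_kernel].
- by apply/measurable_EFinP/measurable_funM; [mfun|exact: measurable_heat_kernel].
move=> tau _; rewrite lee_fin ler_wpM2l ?expR_ge0// !heat_kernelE ler_wpM2l ?expR_ge0//.
rewrite ler_expR lerD2l lerN2 ler_wpM2r ?expR_ge0//; lra.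
Qed.

Definition heat_integral_const sigma : R :=
  expR (- (n%:R / 2 * ln (4 * pi))) * (4 `^ (n%:R / 2 - sigma) * Gamma (n%:R / 2 - sigma)).

Lemma heat_integral_const_gt0 sigma : sigma < n%:R / 2 -> 0 < heat_integral_const sigma.
Proof. by move=> h; rewrite !mulr_gt0 ?expR_gt0 ?powR_gt0 ?Gamma_gt0 ?subr_gt0. Qed.

Lemma enorm_powR z (q : R) : z != 0 -> dot z z `^ q = enorm z `^ (2 * q).
Proof. by move=> z0; rewrite -sqr_enorm -powR_mulrn ?enorm_ge0// -powRrM. Qed.

Lemma heat_integralE sigma z : sigma < n%:R / 2 -> z != 0 ->
  heat_integral sigma z = (heat_integral_const sigma * enorm z `^ (- (n%:R - 2 * sigma)))%:E.
Proof.
move=> sn z0; rewrite /heat_integral.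
have d0 : 0 < dot z z by rewrite -sqr_enorm exprn_gt0// enorm_gt0.
transitivity (\int[leb]_tau (expR (- (n%:R / 2 * ln (4 * pi))) *
   expR (- ((n%:R / 2 - sigma) * tau) - dot z z / 4 * expR (- tau)))%:E)%E.
  apply: eq_integral => tau _; congr (_%:E); rewrite heat_kernelE mulrCA; congr (_ * _).
  by rewrite -expRD; congr expR; ring.
rewrite ge0_integralZl_real; [|mfun|by move=> ?; exact: expR_ge0|exact: expR_ge0].
rewrite Gamma_log_scaleV ?subr_gt0 ?divr_gt0// -EFinM; congr (_%:E).
rewrite /heat_integral_const -!mulrA; congr (_ * _).
rewrite powRM ?invr_ge0//; last exact: ltW.
rewrite enorm_powR// (_ : 2 * _ = - (n%:R - 2 * sigma)); last by field.
have -> : (4^-1 : R) `^ (- (n%:R / 2 - sigma)) = 4 `^ (n%:R / 2 - sigma).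
  by rewrite /powR !gt_eqF ?invr_gt0// lnV ?posrE// mulrNN.
by ring.
Qed.

(** A negative power of |z| is a superposition of Gaussians. *)
Lemma power_gauss_integral (m : R) z : 0 < m -> z != 0 ->
  (\int[leb]_sigma (expR (m / 2 * sigma) * expR (- (expR sigma * dot z z)))%:E =
   (Gamma (m / 2) * enorm z `^ (- m))%:E)%E.
Proof.
move=> m0 z0; have d0 : 0 < dot z z by rewrite -sqr_enorm exprn_gt0// enorm_gt0.
under eq_integral do rewrite -expRD [expR _ * dot z z]mulrC.
rewrite Gamma_log_scale ?divr_gt0// enorm_powR// mulrC; congr ((_ * _ `^ _)%:E).
by field.
Qed.

End gauss_kernel.

#[local] Arguments lebesgue_rV : simpl never.

Section riesz_identity.
Context {R : realType} {n' : nat}.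
Local Notation n := n'.+1.
Local Notation leb := (@lebesgue_measure R).
Local Notation mu := (lebesgue_rV R n).
Implicit Types (x y z : 'rV[R]_n).

Lemma ae_neq (a : 'rV[R]_n) : {ae mu, forall y : 'rV[R]_n, y != a}.
Proof.
exists [set a]; split; [|exact: lebesgue_rV_set1|].
  rewrite -[X in measurable X]setCK; apply: measurableC; apply: open_measurable_rV.
  by apply: closed_openC; exact/accessible_closed_set1/hausdorff_accessible/norm_hausdorff.
by move=> y /= /negP; rewrite negbK => /eqP.
Qed.

Lemma measurable_enorm_powR (q : R) : measurable_fun setT (fun y : 'rV[R]_n => enorm y `^ q).
Proof. by apply: (measurableT_comp (measurable_powR q)); exact: measurable_enorm. Qed.

(** The factor of riesz_potential_power; the kernel is not divided by Gamma s, whence its presence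
    in the numerator. *)
Definition riesz_factor (s a : R) : R :=
  4 `^ (- s) * Gamma s * Gamma (a / 2) * Gamma ((n%:R - 2 * s - a) / 2) /
  (Gamma ((2 * s + a) / 2) * Gamma ((n%:R - a) / 2)).

(** The superposition of riesz_potential_power once space is integrated out: sigma is the logarithmic
    scale of the power and tau - sigma the logarithmic time of the heat kernel, a shear after which the
    integral over sigma is a Gamma integral. *)
Let riesz_time (s a : R) x (tau sigma : R) : R :=
  expR (s * tau) * (1 + 4 * expR tau) `^ (- (n%:R / 2)) *
  expR (a / 2 * sigma - dot x x / (1 + 4 * expR tau) * expR sigma).

Let riesz_space_integral (s a : R) x (tau sigma : R) :
  (\int[mu]_y (expR (s * (tau - sigma)) * heat_kernel (tau - sigma) (x - y) *
     (expR ((2 * s + a) / 2 * sigma) * expR (- (expR sigma * dot y y))))%:E =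
   (riesz_time s a x tau sigma)%:E)%E.
Proof.
set A := expR (- (tau - sigma)) / 4; set B := expR sigma.
have A0 : 0 < A by rewrite divr_gt0 ?expR_gt0.
have B0 : 0 < B by exact: expR_gt0.
have p0 := pi_gt0 R.
transitivity (\int[mu]_y (expR (s * (tau - sigma)) * expR ((2 * s + a) / 2 * sigma) * Num.sqrt (A / pi) ^+ n *
   (expR (- (A * dot (x - y) (x - y))) * expR (- (B * dot y y))))%:E)%E.
  by apply: eq_integral => y _; congr (_%:E); rewrite /heat_kernel /gauss_kernel -/A -/B; ring.
rewrite ge0_integralZl_real; last 3 first.
- apply: measurable_funM; apply: measurable_gauss_rV; last exact: measurable_id.
  by apply: measurable_subrV; [exact: measurable_cst|exact: measurable_id].
- by move=> y; rewrite mulr_ge0 ?expR_ge0.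
- by rewrite !mulr_ge0 ?expR_ge0// exprn_ge0// sqrtr_ge0.
rewrite integral_gauss_conv_rV// -EFinM; congr (_%:E).
have AB0 : 0 < A + B by rewrite addr_gt0.
have e0 := expR_gt0 tau; have T0 : 0 < 1 + 4 * expR tau by rewrite addr_gt0// mulr_gt0.
have AE : A * expR tau * 4 = B.
  by rewrite /A /B mulrAC divfK// -expRD; congr expR; ring.
have eA : 0 < expR (- (tau - sigma)) := expR_gt0 _.
have ABE : A + B = A * (1 + 4 * expR tau) by rewrite -AE; ring.
have BE : A * B / (A + B) = B / (1 + 4 * expR tau).
  by rewrite ABE; field; rewrite !gt_eqF.
rewrite BE /riesz_time -[LHS]mulrA [X in _ * X]mulrA -exprMn -sqrtrM ?divr_ge0 1?ltW//.
rewrite (_ : A / pi * (pi / (A + B)) = (1 + 4 * expR tau)^-1); last first.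
  by rewrite ABE; move: (pi : R) p0 => P P0; field; rewrite !gt_eqF.
rewrite sqrtr_expn ?invr_gt0// lnV ?posrE// /powR gt_eqF// -!expRD; congr expR.
by rewrite -/B; field; rewrite gt_eqF.
Qed.

Let riesz_time_ge0 s a x tau sigma : 0 <= riesz_time s a x tau sigma.
Proof. by rewrite !mulr_ge0 ?expR_ge0 ?powR_ge0. Qed.

Let measurable_riesz_time s a x :
  measurable_fun setT (fun w : R * R => riesz_time s a x w.1 w.2).
Proof.
have e0 (t : R) : 0 < 1 + 4 * expR t by rewrite addr_gt0// mulr_gt0// expR_gt0.
rewrite (_ : (fun w => _) = (fun w : R * R => expR (s * w.1) * (1 + 4 * expR w.1) `^ (- (n%:R / 2)) *
  expR (a / 2 * w.2 - dot x x * expR (- ln (1 + 4 * expR w.1)) * expR w.2))).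
  apply: measurable_funM; last by mfun.
  apply: measurable_funM; first by mfun.
  apply: (measurableT_comp (measurable_powR _)); mfun.
by apply/funext => w; rewrite /riesz_time expRN lnK ?posrE.
Qed.

Let integral_riesz_time (s a : R) x : 0 < s -> 0 < a -> a < n%:R - 2 * s -> x != 0 ->
  (\int[leb]_tau \int[leb]_sigma (riesz_time s a x tau sigma)%:E =
   (4 `^ (- s) * Gamma s * Gamma (a / 2) * Gamma ((n%:R - 2 * s - a) / 2) /
     Gamma ((n%:R - a) / 2) * enorm x `^ (- a))%:E)%E.
Proof.
move=> s0 a0 an x0.
have d0 : 0 < dot x x by rewrite -sqr_enorm exprn_gt0// enorm_gt0.
have e0 (t : R) : 0 < 1 + 4 * expR t by rewrite addr_gt0// mulr_gt0// expR_gt0.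
pose h (t : R) := expR (s * t) * (1 + expR t) `^ (- ((n%:R - a) / 2)).
have mh : measurable_fun setT h.
  apply: measurable_funM; first by mfun.
  by apply: (measurableT_comp (measurable_powR _)); mfun.
have h0 t : 0 <= h t by rewrite mulr_ge0 ?expR_ge0 ?powR_ge0.
transitivity (\int[leb]_tau (Gamma (a / 2) * enorm x `^ (- a) * 4 `^ (- s) * h (tau + ln 4))%:E)%E.
  apply: eq_integral => t _; rewrite /riesz_time.
  rewrite ge0_integralZl_real; [|mfun|by move=> ?; exact: expR_ge0|by rewrite mulr_ge0 ?expR_ge0 ?powR_ge0].
  rewrite Gamma_log_scale ?divr_gt0// -EFinM; congr (_%:E).
  rewrite powRM ?invr_ge0; [|exact: ltW|exact: ltW].
  rewrite enorm_powR// (_ : 2 * - (a / 2) = - a); last by field.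
  rewrite /h expRD lnK ?posrE// [expR t * 4]mulrC.
  have -> : (1 + 4 * expR t)^-1 `^ (- (a / 2)) = (1 + 4 * expR t) `^ (a / 2).
    by rewrite /powR !gt_eqF ?invr_gt0// lnV ?posrE// mulrNN.
  rewrite mulrDr expRD.
  have -> : (1 + 4 * expR t) `^ (- ((n%:R - a) / 2)) = (1 + 4 * expR t) `^ (- (n%:R / 2)) * (1 + 4 * expR t) `^ (a / 2).
    rewrite /powR !gt_eqF// -expRD; congr expR; ring.
  have -> : (4 : R) `^ (- s) = expR (- (s * ln 4)) by rewrite /powR gt_eqF// mulNr.
  by rewrite expRN; field; rewrite gt_eqF// expR_gt0.
rewrite ge0_integralZl_real; last 3 first.
- by apply: (measurableT_comp mh); mfun.
- by move=> t; exact: h0.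
- by rewrite !mulr_ge0 ?powR_ge0// ltW// Gamma_gt0// divr_gt0.
have -> : (\int[leb]_t (h (t + ln 4))%:E = \int[leb]_t (h t)%:E)%E.
  by apply: (integral_shift (ln 4) (f := EFin \o h)); [exact/measurable_EFinP|move=> t; rewrite lee_fin].
rewrite Beta_log//; last by rewrite ltr_pdivlMr//; lra.
rewrite -EFinM; congr (_%:E).
rewrite (_ : (n%:R - a) / 2 - s = (n%:R - 2 * s - a) / 2); last by field.
move: (Gamma s) (Gamma (a / 2)) (Gamma _) (_ `^ _) (_ `^ _) (Gamma _) => g1 g2 g3 g4 g5 g6.
by ring.
Qed.

(** Both the kernel and the power are superpositions of Gaussians. Tonelli brings the space
    integral inside, where it is a convolution of two Gaussians; the integral over sigma is then a
    Gamma integral and the one over tau a Beta integral. *)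
Lemma riesz_potential_power (s a : R) x : 0 < s -> 0 < a -> a < n%:R - 2 * s -> x != 0 ->
  (\int[mu]_y (heat_integral s (x - y) * (enorm y `^ (- (2 * s + a)))%:E) =
   (riesz_factor s a * enorm x `^ (- a))%:E)%E.
Proof.
move=> s0 a0 an x0; set m := 2 * s + a.
have m0 : 0 < m by rewrite addr_gt0// mulr_gt0.
have Gm : 0 < Gamma (m / 2) by rewrite Gamma_gt0// divr_gt0.
pose A (t : R) y := expR (s * t) * heat_kernel t (x - y).
pose B (t : R) y := expR (m / 2 * t) * expR (- (expR t * dot y y)).
have A0 t y : 0 <= A t y by rewrite mulr_ge0 ?expR_ge0 ?heat_kernel_ge0.
have B0 t y : 0 <= B t y by rewrite mulr_ge0 ?expR_ge0.
have mxy d (T : measurableType d) (g : T -> 'rV[R]_n) : measurable_fun setT g ->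
    measurable_fun setT (fun t => x - g t).
  by move=> mg; apply: measurable_subrV => //; exact: measurable_cst.
have mA d (T : measurableType d) (f : T -> R) (g : T -> 'rV[R]_n) : measurable_fun setT f ->
    measurable_fun setT g -> measurable_fun setT (fun t => A (f t) (g t)).
  move=> mf mg; apply: measurable_funM; first by mfun.
  by apply: measurable_heat_kernel => //; exact: mxy.
have mB d (T : measurableType d) (f : T -> R) (g : T -> 'rV[R]_n) : measurable_fun setT f ->
    measurable_fun setT g -> measurable_fun setT (fun t => B (f t) (g t)).
  move=> mf mg; have mgg := measurable_dot mg mg.
  apply: measurable_funM; [mfun|apply: (measurableT_comp (@measurable_expR R)); mfun].
have H0 : ((Gamma (m / 2))%:E * \int[mu]_y (heat_integral s (x - y) * (enorm y `^ (- m))%:E) =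
    \int[mu]_y \int[leb]_sigma \int[leb]_tau (A tau y * B sigma y)%R%:E)%E.
  rewrite -ge0_integralZl//; last 3 first.
  - apply: emeasurable_funM; first by apply: measurable_heat_integral; exact: mxy.
    by apply/measurable_EFinP; exact: measurable_enorm_powR.
  - by move=> y _; rewrite mule_ge0// ?heat_integral_ge0// lee_fin powR_ge0.
  - by rewrite lee_fin ltW.
  apply: ae_eq_integral => //.
  - apply: emeasurable_funM; first exact: measurable_cst.
    apply: emeasurable_funM; first by apply: measurable_heat_integral; exact: mxy.
    by apply/measurable_EFinP; exact: measurable_enorm_powR.
  - apply: (measurable_integral_param leb (f := fun z : 'rV[R]_n * measurableTypeR R =>
      \int[leb]_tau (A tau z.1 * B z.2 z.1)%R%:E))%E.
    apply: (measurable_integral_param leb (f := fun w : ('rV[R]_n * measurableTypeR R) * measurableTypeR R =>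
      (A w.2 w.1.1 * B w.1.2 w.1.1)%R%:E))%E.
    apply/measurable_EFinP/measurable_funM; [apply: mA|apply: mB].
    + exact: measurable_snd.
    + exact: (measurableT_comp measurable_fst measurable_fst).
    + exact: (measurableT_comp measurable_snd measurable_fst).
    + exact: (measurableT_comp measurable_fst measurable_fst).
  apply: filterS (ae_neq 0) => y y0 _.
  rewrite muleCA -EFinM -power_gauss_integral// -ge0_integralZl//; last 2 first.
  - by apply/measurable_EFinP; apply: mB; [exact: measurable_id|exact: measurable_cst].
  - exact: heat_integral_ge0.
  apply: eq_integral => t _; rewrite muleC -ge0_integralZl_real.
  - by apply: eq_integral => t' _; rewrite mulrC.
  - by apply: mA; [exact: measurable_id|exact: measurable_cst].
  - by move=> t'; exact: A0.
  - exact: B0.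
have H2 := @fubini_tonelli _ _ 'rV[R]_n (measurableTypeR R) R mu leb (fun z : 'rV[R]_n * measurableTypeR R =>
      \int[leb]_tau (A tau z.1 * B z.2 z.1)%R%:E)%E.
rewrite H2/= in H0; last 2 first.
- apply: (measurable_integral_param leb (f := fun w : ('rV[R]_n * measurableTypeR R) * measurableTypeR R =>
      (A w.2 w.1.1 * B w.1.2 w.1.1)%R%:E))%E.
  apply/measurable_EFinP/measurable_funM; [apply: mA|apply: mB].
  + exact: measurable_snd.
  + exact: (measurableT_comp measurable_fst measurable_fst).
  + exact: (measurableT_comp measurable_snd measurable_fst).
  + exact: (measurableT_comp measurable_fst measurable_fst).
- by move=> z; apply: integral_ge0 => t _; rewrite lee_fin mulr_ge0.
have H3 : (\int[leb]_sigma \int[mu]_y \int[leb]_tau (A tau y * B sigma y)%R%:E =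
   \int[leb]_sigma \int[leb]_tau (riesz_time s a x tau sigma)%:E)%E.
  apply: eq_integral => sigma _.
  have := @fubini_tonelli _ _ 'rV[R]_n (measurableTypeR R) R mu leb (fun z : 'rV[R]_n * measurableTypeR R =>
      (A z.2 z.1 * B sigma z.1)%R%:E) => /= ->; last 2 first.
  - apply/measurable_EFinP/measurable_funM; [apply: mA|apply: mB].
    + exact: measurable_snd.
    + exact: measurable_fst.
    + exact: measurable_cst.
    + exact: measurable_fst.
  - by move=> z; rewrite lee_fin mulr_ge0.
  rewrite -(integral_shift (- sigma) (f := fun t => \int[mu]_y (A t y * B sigma y)%R%:E)%E); last 2 first.
  - apply: (measurable_integral_param mu (f := fun z : measurableTypeR R * 'rV[R]_n => (A z.1 z.2 * B sigma z.2)%R%:E)).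
    apply/measurable_EFinP/measurable_funM; [apply: mA|apply: mB].
    + exact: measurable_fst.
    + exact: measurable_snd.
    + exact: measurable_cst.
    + exact: measurable_snd.
  - by move=> t; apply: integral_ge0 => y _; rewrite lee_fin mulr_ge0.
  by apply: eq_integral => t _; exact: riesz_space_integral.
rewrite H3 in H0.
have H4 := @fubini_tonelli _ _ (measurableTypeR R) (measurableTypeR R) R leb leb (fun w => (riesz_time s a x w.1 w.2)%:E).
rewrite -H4/= in H0; last 2 first.
- by apply/measurable_EFinP; exact: measurable_riesz_time.
- by move=> z; rewrite lee_fin riesz_time_ge0.
have {}H0 := etrans H0 (integral_riesz_time s0 a0 an x0).
rewrite (mule_eq_EFin Gm H0); congr (_%:E).
rewrite /riesz_factor invfM -/m.
move: (Gamma s) (Gamma (a / 2)) (Gamma ((n%:R - 2 * s - a) / 2)) (Gamma (m / 2))^-1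
  (Gamma ((n%:R - a) / 2))^-1 (4 `^ (- s)) (enorm x `^ (- a)) => ? ? ? ? ? ? ?.
by ring.
Qed.

End riesz_identity.

(** * Monotonicity of the Riesz factor *)

Section riesz_factor_theory.
Context {R : realType} {n' : nat}.
Local Notation n := n'.+1.
Local Notation leb := (@lebesgue_measure R).
Local Notation mu := (lebesgue_rV R n).
Local Notation rf := (@riesz_factor R n').
Implicit Types (x y z : 'rV[R]_n).

Lemma riesz_factor_sym (s a : R) : rf s (n%:R - 2 * s - a) = rf s a.
Proof.
rewrite /riesz_factor.
rewrite (_ : n%:R - 2 * s - (n%:R - 2 * s - a) = a); last by ring.
rewrite (_ : 2 * s + (n%:R - 2 * s - a) = n%:R - a); last by ring.
rewrite (_ : n%:R - (n%:R - 2 * s - a) = 2 * s + a); last by ring.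
move: (Gamma (a / 2)) (Gamma ((n%:R - 2 * s - a) / 2)) (Gamma ((2 * s + a) / 2))
  (Gamma ((n%:R - a) / 2)) => A B C D.
by congr (_ / _); [exact: mulrAC|exact: mulrC].
Qed.

Lemma riesz_factor_gt0 (s a : R) : 0 < s -> 0 < a -> a < n%:R - 2 * s -> 0 < rf s a.
Proof.
move=> s0 a0 an; rewrite /riesz_factor !mulr_gt0 ?invr_gt0 ?mulr_gt0 ?powR_gt0 ?Gamma_gt0 ?divr_gt0//; lra.
Qed.

(** The link with the constant of the equation: it makes |x|^-b, for b = (n - 2s)/2 - alpha, an
    exact solution of the linear equation. *)
Lemma hardy_gammaE (s alpha : R) : 0 < s -> 0 <= alpha < (n%:R - 2 * s) / 2 ->
  hardy_gamma n s alpha * rf s ((n%:R - 2 * s) / 2 - alpha) = Gamma s.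
Proof.
move=> s0 /andP[a0 an]; rewrite /hardy_gamma /riesz_factor lt_eqF//.
rewrite (_ : ((n%:R - 2 * s) / 2 - alpha) / 2 = (n%:R - 2 * s - 2 * alpha) / 4); last by field.
rewrite (_ : (n%:R - 2 * s - ((n%:R - 2 * s) / 2 - alpha)) / 2 = (n%:R - 2 * s + 2 * alpha) / 4); last by field.
rewrite (_ : (2 * s + ((n%:R - 2 * s) / 2 - alpha)) / 2 = (n%:R + 2 * s - 2 * alpha) / 4); last by field.
rewrite (_ : (n%:R - ((n%:R - 2 * s) / 2 - alpha)) / 2 = (n%:R + 2 * s + 2 * alpha) / 4); last by field.
have Gamma4_gt0 (t : R) : 0 < t -> 0 < Gamma (t / 4) by move=> t0; rewrite Gamma_gt0// divr_gt0.
have h1 : 0 < n%:R - 2 * s - 2 * alpha by lra.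
have h2 : 0 < n%:R - 2 * s + 2 * alpha by lra.
have h3 : 0 < n%:R + 2 * s - 2 * alpha by lra.
have h4 : 0 < n%:R + 2 * s + 2 * alpha by lra.
move: (Gamma4_gt0 _ h1) (Gamma4_gt0 _ h2) (Gamma4_gt0 _ h3) (Gamma4_gt0 _ h4) => g1 g2 g3 g4.
have -> : (4 : R) `^ (- s) = (2 `^ (2 * s))^-1.
  by rewrite powRN powRrM powR_mulrn// (_ : (2 : R) ^+ 2 = 4)//; ring.
have p2 : (0 : R) < 2 `^ (2 * s) by rewrite powR_gt0.
move: (Gamma _) (Gamma _) (Gamma _) (Gamma _) g1 g2 g3 g4 => G1 G2 G3 G4 g1 g2 g3 g4.
by field; rewrite !gt_eqF.
Qed.

Lemma hardy_gamma_ge0 (s alpha : R) : 0 < s -> 0 <= alpha <= (n%:R - 2 * s) / 2 ->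
  0 <= hardy_gamma n s alpha.
Proof.
move=> s0 /andP[a0]; rewrite le_eqVlt => /predU1P[->|an]; first by rewrite /hardy_gamma eqxx.
have := hardy_gammaE s0 (introT andP (conj a0 an)) => H.
have r0 : 0 < rf s ((n%:R - 2 * s) / 2 - alpha) by apply: riesz_factor_gt0 => //; lra.
by rewrite -(pmulr_lge0 _ r0) H ltW// Gamma_gt0.
Qed.

Definition unit_vector : 'rV[R]_n := delta_mx ord0 ord0.

Lemma dot_unit_vector : dot unit_vector unit_vector = 1.
Proof.
rewrite /dot (bigD1 ord0)//= big1 ?addr0 => [|i i0]; first by rewrite mxE eqxx mulr1.
by rewrite mxE (negbTE i0) andbF mulr0.
Qed.

Lemma enorm_unit_vector : enorm unit_vector = 1.
Proof. by rewrite /enorm dot_unit_vector sqrtr1. Qed.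

Lemma unit_vector_neq0 : unit_vector != 0.
Proof. by rewrite -enorm_gt0 enorm_unit_vector. Qed.

Lemma heat_integral_ge (sigma t : R) z : sigma < n%:R / 2 -> 0 < t -> dot z z <= t ^+ 2 ->
  ((heat_integral_const (n := n) sigma * t `^ (- (n%:R - 2 * sigma)))%:E <= heat_integral sigma z)%E.
Proof.
move=> sn t0 zt; have tE : enorm (t *: unit_vector) = t.
  by rewrite enormZ enorm_unit_vector mulr1 gtr0_norm.
have tn : t *: unit_vector != 0 by rewrite -enorm_gt0 tE.
have := heat_integralE sn tn; rewrite tE => <-.
by apply: heat_integral_le; rewrite -[dot (t *: _) _]sqr_enorm tE.
Qed.

(** A lower bound, up to a constant, of the Riesz kernel at a unit vector times |y|^-(2s+a). It is
    comparable to |y|^-(2s+a) near 0 and to |y|^-(n+a) at infinity. *)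
Definition riesz_weight (s a : R) y : R :=
  enorm y `^ (- (2 * s + a)) * Num.sqrt (2 + 2 * dot y y) `^ (- (n%:R - 2 * s)).

Lemma measurable_riesz_weight s a : measurable_fun setT (riesz_weight s a).
Proof.
apply: measurable_funM; first exact: measurable_enorm_powR.
apply: (measurableT_comp (measurable_powR _)).
apply: (measurableT_comp (continuous_measurable_fun (@sqrt_continuous R))).
have := measurable_dot (@measurable_id _ 'rV[R]_n setT) (@measurable_id _ 'rV[R]_n setT) => ?.
mfun.
Qed.

Lemma riesz_weight_ge0 s a y : 0 <= riesz_weight s a y.
Proof. by rewrite mulr_ge0 ?powR_ge0. Qed.

(** The finiteness of the integral of riesz_potential_power at a unit vector spares polar
    coordinates: all integrability of powers below is deduced from it. *)
Lemma integral_riesz_weight (s a : R) : 0 < s -> 0 < a -> a < n%:R - 2 * s ->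
  (\int[mu]_y (riesz_weight s a y)%:E < +oo)%E.
Proof.
move=> s0 a0 an; have sn : s < n%:R / 2 by lra.
have c0 := heat_integral_const_gt0 (n := n) sn.
have H := riesz_potential_power s0 a0 an unit_vector_neq0.
have : ((heat_integral_const (n := n) s)%:E * \int[mu]_y (riesz_weight s a y)%:E < +oo)%E.
  rewrite -ge0_integralZl_real; last 3 first.
  - exact: measurable_riesz_weight.
  - exact: riesz_weight_ge0.
  - exact: ltW.
  apply: (@le_lt_trans _ _ (rf s a * enorm unit_vector `^ (- a))%:E); last by rewrite ltry.
  rewrite -H; apply: ge0_le_integral => //.
  - by move=> y _; rewrite lee_fin mulr_ge0 ?riesz_weight_ge0// ltW.
  - by apply/measurable_EFinP; apply: measurable_funM => //; exact: measurable_riesz_weight.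
  - apply: emeasurable_funM.
      by apply: measurable_heat_integral; apply: measurable_subrV; [exact: measurable_cst|exact: measurable_id].
    by apply/measurable_EFinP; exact: measurable_enorm_powR.
  move=> y _; rewrite /riesz_weight mulrCA mulrC EFinM; apply: lee_wpmul2r; first by rewrite lee_fin powR_ge0.
  apply: heat_integral_ge => //; first by rewrite sqrtr_gt0 ltr_pwDl// mulr_ge0// dot_ge0.
  rewrite sqr_sqrtr; last by rewrite addr_ge0// mulr_ge0// dot_ge0.
  by have := dotB_le2 unit_vector y; rewrite dot_unit_vector mulr1.
have : (0 <= \int[mu]_y (riesz_weight s a y)%:E)%E.
  by apply: integral_ge0 => y _; rewrite lee_fin riesz_weight_ge0.
case: (\int[mu]_y _)%E => [r _ _||//]; first by rewrite ltry.
by move=> _; rewrite mulry gtr0_sg// mul1e.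
Qed.

Lemma heat_integral_gt0 (sigma : R) z : sigma < n%:R / 2 -> (0 < heat_integral sigma z)%E.
Proof.
move=> sn; have d0 := dot_ge0 z.
have h1 : dot z z <= Num.sqrt (1 + dot z z) ^+ 2 by rewrite sqr_sqrtr ?addr_ge0// lerDr.
have h2 : 0 < Num.sqrt (1 + dot z z) by rewrite sqrtr_gt0 ltr_pwDl.
apply: lt_le_trans (heat_integral_ge sn h2 h1).
by rewrite lte_fin mulr_gt0 ?heat_integral_const_gt0// powR_gt0.
Qed.

(** The difference of the symmetrised powers of exponents a and b; since riesz_factor is symmetric
    about Q/2, its Riesz potential at a unit vector is 2 (riesz_factor s a - riesz_factor s b). *)
Let power_gap (s a b t : R) : R :=
  t `^ (- (2 * s + a)) + t `^ (- (2 * s + (n%:R - 2 * s - a))) -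
  (t `^ (- (2 * s + b)) + t `^ (- (2 * s + (n%:R - 2 * s - b)))).

(** The factorisation shows the sign: both factors vanish at t = 1 and change sign there. *)
Let power_gapE (s a b t : R) : 0 < t -> power_gap s a b t =
  expR (- ((2 * s + a) * ln t)) * ((1 - expR (- ((b - a) * ln t))) *
     (1 - expR (- ((n%:R - 2 * s - b - a) * ln t)))).
Proof.
move=> t0; rewrite /power_gap /powR gt_eqF//; set L := ln t.
rewrite (_ : - (2 * s + (n%:R - 2 * s - a)) * L =
   - ((2 * s + a) * L) + (- ((b - a) * L) + - ((n%:R - 2 * s - b - a) * L))); last by ring.
rewrite (_ : - (2 * s + (n%:R - 2 * s - b)) * L =
   - ((2 * s + a) * L) + - ((n%:R - 2 * s - b - a) * L)); last by ring.
rewrite (_ : - (2 * s + b) * L = - ((2 * s + a) * L) + - ((b - a) * L)); last by ring.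
rewrite mulNr !expRD.
move: (expR _) (expR _) (expR _) => A B C.
by ring.
Qed.

Let expR_factor_ge0 (u v L : R) : 0 < u -> 0 < v ->
  0 <= (1 - expR (- (u * L))) * (1 - expR (- (v * L))).
Proof.
move=> u0 v0; have [L0|L0] := lerP 0 L.
  by rewrite mulr_ge0// subr_ge0 expR_le1 oppr_le0 mulr_ge0// ltW.
by rewrite mulr_le0// subr_le0 -expR0 ler_expR oppr_ge0 ltW// pmulr_rlt0.
Qed.

Let power_gap_ge0 (s a b t : R) : a < b -> b <= (n%:R - 2 * s) / 2 -> 0 < t -> 0 <= power_gap s a b t.
Proof.
move=> ab bn t0; rewrite power_gapE// mulr_ge0 ?expR_ge0//; apply: expR_factor_ge0; lra.
Qed.

Let power_gap_eq0 (s a b t : R) : a < b -> b <= (n%:R - 2 * s) / 2 -> 0 < t -> power_gap s a b t = 0 -> t = 1.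
Proof.
move=> ab bn t0; rewrite power_gapE// => /eqP; rewrite !mulf_eq0 gt_eqF ?expR_gt0//=.
have aux (u : R) : 0 < u -> (1 - expR (- (u * ln t)) == 0) -> t = 1.
  move=> u0; rewrite subr_eq0 eq_sym -[X in _ == X]expR0 => /eqP/expR_inj/eqP.
  by rewrite oppr_eq0 mulf_eq0 gt_eqF//= ln_eq0// => /eqP.
by case/orP; apply: aux; lra.
Qed.

Let measurable_riesz_integrand (s q : R) x :
  measurable_fun setT (fun y => (heat_integral s (x - y) * (enorm y `^ q)%:E)%E).
Proof.
apply: emeasurable_funM.
  by apply: measurable_heat_integral; apply: measurable_subrV; [exact: measurable_cst|exact: measurable_id].
by apply/measurable_EFinP; exact: measurable_enorm_powR.
Qed.

(** The integral of the kernel against power_gap is nonnegative. If it were 0, power_gap would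
    vanish almost everywhere, so that |y| = 1 for almost every y; then the potentials of the two powers would
    agree everywhere, which the values at a vector of norm 2 refute. *)
Lemma riesz_factor_lt (s a b : R) : 0 < s -> 0 < a -> a < b -> b <= (n%:R - 2 * s) / 2 ->
  rf s b < rf s a.
Proof.
move=> s0 a0 ab bn.
have an : a < n%:R - 2 * s by lra.
have b0 : 0 < b by lra.
have bn' : b < n%:R - 2 * s by lra.
have sn : s < n%:R / 2 by lra.
pose D y := power_gap s a b (enorm y).
have mpow q : measurable_fun setT (fun y : 'rV[R]_n => enorm y `^ q) by exact: measurable_enorm_powR.
have mD : measurable_fun setT D.
  by apply: measurable_funB; apply: measurable_funD.
have J q x : 0 < q -> q < n%:R - 2 * s -> x != 0 -> (\int[mu]_y (heat_integral s (x - y) * (enorm y `^ (- (2 * s + q)))%:E) =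
   (rf s q * enorm x `^ (- q))%:E)%E by move=> q0 qn x0; exact: riesz_potential_power.
pose P q y : \bar R := (heat_integral s (unit_vector - y) * (enorm y `^ (- (2 * s + q)))%:E)%E.
have P0 q y : (0 <= P q y)%E by rewrite mule_ge0 ?heat_integral_ge0// lee_fin powR_ge0.
have mP q : measurable_fun setT (P q) by exact: measurable_riesz_integrand.
have mk : measurable_fun setT (fun y => heat_integral s (unit_vector - y)).
  by apply: measurable_heat_integral; apply: measurable_subrV; [exact: measurable_cst|exact: measurable_id].
have IP q : 0 < q -> q < n%:R - 2 * s -> (\int[mu]_y P q y = (rf s q)%:E)%E.
  by move=> q0 qn; rewrite J ?unit_vector_neq0// enorm_unit_vector powR1 mulr1.
have mMax : measurable_fun setT (fun y => (heat_integral s (unit_vector - y) * (Num.max (D y) 0)%:E)%E).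
  by apply: emeasurable_funM => //; apply/measurable_EFinP; apply: measurable_maxr => //; exact: measurable_cst.
have X0 y : (0 <= heat_integral s (unit_vector - y) * (Num.max (D y) 0)%:E)%E.
  by rewrite mule_ge0 ?heat_integral_ge0// lee_fin le_max lexx orbT.
have IPD q q' : 0 < q -> q < n%:R - 2 * s -> 0 < q' -> q' < n%:R - 2 * s ->
    (\int[mu]_y (P q y + P q' y) = (rf s q + rf s q')%:E)%E.
  by move=> q0 qn q0' qn'; rewrite ge0_integralD// !IP.
have split2 : (\int[mu]_y (heat_integral s (unit_vector - y) * (Num.max (D y) 0)%:E) + (rf s b + rf s b)%:E = (rf s a + rf s a)%:E)%E.
  rewrite -{2}(riesz_factor_sym s b) -{2}(riesz_factor_sym s a).
  have qb : 0 < n%:R - 2 * s - b < n%:R - 2 * s by apply/andP; split; lra.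
  have qa : 0 < n%:R - 2 * s - a < n%:R - 2 * s by apply/andP; split; lra.
  case/andP: qa => qa1 qa2; case/andP: qb => qb1 qb2.
  rewrite -(IPD b)// -(IPD a)//.
  rewrite -ge0_integralD//; last 2 first.
  - by move=> y _; rewrite adde_ge0.
  - exact: emeasurable_funD.
  apply: ae_eq_integral => //.
  - by apply: emeasurable_funD => //; exact: emeasurable_funD.
  - exact: emeasurable_funD.
  apply: filterS (ae_neq 0) => y y0 _.
  have y0' : 0 < enorm y by rewrite enorm_gt0.
  have D0 : 0 <= D y by exact: power_gap_ge0.
  rewrite /P max_l// -!ge0_muleDr ?lee_fin//; do ?[exact: D0|by rewrite ?addr_ge0 ?powR_ge0].
  by rewrite -!EFinD; congr (_ * _%:E)%E; rewrite /D /power_gap; ring.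
have I0 := integral_ge0 (D := setT) mu (fun y _ => X0 y).
rewrite ltNge; apply/negP => le_ab.
have H : (\int[mu]_y (heat_integral s (unit_vector - y) * (Num.max (D y) 0)%:E) = 0)%E /\ rf s a = rf s b.
  move: I0 split2; case: (\int[mu]_y _)%E => [q||//] q0; last by rewrite addye.
  move=> /eqP; rewrite -EFinD eqe => /eqP H; rewrite lee_fin in q0.
  move: le_ab H q0; move: (rf s a) (rf s b) => ra rb h1 h2 h3.
  by split; [congr (_%:E)|]; lra.
clear I0 split2 le_ab.
pose x2 := (2 : R) *: unit_vector.
have x2E : enorm x2 = 2 by rewrite enormZ enorm_unit_vector mulr1 ger0_norm.
have x20 : x2 != 0 by rewrite -enorm_gt0 x2E.
have rb0 : rf s b != 0 by rewrite gt_eqF// riesz_factor_gt0.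
have two_inj : (2 : R) `^ (- a) = 2 `^ (- b) -> a = b.
  have l2 : ln (2 : R) != 0 by rewrite gt_eqF// ln_gt0// ltr1n.
  by rewrite /powR pnatr_eq0/= => /expR_inj/(mulIf l2)/oppr_inj.
have ae0 : ae_eq mu setT (fun y => (heat_integral s (unit_vector - y) * (Num.max (D y) 0)%:E)%E) (cst 0%E).
  apply/(ae_eq_integral_abs mu measurableT mMax); rewrite -[RHS](proj1 H); apply: eq_integral => y _.
  by rewrite gee0_abs// mule_ge0 ?heat_integral_ge0// lee_fin le_max lexx orbT.
have ae1 : {ae mu, forall y : 'rV[R]_n, enorm y = 1}.
  near=> y.
  have y0 : y != 0 by near: y; exact: (ae_neq 0).
  have y0' : 0 < enorm y by rewrite enorm_gt0.
  have D0 : 0 <= D y by exact: power_gap_ge0.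
  have : (heat_integral s (unit_vector - y) * (Num.max (D y) 0)%:E)%E = 0%E.
    by have := near ae0 y; apply.
  move=> /eqP; rewrite mule_eq0 gt_eqF ?heat_integral_gt0//= max_l// eqe => /eqP.
  exact: power_gap_eq0.
have : (rf s a * enorm x2 `^ (- a))%:E = (rf s b * enorm x2 `^ (- b))%:E.
  rewrite -(J a x2 a0 an x20) -(J b x2 b0 bn' x20).
  apply: ae_eq_integral => //.
  by apply: filterS ae1 => y -> _; rewrite !powR1.
rewrite x2E (proj2 H) => /eqP; rewrite eqe => /eqP/(mulfI rb0)/two_inj ba.
by move: ab; rewrite ba ltxx.
Unshelve. all: by end_near. Qed.

End riesz_factor_theory.

(** * Monotone iteration for the integral equation *)

Section hardy_iteration.
Context {R : realType} {n' : nat}.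
Local Notation n := n'.+1.
Local Notation mu := (lebesgue_rV R n).
Local Notation rf := (@riesz_factor R n').
Variables (s gam p r : R).
Hypotheses (s0 : 0 < s) (gam0 : 0 <= gam) (p0 : 0 < p) (r0 : 0 < r).
Implicit Types (x y z : 'rV[R]_n) (w : 'rV[R]_n -> R).
Local Notation Q := (n%:R - 2 * s).

Definition riesz_potential (f : 'rV[R]_n -> R) x : \bar R :=
  (\int[mu]_y (heat_integral s (x - y) * (f y)%:E))%E.

(** The origin is excluded because the convention for powers of 0 gives the singular coefficient
    the value 0 there. *)
Definition hardy_source w y : R :=
  if (0 < enorm y) && (enorm y < r)
  then gam * enorm y `^ (- (2 * s)) * w y + w y `^ p else 0.

Lemma powR_ge0_le (a b : R) : 0 <= a -> a <= b -> a `^ p <= b `^ p.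
Proof.
move=> a0 ab; have b0 := le_trans a0 ab.
by apply: ge0_ler_powR => //; [exact: ltW|rewrite nnegrE..].
Qed.

Lemma riesz_potential_ge0 f x : (forall y, 0 <= f y) -> (0 <= riesz_potential f x)%E.
Proof. by move=> f0; apply: integral_ge0 => y _; rewrite mule_ge0 ?heat_integral_ge0 ?lee_fin. Qed.

Lemma measurable_riesz_integrand (f : 'rV[R]_n -> R) x : measurable_fun setT f ->
  measurable_fun setT (fun y => (heat_integral s (x - y) * (f y)%:E)%E).
Proof.
move=> mf; apply: emeasurable_funM; last exact/measurable_EFinP.
by apply: measurable_heat_integral; apply: measurable_subrV; [exact: measurable_cst|exact: measurable_id].
Qed.

Lemma measurable_riesz_integrand2 (f : 'rV[R]_n -> R) : measurable_fun setT f ->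
  measurable_fun setT (fun z : 'rV[R]_n * 'rV[R]_n => (heat_integral s (z.1 - z.2) * (f z.2)%:E)%E).
Proof.
move=> mf; apply: emeasurable_funM; last by apply/measurable_EFinP; exact: (measurableT_comp mf measurable_snd).
by apply: measurable_heat_integral; apply: measurable_subrV; [exact: measurable_fst|exact: measurable_snd].
Qed.

Lemma measurable_riesz_potential (f : 'rV[R]_n -> R) : measurable_fun setT f ->
  measurable_fun setT (riesz_potential f).
Proof.
by move=> mf; apply: (measurable_integral_param mu (measurable_riesz_integrand2 mf)).
Qed.

Lemma le_riesz_potential (f g : 'rV[R]_n -> R) x : measurable_fun setT f -> measurable_fun setT g ->
  (forall y, 0 <= f y) -> (forall y, f y <= g y) -> (riesz_potential f x <= riesz_potential g x)%E.
Proof.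
move=> mf mg f0 fg; apply: ge0_le_integral => //.
- by move=> y _; rewrite mule_ge0 ?heat_integral_ge0 ?lee_fin.
- exact: measurable_riesz_integrand.
- exact: measurable_riesz_integrand.
- by move=> y _; rewrite lee_wpmul2l ?heat_integral_ge0// lee_fin.
Qed.

Lemma riesz_potential_le_power (f : 'rV[R]_n -> R) (a M : R) x : measurable_fun setT f ->
  (forall y, 0 <= f y) -> 0 < a -> a < Q -> 0 <= M ->
  (forall y, y != 0 -> f y <= M * enorm y `^ (- (2 * s + a))) -> x != 0 ->
  (riesz_potential f x <= (M * rf s a * enorm x `^ (- a))%:E)%E.
Proof.
move=> mf f0 a0 aQ M0 fM x0.
rewrite -mulrA EFinM -riesz_potential_power// -ge0_integralZl//; last 2 first.
- by apply: (measurable_riesz_integrand (f := fun y => enorm y `^ _)); exact: measurable_enorm_powR.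
- by move=> y _; rewrite mule_ge0 ?heat_integral_ge0// lee_fin powR_ge0.
apply: ae_ge0_le_integral => //.
- by move=> y _; rewrite mule_ge0 ?heat_integral_ge0 ?lee_fin.
- exact: measurable_riesz_integrand.
- by move=> y _; rewrite !mule_ge0 ?heat_integral_ge0// lee_fin// powR_ge0.
- apply: emeasurable_funM; first exact: measurable_cst.
  by apply: (measurable_riesz_integrand (f := fun y => enorm y `^ _)); exact: measurable_enorm_powR.
apply: filterS (ae_neq 0) => y y0 _.
by rewrite muleCA -EFinM lee_wpmul2l ?heat_integral_ge0// lee_fin fM.
Qed.

Lemma measurable_annulus : measurable_fun setT (fun y : 'rV[R]_n => (0 < enorm y) && (enorm y < r)).
Proof.
have me := measurable_enorm (@measurable_id _ 'rV[R]_n setT).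
by apply: measurable_and; apply: measurable_fun_ltr => //; exact: measurable_cst.
Qed.

Lemma measurable_hardy_source w : measurable_fun setT w -> measurable_fun setT (hardy_source w).
Proof.
move=> mw; apply: measurable_fun_ifT; [exact: measurable_annulus| |exact: measurable_cst].
apply: measurable_funD; last by apply: (measurableT_comp (measurable_powR _)).
apply: measurable_funM => //; apply: measurable_funM; first exact: measurable_cst.
exact: measurable_enorm_powR.
Qed.

Lemma hardy_source_ge0 w y : (0 < enorm y < r -> 0 <= w y) -> 0 <= hardy_source w y.
Proof.
move=> h; rewrite /hardy_source; case: ifPn => // /h {}h.
by rewrite addr_ge0 ?powR_ge0// !mulr_ge0 ?powR_ge0.
Qed.

Lemma le_hardy_source w w' y : (0 < enorm y < r -> 0 <= w y <= w' y) ->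
  hardy_source w y <= hardy_source w' y.
Proof.
move=> h; rewrite /hardy_source; case: ifPn => // /h /andP[h1 h2].
by rewrite lerD ?powR_ge0_le// ler_wpM2l// mulr_ge0 ?powR_ge0.
Qed.

Lemma cvg_powR (u : R^nat) (l : R) : 0 < l -> u k @[k --> \oo] --> l ->
  u k `^ p @[k --> \oo] --> l `^ p.
Proof.
move=> l0 ul; apply: (@cvg_comp _ _ _ u (fun t => t `^ p) \oo (nbhs l)) => //.
apply: (@cvg_trans _ ((fun t => expR (p * ln t)) @ l)).
  apply: near_eq_cvg; near=> t; rewrite /powR gt_eqF//.
  by near: t; exact: lt_nbhsr.
rewrite /powR gt_eqF//; apply: (@continuous_comp _ _ _ (fun t => p * ln t) expR).
  by apply: cvgM; [exact: cvg_cst|exact: continuous_ln].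
exact: continuous_expR.
Unshelve. all: by end_near. Qed.

Variables (kap eps a M : R) (U : 'rV[R]_n -> R).
Hypotheses (kap0 : 0 <= kap) (eps0 : 0 < eps) (a0 : 0 < a) (aQ : a < Q) (M0 : 0 <= M).
Hypotheses (mU : measurable_fun setT U) (U0 : forall y, 0 <= U y).
Hypothesis U_source : forall y, y != 0 -> hardy_source U y <= M * enorm y `^ (- (2 * s + a)).
Hypothesis U_super : forall y, 0 < enorm y < r ->
  (eps%:E + kap%:E * riesz_potential (hardy_source U) y <= (U y)%:E)%E.

Fixpoint hardy_iter (k : nat) : 'rV[R]_n -> R :=
  if k is k'.+1 then fun x => eps + kap * fine (riesz_potential (hardy_source (hardy_iter k')) x)
  else cst eps.
Local Notation W := hardy_iter.

Let iterS k x : W k.+1 x = eps + kap * fine (riesz_potential (hardy_source (W k)) x).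
Proof. by []. Qed.

Let measurable_iter k : measurable_fun setT (W k).
Proof.
elim: k => [|k IH] /=; first exact: measurable_cst.
apply: measurable_funD; first exact: measurable_cst.
apply: measurable_funM; first exact: measurable_cst.
apply: (measurableT_comp (@fine_measurable R setT measurableT)).
by apply: measurable_riesz_potential; exact: measurable_hardy_source.
Qed.

Let iter_ge_eps k x : eps <= W k x.
Proof.
elim: k x => [|k IH] x //=.
rewrite lerDl mulr_ge0// fine_ge0// riesz_potential_ge0// => y.
by apply: hardy_source_ge0 => _; exact: le_trans (ltW eps0) (IH y).
Qed.

Let iter_ge0 k x : 0 <= W k x.
Proof. exact: le_trans (ltW eps0) (iter_ge_eps k x). Qed.

Let source_U_ge0 y : 0 <= hardy_source U y.
Proof. by apply: hardy_source_ge0 => _; exact: U0. Qed.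

Let potential_bound (f : 'rV[R]_n -> R) x : measurable_fun setT f -> (forall y, 0 <= f y) -> (forall y, f y <= hardy_source U y) ->
  x != 0 -> (riesz_potential f x <= (M * rf s a * enorm x `^ (- a))%:E)%E.
Proof.
move=> mf f0 fU x0; apply: (le_trans (le_riesz_potential x mf (measurable_hardy_source mU) f0 fU)).
by apply: riesz_potential_le_power => //; exact: measurable_hardy_source.
Qed.

Let potential_fin (f : 'rV[R]_n -> R) x : measurable_fun setT f -> (forall y, 0 <= f y) -> (forall y, f y <= hardy_source U y) ->
  x != 0 -> riesz_potential f x \is a fin_num.
Proof.
move=> mf f0 fU x0; rewrite ge0_fin_numE ?riesz_potential_ge0//.
by apply: le_lt_trans (potential_bound mf f0 fU x0) _; rewrite ltry.
Qed.

(** The iterates are compared with U inside the ball only: the source ignores the values outside. *)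
Let iter_le_U k y : 0 < enorm y < r -> W k y <= U y.
Proof.
elim: k y => [|k IH] y yr.
  rewrite -lee_fin; apply: le_trans (U_super yr).
  by rewrite leeDl// mule_ge0 ?lee_fin// riesz_potential_ge0.
have y0 : y != 0 by rewrite -enorm_gt0; case/andP: yr.
have f0 z : 0 <= hardy_source (W k) z by apply: hardy_source_ge0.
have fU z : hardy_source (W k) z <= hardy_source U z.
  by apply: le_hardy_source => zr; rewrite iter_ge0 IH.
have mf := measurable_hardy_source (measurable_iter k).
rewrite -lee_fin; apply: le_trans (U_super yr).
rewrite /= EFinD EFinM fineK; last exact: potential_fin.
apply: leeD2l; apply: lee_wpmul2l; first by rewrite lee_fin.
by apply: le_riesz_potential => //; exact: measurable_hardy_source.
Qed.

Let source_iter_ge0 k y : 0 <= hardy_source (W k) y.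
Proof. by apply: hardy_source_ge0. Qed.

Let source_iter_le k y : hardy_source (W k) y <= hardy_source U y.
Proof. by apply: le_hardy_source => yr; rewrite iter_ge0 iter_le_U. Qed.

Let iter_step k x : x != 0 -> W k x <= W k.+1 x.
Proof.
elim: k x => [|k IH] x x0; first exact: (iter_ge_eps 1).
rewrite iterS [leRHS]iterS; apply: lerD; first exact: lexx.
apply: ler_wpM2l; first exact: kap0.
apply: fine_le.
- by apply: potential_fin => //; exact: measurable_hardy_source.
- by apply: potential_fin => //; exact: measurable_hardy_source.
apply: le_riesz_potential; [exact: measurable_hardy_source..|exact: source_iter_ge0|] => y.
apply: le_hardy_source => /andP[y0 yr]; rewrite iter_ge0/=; apply: IH.
by rewrite -enorm_gt0.
Qed.

Let iter_nd x : x != 0 -> {homo W^~ x : k m / (k <= m)%N >-> k <= m}.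
Proof. by move=> x0; apply/nondecreasing_seqP => k; exact: iter_step. Qed.

Let bound x := eps + kap * (M * rf s a * enorm x `^ (- a)).

Let iter_bound k x : x != 0 -> W k x <= bound x.
Proof.
move=> x0; apply: (le_trans (iter_step k x0)); rewrite iterS; apply: lerD; first exact: lexx.
apply: ler_wpM2l; first exact: kap0.
rewrite -lee_fin fineK; last by apply: potential_fin => //; exact: measurable_hardy_source.
by apply: potential_bound => //; exact: measurable_hardy_source.
Qed.

Let cvg_iter x : x != 0 -> W k x @[k --> \oo] --> lim (W k x @[k --> \oo]).
Proof.
move=> x0; apply: nondecreasing_is_cvgn; first exact: iter_nd.
by exists (bound x) => _ [k _ <-]; exact: iter_bound.
Qed.

(** At the origin the potentials may be infinite, and the iterates have no meaningful value there;
    any positive number serves instead. *)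
Definition hardy_solution x : R := if x == 0 then 1 else lim (W k x @[k --> \oo]).
Local Notation u := hardy_solution.

Let cvg_iter_solution x : x != 0 -> W k x @[k --> \oo] --> u x.
Proof. by move=> x0; rewrite /u (negbTE x0); exact: cvg_iter. Qed.

Lemma measurable_hardy_solution : measurable_fun setT u.
Proof.
have meq : measurable_fun setT (fun x : 'rV[R]_n => x == 0).
  rewrite (_ : (fun x => _) = (fun x : 'rV[R]_n => enorm x == 0)); last first.
    by apply/funext => x; rewrite enorm_eq0.
  apply: measurable_fun_eqr; last exact: measurable_cst.
  exact: (measurable_enorm (@measurable_id _ 'rV[R]_n setT)).
apply: (@measurable_fun_cvg _ _ _ _ (fun k x => if x == 0 then 1 else W k x)).
  by move=> k; apply: measurable_fun_ifT => //; exact: measurable_cst.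
move=> x _; have [->|x0] := eqVneq x 0; first by rewrite /u eqxx; exact: cvg_cst.
exact: cvg_iter_solution.
Qed.

Let iter_le_solution k x : x != 0 -> W k x <= u x.
Proof.
move=> x0; rewrite /u (negbTE x0); apply: (nondecreasing_cvgn_le (iter_nd x0)).
exact: cvg_iter.
Qed.

Lemma hardy_solution_ge x : x != 0 -> eps <= u x.
Proof. by move=> x0; exact: (iter_le_solution 0). Qed.

Lemma hardy_solution_le x : 0 < enorm x < r -> u x <= U x.
Proof.
move=> xr; have x0 : x != 0 by rewrite -enorm_gt0; case/andP: xr.
rewrite /u (negbTE x0); apply: limr_le; first exact: cvg_iter.
by near=> k; exact: iter_le_U.
Unshelve. all: by end_near. Qed.

Lemma hardy_solution_source_ge0 y : 0 <= hardy_source u y.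
Proof.
apply: hardy_source_ge0 => /andP[y0 _]; apply: (le_trans (ltW eps0)).
by apply: hardy_solution_ge; rewrite -enorm_gt0.
Qed.

Lemma hardy_solution_source_le y : hardy_source u y <= hardy_source U y.
Proof.
apply: le_hardy_source => yr; rewrite hardy_solution_le// andbT.
apply: (le_trans (ltW eps0)).
by apply: hardy_solution_ge; rewrite -enorm_gt0; case/andP: yr.
Qed.

Let cvg_source y : hardy_source (W k) y @[k --> \oo] --> hardy_source u y.
Proof.
rewrite /hardy_source; case: ifPn => [/andP[y0 _]|_]; last exact: cvg_cst.
have y0' : y != 0 by rewrite -enorm_gt0.
apply: cvgD.
  by apply: cvgM; [exact: cvg_cst|exact: cvg_iter_solution].
apply: cvg_powR; last exact: cvg_iter_solution.
by apply: lt_le_trans (hardy_solution_ge y0').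
Qed.

(** Monotone convergence applied to the recursion. *)
Lemma hardy_solutionE x : x != 0 ->
  (u x)%:E = (eps%:E + kap%:E * riesz_potential (hardy_source u) x)%E.
Proof.
move=> x0.
have msu := measurable_hardy_source measurable_hardy_solution.
have fin : riesz_potential (hardy_source u) x \is a fin_num.
  by apply: potential_fin => //; [exact: hardy_solution_source_ge0|exact: hardy_solution_source_le].
have C : riesz_potential (hardy_source (W k)) x @[k --> \oo] --> riesz_potential (hardy_source u) x.
  have := @cvg_monotone_convergence _ _ _ mu setT measurableT
    (fun k y => (heat_integral s (x - y) * (hardy_source (W k) y)%:E)%E).
  move=> H.
  have nd y : {homo (fun k => (heat_integral s (x - y) * (hardy_source (W k) y)%:E)%E) : k m / (k <= m)%N >-> (k <= m)%E}.
    move=> k m km; rewrite lee_wpmul2l ?heat_integral_ge0// lee_fin.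
    by apply: le_hardy_source => /andP[y0 _]; rewrite iter_ge0/= iter_nd// -enorm_gt0.
  rewrite /riesz_potential.
  have -> : (\int[mu]_y (heat_integral s (x - y) * (hardy_source u y)%:E) =
     \int[mu]_y limn (fun k => heat_integral s (x - y) * (hardy_source (W k) y)%:E))%E.
    apply: ae_eq_integral => //.
    - exact: measurable_riesz_integrand.
    - apply: (@emeasurable_fun_cvg _ _ _ _ (fun k y => (heat_integral s (x - y) * (hardy_source (W k) y)%:E)%E)).
        by move=> k; apply: measurable_riesz_integrand; exact: measurable_hardy_source.
      by move=> y _; apply: ereal_nondecreasing_is_cvgn; exact: nd.
    apply: filterS (ae_neq x) => y yx _; apply/esym/cvg_lim => //.
    have xy : x - y != 0 by rewrite subr_eq0 eq_sym.
    have sn : s < n%:R / 2 by move: aQ a0; lra.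
    rewrite heat_integralE//; apply: cvg_EFin; first by near=> k; rewrite -EFinM.
    by rewrite /comp/=; apply: cvgM; [exact: cvg_cst|exact: cvg_source].
  apply: H => // k.
    by apply: measurable_riesz_integrand; exact: measurable_hardy_source.
  by move=> y _; rewrite mule_ge0 ?heat_integral_ge0 ?lee_fin.
have C' : W k.+1 x @[k --> \oo] --> eps + kap * fine (riesz_potential (hardy_source u) x).
  apply: cvgD; first exact: cvg_cst.
  apply: cvgM; first exact: cvg_cst.
  by apply: fine_cvg; rewrite fineK.
have := cvg_iter_solution x0; rewrite -cvg_shiftS => C2.
have := cvg_unique (@Rhausdorff R) C2 C' => ->.
by rewrite EFinD EFinM fineK.
Unshelve. all: by end_near. Qed.

End hardy_iteration.

(** * Supersolutions *)

Section supersolutions.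
Context {R : realType} {n' : nat}.
Local Notation n := n'.+1.
Local Notation mu := (lebesgue_rV R n).
Local Notation rf := (@riesz_factor R n').
Implicit Types (x y z : 'rV[R]_n) (s gam p r a : R).

(** What the passage to distributions needs to know of a solution; the bound on the source makes
    its potential finite away from the origin. *)
Definition riesz_hardy_solution s gam p r (u : 'rV[R]_n -> R) : Prop :=
  exists eps a M : R,
  [/\ 0 < eps /\ 0 < a < n%:R - 2 * s /\ 0 <= M, measurable_fun setT u,
      u 0 = 1 /\ (forall x, x != 0 -> eps <= u x),
      forall y, y != 0 -> hardy_source s gam p r u y <= M * enorm y `^ (- (2 * s + a)) &
      forall x, x != 0 -> (u x)%:E =
        (eps%:E + (Gamma s)^-1%:E * riesz_potential s (hardy_source s gam p r u) x)%E].

Lemma riesz_hardy_solution_of_super s gam p r (eps a M : R) (U : 'rV[R]_n -> R) :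
  0 < s -> 0 <= gam -> 0 < p -> 0 < eps -> 0 < a -> a < n%:R - 2 * s -> 0 <= M ->
  measurable_fun setT U -> (forall y, 0 <= U y) ->
  (forall y, y != 0 -> hardy_source s gam p r U y <= M * enorm y `^ (- (2 * s + a))) ->
  (forall y, 0 < enorm y < r ->
    (eps%:E + (Gamma s)^-1%:E * riesz_potential s (hardy_source s gam p r U) y <= (U y)%:E)%E) ->
  exists u, riesz_hardy_solution s gam p r u.
Proof.
move=> s0 g0 p0 e0 a0 aQ M0 mU U0 Us Usup.
have k0 : 0 <= (Gamma s)^-1 by rewrite invr_ge0 ltW// Gamma_gt0.
exists (hardy_solution s gam p r (Gamma s)^-1 eps); exists eps, a, M; split.
- by rewrite a0.
- exact: (measurable_hardy_solution s0 g0 p0 k0 e0 a0 aQ M0 mU U0 Us Usup).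
- split; first by rewrite /hardy_solution eqxx.
  by move=> x x0; exact: (hardy_solution_ge s0 g0 p0 k0 e0 a0 aQ M0 mU U0 Us Usup).
- move=> y y0; apply: le_trans (Us y y0).
  exact: (hardy_solution_source_le s0 g0 p0 k0 e0 a0 aQ M0 mU U0 Us Usup).
- by move=> x x0; exact: (hardy_solutionE s0 g0 p0 k0 e0 a0 aQ M0 mU U0 Us Usup).
Qed.

Lemma powR_le_powR (t r q q' : R) : 0 < t -> t < r -> q <= q' ->
  t `^ (- q) <= r `^ (q' - q) * t `^ (- q').
Proof.
move=> t0 tr qq; have -> : t `^ (- q) = t `^ (q' - q) * t `^ (- q').
  rewrite -powRD; first by congr (_ `^ _); ring.
  by apply/implyP => _; exact: lt0r_neq0.
rewrite ler_wpM2r ?powR_ge0//; apply: ge0_ler_powR.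
- by rewrite subr_ge0.
- by rewrite nnegrE ltW.
- by rewrite nnegrE ltW// (lt_trans t0 tr).
- exact: ltW.
Qed.

Let ball_power (r a : R) y : R :=
  if (0 < enorm y) && (enorm y < r) then enorm y `^ (- a) else 0.

Let measurable_ball_power r a : measurable_fun setT (ball_power r a).
Proof.
apply: measurable_fun_ifT; [exact: measurable_annulus|exact: measurable_enorm_powR|exact: measurable_cst].
Qed.

Let ball_power_ge0 r a y : 0 <= ball_power r a y.
Proof. by rewrite /ball_power; case: ifP => // _; rewrite powR_ge0. Qed.

(** For p > 1 the ratio A^p / A takes every positive value: a small amplitude A makes the nonlinear
    term as small as wanted relative to A. *)
Lemma exists_powR_root (p K : R) : 1 < p -> 0 < K -> exists2 A, 0 < A & A `^ p = K * A.
Proof.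
move=> p1 K0; exists (K `^ (p - 1)^-1); first exact: powR_gt0.
rewrite -powRrM (_ : (p - 1)^-1 * p = 1 + (p - 1)^-1); last by field; rewrite subr_eq0 gt_eqF.
rewrite powRD ?powRr1 ?ltW//; apply/implyP => _; exact: lt0r_neq0.
Qed.

(** The supersolution is A |x|^-a in the ball. The exponent a is chosen such that a p <= 2s + a,
    so that the potential of the source is at most a multiple of A^p |x|^-a; the amplitude A makes this
    multiple A/2, and the other half leaves room for eps. *)
Lemma riesz_hardy_solution_gamma0 s p r : 0 < s -> 2 * s < n%:R -> 1 < p -> 0 < r ->
  exists u, riesz_hardy_solution s 0 p r u.
Proof.
move=> s0 sn p1 r0.
pose a := Num.min ((n%:R - 2 * s) / 2) (2 * s / (p - 1)).
have p10 : 0 < p - 1 by rewrite subr_gt0.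
have a0 : 0 < a by rewrite lt_min !divr_gt0// ?mulr_gt0// subr_gt0.
have aQ : a < n%:R - 2 * s.
  have : a <= (n%:R - 2 * s) / 2 by rewrite ge_min lexx.
  lra.
have ap : a * p <= 2 * s + a.
  have : a <= 2 * s / (p - 1) by rewrite ge_min lexx orbT.
  by rewrite ler_pdivlMr//; lra.
have G0 := Gamma_gt0 s0; have rf0 := riesz_factor_gt0 s0 a0 aQ.
have [F FE] : exists F, rf s a = F by exists (rf s a).
have [G GE] : exists G, Gamma s = G by exists (Gamma s).
rewrite FE in rf0; rewrite GE in G0.
pose C := r `^ (2 * s + a - a * p).
have C0 : 0 < C by exact: powR_gt0.
have K0 : 0 < G / (2 * C * F) by rewrite divr_gt0// !mulr_gt0.
have [A A0 Ap] := exists_powR_root p1 K0.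
pose U y := A * ball_power r a y.
have U0 y : 0 <= U y by rewrite mulr_ge0// ltW.
have mU : measurable_fun setT U by apply: measurable_funM => //; exact: measurable_cst.
pose M := A `^ p * C.
have M0 : 0 <= M by rewrite mulr_ge0 ?powR_ge0.
have Us y : hardy_source s 0 p r U y <= M * enorm y `^ (- (2 * s + a)).
  rewrite /hardy_source; case: ifPn => [yr'|_]; last by rewrite mulr_ge0 ?powR_ge0.
  have /andP[y0 yr] := yr'; rewrite /U /ball_power yr'.
  rewrite !mul0r add0r powRM ?powR_ge0// -?powRrM /M -?mulrA; last exact: ltW.
  rewrite ler_wpM2l ?powR_ge0// (_ : - a * p = - (a * p)); last by ring.
  exact: powR_le_powR.
have p0 : 0 < p by apply: lt_trans p1.
apply: (@riesz_hardy_solution_of_super s 0 p r (A / 2 * r `^ (- a)) a M U) => //.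
- by rewrite mulr_gt0 ?powR_gt0// divr_gt0.
- move=> x xr; have /andP[x0 xr'] := xr.
  have x0' : x != 0 by rewrite -enorm_gt0.
  have src0 y : 0 <= hardy_source s 0 p r U y by apply: hardy_source_ge0.
  have msrc := measurable_hardy_source s 0 p r mU.
  have Pl := riesz_potential_le_power s0 msrc src0 a0 aQ M0 (fun y _ => Us y) x0'.
  rewrite FE in Pl; rewrite GE.
  apply: (@le_trans _ _ ((A / 2 * r `^ (- a))%:E + G^-1%:E * (M * F * enorm x `^ (- a))%:E)%E).
    by apply: leeD2l; apply: lee_wpmul2l => //; rewrite lee_fin invr_ge0 ltW.
  rewrite -EFinM -EFinD lee_fin /U /ball_power xr.
  have -> : G^-1 * (M * F * enorm x `^ (- a)) = A / 2 * enorm x `^ (- a).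
    by rewrite /M Ap; field; rewrite !gt_eqF.
  have h : r `^ (- a) <= enorm x `^ (- a).
    by rewrite !powRN lef_pV2 ?posrE ?powR_gt0//; apply: ge0_ler_powR; rewrite ?nnegrE ltW.
  have A2 : 0 < A / 2 by rewrite divr_gt0.
  have := ler_wpM2l (ltW A2) h; lra.
Qed.

(** The mass of the power |y|^-(2s+c) beyond the radius rho acts on the ball like a small constant:
    half of the exponent pays for the factor rho^(-c/2) and the other half for the convergence. *)
Lemma riesz_tail s : 0 < s -> forall c : R, 0 < c -> c < n%:R - 2 * s ->
  exists2 C : R, 0 < C & forall r rho x, 0 < r -> 1 <= rho -> 2 * r <= rho -> enorm x < r ->
  (\int[mu]_y (heat_integral s (x - y) * (if rho <= enorm y then enorm y `^ (- (2 * s + c)) else 0)%:E) <=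
   (C * rho `^ (- (c / 2)))%:E)%E.
Proof.
move=> s0 c c0 cQ.
have sn : s < n%:R / 2 by lra.
have c2 : 0 < c / 2 by rewrite divr_gt0.
have cQ2 : c / 2 < n%:R - 2 * s by lra.
have Wfin := integral_riesz_weight s0 c2 cQ2.
have W0 : (0 <= \int[mu]_y (riesz_weight s (c / 2) y)%:E)%E.
  by apply: integral_ge0 => y _; rewrite lee_fin riesz_weight_ge0.
have WE : (\int[mu]_y (riesz_weight s (c / 2) y)%:E = (fine (\int[mu]_y (riesz_weight s (c / 2) y)%:E))%:E)%E.
  by rewrite fineK// ge0_fin_numE.
move: WE; set W := fine _ => WE.
have W0' : 0 <= W by rewrite -lee_fin -WE.
pose H := heat_integral_const (n := n) s * 4 `^ (n%:R - 2 * s).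
have H0 : 0 < H by rewrite mulr_gt0 ?powR_gt0 ?heat_integral_const_gt0.
exists (H * (W + 1)); first by rewrite mulr_gt0// ltr_wpDl.
move=> r rho x r0 rho1 rrho xr.
have rho0 : 0 < rho by apply: lt_le_trans rho1.
apply: (@le_trans _ _ (\int[mu]_y (H * rho `^ (- (c / 2)) * riesz_weight s (c / 2) y)%:E)%E); last first.
  rewrite ge0_integralZl_real; [|exact: measurable_riesz_weight|exact: riesz_weight_ge0|by rewrite mulr_ge0 ?powR_ge0// ltW].
  rewrite WE -EFinM lee_fin [leRHS](_ : _ = H * rho `^ (- (c / 2)) * (W + 1)); last by ring.
  apply: ler_wpM2l; first by rewrite mulr_ge0 ?powR_ge0// ltW.
  by rewrite lerDl.
have mtail : measurable_fun setT (fun y : 'rV[R]_n => if rho <= enorm y then enorm y `^ (- (2 * s + c)) else 0).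
  apply: measurable_fun_ifT; [|exact: measurable_enorm_powR|exact: measurable_cst].
  apply: measurable_fun_ler; first exact: measurable_cst.
  exact: (measurable_enorm (@measurable_id _ 'rV[R]_n setT)).
apply: ge0_le_integral => //.
- by move=> y _; rewrite mule_ge0 ?heat_integral_ge0// lee_fin; case: ifP; rewrite ?powR_ge0.
- exact: measurable_riesz_integrand.
- by apply/measurable_EFinP; apply: measurable_funM; [exact: measurable_cst|exact: measurable_riesz_weight].
move=> y _; case: ifPn => [ry|_]; last first.
  rewrite mule0 lee_fin mulr_ge0 ?riesz_weight_ge0//.
  by rewrite mulr_ge0 ?powR_ge0// ltW.
have y1 : 1 <= enorm y by apply: le_trans ry.
have y0 : 0 < enorm y by apply: lt_le_trans y1.
have y0' : y != 0 by rewrite -enorm_gt0.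
have h2n : (2^-1 : R) *: y != 0 by rewrite scaler_eq0 invr_eq0 pnatr_eq0.
have h2E : enorm ((2^-1 : R) *: y) = enorm y / 2 by rewrite enormZ ger0_norm// mulrC.
have K1 : (heat_integral s (x - y) <= (heat_integral_const (n := n) s * (enorm y / 2) `^ (- (n%:R - 2 * s)))%:E)%E.
  rewrite -h2E -(heat_integralE sn h2n); apply: heat_integral_le.
  rewrite -[dot (_ *: _) _]sqr_enorm h2E dotBC.
  have := dot_le2 y x; rewrite -!sqr_enorm => h.
  have hx : enorm x <= enorm y / 2 by lra.
  have hx2 : enorm x ^+ 2 <= (enorm y / 2) ^+ 2 by rewrite ler_pXn2r// nnegrE ?enorm_ge0// divr_ge0 ?enorm_ge0.
  by rewrite expr_div_n in hx2 *; lra.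
have K2 : (enorm y / 2) `^ (- (n%:R - 2 * s)) <= 4 `^ (n%:R - 2 * s) * Num.sqrt (2 + 2 * dot y y) `^ (- (n%:R - 2 * s)).
  have q0 : 0 < n%:R - 2 * s by lra.
  have -> : enorm y / 2 = 4^-1 * (2 * enorm y) by field.
  rewrite powRM ?mulr_ge0 ?enorm_ge0//.
  have -> : (4^-1 : R) `^ (- (n%:R - 2 * s)) = 4 `^ (n%:R - 2 * s).
    by rewrite /powR !gt_eqF ?invr_gt0// lnV ?posrE// mulrNN.
  rewrite ler_wpM2l ?powR_ge0// !powRN lef_pV2 ?posrE ?powR_gt0 ?mulr_gt0//; last first.
    by rewrite sqrtr_gt0 ltr_pwDl// mulr_ge0// dot_ge0.
  apply: ge0_ler_powR; [exact: ltW|by rewrite nnegrE sqrtr_ge0|by rewrite nnegrE mulr_ge0 ?enorm_ge0|].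
  rewrite -[leRHS]ger0_norm ?mulr_ge0 ?enorm_ge0// -sqrtr_sqr ler_wsqrtr// -sqr_enorm exprMn.
  have : 1 <= enorm y ^+ 2 by rewrite exprn_ege1.
  by lra.
have K3 : enorm y `^ (- (2 * s + c)) <= rho `^ (- (c / 2)) * enorm y `^ (- (2 * s + c / 2)).
  have -> : - (2 * s + c) = - (c / 2) + - (2 * s + c / 2) by field.
  rewrite powRD; last by apply/implyP => _; exact: lt0r_neq0.
  rewrite ler_wpM2r ?powR_ge0// !powRN lef_pV2 ?posrE ?powR_gt0//.
  apply: ge0_ler_powR => //; [exact: ltW|by rewrite nnegrE ltW..].
apply: (@le_trans _ _ ((heat_integral_const (n := n) s * (enorm y / 2) `^ (- (n%:R - 2 * s)))%:E *
   (enorm y `^ (- (2 * s + c)))%:E)%E).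
  by apply: lee_wpmul2r => //; rewrite lee_fin powR_ge0.
rewrite -EFinM lee_fin /riesz_weight /H.
have hc0 := ltW (heat_integral_const_gt0 (n := n) sn).
have := ler_pM (powR_ge0 _ _) (powR_ge0 _ _) K2 K3 => K4.
apply: (@le_trans _ _ (heat_integral_const (n := n) s *
  (4 `^ (n%:R - 2 * s) * Num.sqrt (2 + 2 * dot y y) `^ (- (n%:R - 2 * s)) *
    (rho `^ (- (c / 2)) * enorm y `^ (- (2 * s + c / 2)))))).
  by rewrite -[leLHS]mulrA; apply: ler_wpM2l.
move: (heat_integral_const _) (4 `^ _) (Num.sqrt _ `^ _) (rho `^ _) (enorm y `^ _) => A1 A2 A3 A4 A5.
by rewrite le_eqVlt; apply/orP; left; apply/eqP; ring.
Qed.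

(** The supersolution is A (|x|^-b - eta |x|^-c) in the ball, with c slightly below b. In the whole
    space the potential of gamma |y|^-2s times it, divided by Gamma s, is
    A (|x|^-b - eta th |x|^-c) with th = riesz_factor s c / riesz_factor s b > 1. The gain A eta (th - 1) |x|^-c is split into three
    equal parts, for eps, for u^p and for what the cut-off of the source at radius r costs. That cost comes
    from the radii beyond rho = eta^(-1/(b-c)) only, where the difference is negative. *)
Lemma riesz_hardy_solution_pos s alpha p r : 0 < s -> 0 <= alpha -> alpha < (n%:R - 2 * s) / 2 ->
  1 < p -> p < (n%:R + 2 * s - 2 * alpha) / (n%:R - 2 * s - 2 * alpha) -> 0 < r ->
  exists u, riesz_hardy_solution s (hardy_gamma n s alpha) p r u.
Proof.
move=> s0 al0 aln p1 pn r0.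
pose b := (n%:R - 2 * s) / 2 - alpha.
have b0 : 0 < b by rewrite subr_gt0.
have bQ2 : b <= (n%:R - 2 * s) / 2 by rewrite gerBl.
have bQ : b < n%:R - 2 * s by move: bQ2 b0; lra.
have bp : b * p < 2 * s + b.
  move: pn; rewrite ltr_pdivlMr; last by move: b0; rewrite /b; lra.
  by rewrite /b; lra.
pose del := Num.min b (2 * s + b - b * p) / 2.
have del0 : 0 < del by rewrite divr_gt0// lt_min b0 subr_gt0.
have delb : del <= b / 2 by rewrite ler_pM2r// ge_min lexx.
have delp : del <= (2 * s + b - b * p) / 2 by rewrite ler_pM2r// ge_min lexx orbT.
pose c := b - del.
have c0 : 0 < c by rewrite /c; lra.
have cb : c < b by rewrite /c; lra.
have cQ : c < n%:R - 2 * s by lra.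
have cp : b * p <= 2 * s + c by rewrite /c; lra.
have bp' : b * p <= 2 * s + b by lra.
have G0 := Gamma_gt0 s0.
have rb0 := riesz_factor_gt0 s0 b0 bQ; have rc0 := riesz_factor_gt0 s0 c0 cQ.
have [B BE] : exists B, rf s b = B by exists (rf s b).
have [F FE] : exists F, rf s c = F by exists (rf s c).
have [G GE] : exists G, Gamma s = G by exists (Gamma s).
have [gam gamE] : exists gam, hardy_gamma n s alpha = gam by exists (hardy_gamma n s alpha).
have rbc : rf s b < rf s c by apply: riesz_factor_lt.
have gE : hardy_gamma n s alpha * rf s b = Gamma s by apply: hardy_gammaE => //; rewrite al0.
rewrite BE FE GE gamE in rb0 rc0 G0 rbc gE *.
have gam0 : 0 < gam by rewrite -(pmulr_lgt0 _ rb0) gE.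
have [CT CT0 tail] := riesz_tail s0 c0 cQ.
pose th := F / B.
have th1 : 0 < th - 1 by rewrite subr_gt0 /th ltr_pdivlMr// mul1r.
have kg : G^-1 * gam = (B)^-1 by rewrite -gE; field; rewrite !gt_eqF.
(* rho is chosen so that the tail is absorbed by a third of the gain th - 1 *)
pose K1 := (th - 1) / 3 * r `^ (- c) * B / CT.
have K10 : 0 < K1 by rewrite !mulr_gt0 ?invr_gt0 ?powR_gt0.
pose rho := Num.max (Num.max 1 (2 * r)) (K1 `^ (- (2 / c))).
have rho1 : 1 <= rho by rewrite !le_max lexx.
have rho2 : 2 * r <= rho by rewrite !le_max lexx orbT.
have rho0 : 0 < rho by apply: lt_le_trans rho1.
have rhoK : rho `^ (- (c / 2)) <= K1.
  have h : K1 `^ (- (2 / c)) <= rho by rewrite !le_max lexx orbT.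
  have c20 : 0 <= c / 2 by rewrite divr_ge0// ltW.
  have := @ge0_ler_powR R _ c20 _ _ _ _ h.
  rewrite !nnegrE powR_ge0 (ltW rho0) => /(_ isT isT).
  rewrite -powRrM (_ : - (2 / c) * (c / 2) = - 1); last by field; rewrite gt_eqF.
  rewrite powR_inv1; last exact: ltW.
  rewrite powRN => h2.
  by rewrite -[K1]invrK lef_pV2// ?posrE ?powR_gt0 ?invr_gt0.
pose eta := rho `^ (- del).
have eta0 : 0 < eta by exact: powR_gt0.
pose C1 := r `^ (2 * s + c - b * p); pose C2 := r `^ (2 * s + b - b * p).
have C10 : 0 < C1 by exact: powR_gt0.
have C20 : 0 < C2 by exact: powR_gt0.
have K20 : 0 < eta * (th - 1) / 3 * G / (C1 * F).
  by rewrite divr_gt0 ?mulr_gt0// divr_gt0// mulr_gt0.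
have [A A0 Ap] := exists_powR_root p1 K20.
have p0 : 0 < p by apply: lt_trans p1.
pose V y := ball_power r b y - eta * ball_power r c y.
have in_ball y : 0 < enorm y < r -> V y = enorm y `^ (- b) - eta * enorm y `^ (- c).
  by move=> yr; rewrite /V /ball_power yr.
have bcE t : 0 < t -> t `^ (- b) = t `^ (- del) * t `^ (- c).
  move=> t0; rewrite -powRD; first by congr (_ `^ _); rewrite /c; ring.
  by apply/implyP => _; exact: lt0r_neq0.
have eta_le t : 0 < t -> t <= rho -> eta * t `^ (- c) <= t `^ (- b).
  move=> t0 tr; rewrite bcE// ler_wpM2r ?powR_ge0// /eta !powRN lef_pV2 ?posrE ?powR_gt0//.
  by apply: ge0_ler_powR => //; [exact: ltW|by rewrite nnegrE ltW..].
have rrho : r <= rho by move: rho2 r0; clear; lra.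
have V0 y : 0 <= V y.
  rewrite /V /ball_power; case: ifPn => [/andP[y0 yr]|_]; last by rewrite mulr0 subrr.
  by rewrite subr_ge0 eta_le// ltW// (lt_le_trans yr).
have Vb y : 0 < enorm y < r -> V y <= enorm y `^ (- b).
  by move=> yr; rewrite in_ball// gerBl mulr_ge0 ?powR_ge0// ltW.
pose U y := A * V y.
have U0 y : 0 <= U y by rewrite mulr_ge0// ltW.
have mU : measurable_fun setT U.
  apply: measurable_funM; first exact: measurable_cst.
  apply: measurable_funB => //; apply: measurable_funM => //; exact: measurable_cst.
have src0 y : 0 <= hardy_source s gam p r U y by apply: hardy_source_ge0 => //; exact: ltW.
have msrc := measurable_hardy_source s gam p r mU.
have Up y : 0 < enorm y < r -> U y `^ p <= A `^ p * enorm y `^ (- (b * p)).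
  move=> yr; rewrite (_ : - (b * p) = - b * p); last by ring.
  rewrite powRrM -powRM ?powR_ge0 ?(ltW A0)//; apply: ge0_ler_powR; rewrite ?nnegrE ?mulr_ge0 ?powR_ge0 ?(ltW A0) ?(ltW p0)//.
  by rewrite ler_wpM2l ?(ltW A0)// Vb.
pose M := gam * A + A `^ p * C2.
have M0 : 0 <= M by rewrite addr_ge0// mulr_ge0 ?powR_ge0// ltW.
have split2s t q : 0 < t -> t `^ (- (2 * s)) * t `^ (- q) = t `^ (- (2 * s + q)).
  move=> t0; rewrite -powRD; first by congr (_ `^ _); ring.
  by apply/implyP => _; exact: lt0r_neq0.
have Us y : y != 0 -> hardy_source s gam p r U y <= M * enorm y `^ (- (2 * s + b)).
  rewrite -enorm_gt0 => y0; rewrite /hardy_source; case: ifPn => [yr|_]; last by rewrite mulr_ge0 ?powR_ge0.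
  rewrite /M [leRHS]mulrDl; apply: lerD.
    have -> : gam * enorm y `^ (- (2 * s)) * U y = gam * A * enorm y `^ (- (2 * s)) * V y by rewrite /U; ring.
    rewrite -split2s// mulrA; apply: ler_wpM2l; last exact: Vb.
    by rewrite mulr_ge0 ?powR_ge0// mulr_ge0// ltW.
  apply: (le_trans (Up y yr)); rewrite -mulrA ler_wpM2l ?powR_ge0//.
  by apply: powR_le_powR => //; case/andP: yr.
pose e := A * eta * (th - 1) / 3 * r `^ (- c).
have e0 : 0 < e by rewrite !mulr_gt0 ?powR_gt0 ?invr_gt0.
apply: (@riesz_hardy_solution_of_super s gam p r e b M U) => //; first exact: ltW.
move=> x xr; have /andP[x0 xr'] := xr; rewrite GE.
have x0' : x != 0 by rewrite -enorm_gt0.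
pose T y : R := if rho <= enorm y then enorm y `^ (- (2 * s + c)) else 0.
have mT : measurable_fun setT T.
  apply: measurable_fun_ifT; [|exact: measurable_enorm_powR|exact: measurable_cst].
  apply: measurable_fun_ler; first exact: measurable_cst.
  exact: (measurable_enorm (@measurable_id _ 'rV[R]_n setT)).
have T0 y : 0 <= T y by rewrite /T; case: ifP => // _; rewrite powR_ge0.
pose P q y : R := enorm y `^ (- (2 * s + q)).
have P0 q y : 0 <= P q y by exact: powR_ge0.
have mP q : measurable_fun setT (P q) by exact: measurable_enorm_powR.
have IP q : 0 < q -> q < n%:R - 2 * s -> riesz_potential s (P q) x = (rf s q * enorm x `^ (- q))%:E.
  by move=> q0 qQ; exact: riesz_potential_power.
have lin (f g : 'rV[R]_n -> R) (k l : R) : measurable_fun setT f -> measurable_fun setT g ->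
    (forall y, 0 <= f y) -> (forall y, 0 <= g y) -> 0 <= k -> 0 <= l ->
    riesz_potential s (fun y => k * f y + l * g y) x =
    (k%:E * riesz_potential s f x + l%:E * riesz_potential s g x)%E.
  move=> mf mg f0 g0 k0 l0; rewrite /riesz_potential -!ge0_integralZl ?lee_fin//.
  - rewrite -ge0_integralD//.
    + apply: eq_integral => y _; rewrite EFinD !EFinM ge0_muleDr ?mule_ge0 ?lee_fin//.
      by rewrite muleCA [X in (_ + X)%E]muleCA.
    + by move=> y _; rewrite !mule_ge0 ?heat_integral_ge0 ?lee_fin.
    + by apply: emeasurable_funM; [exact: measurable_cst|exact: measurable_riesz_integrand].
    + by move=> y _; rewrite !mule_ge0 ?heat_integral_ge0 ?lee_fin.
    + by apply: emeasurable_funM; [exact: measurable_cst|exact: measurable_riesz_integrand].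
  - exact: measurable_riesz_integrand.
  - by move=> y _; rewrite mule_ge0 ?heat_integral_ge0 ?lee_fin.
  - exact: measurable_riesz_integrand.
  - by move=> y _; rewrite mule_ge0 ?heat_integral_ge0 ?lee_fin.
(* adding a multiple of P c to both sides makes all terms nonnegative, so that their potentials add up *)
have key y : y != 0 -> hardy_source s gam p r U y + gam * A * eta * P c y <=
    (gam * A * P b y + gam * A * eta * T y) + (A `^ p * C1) * P c y.
  rewrite -enorm_gt0 => y0; rewrite /hardy_source; case: ifPn => [yr|yr].
    have h1 : U y `^ p <= A `^ p * C1 * P c y.
      apply: (le_trans (Up y yr)); rewrite -mulrA ler_wpM2l ?powR_ge0//.
      by apply: powR_le_powR => //; case/andP: yr.
    have h2 : 0 <= gam * A * eta * T y by rewrite !mulr_ge0// ltW.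
    have h3 : gam * enorm y `^ (- (2 * s)) * U y = gam * A * P b y - gam * A * eta * P c y.
      by rewrite /U in_ball// /P -!split2s//; ring.
    by move: h1 h2 h3; clear; lra.
  have h2 : 0 <= A `^ p * C1 * P c y by rewrite !mulr_ge0 ?powR_ge0.
  have gA : 0 <= gam * A by rewrite mulr_ge0 ?ltW.
  have h3 : eta * P c y <= P b y + eta * T y.
    rewrite /T; case: ifPn => [_|]; first by rewrite lerDr.
    rewrite -ltNge => yrho; rewrite mulr0 addr0 /P -!split2s// mulrCA ler_wpM2l ?powR_ge0//.
    by rewrite eta_le// ltW.
  by move: h2 (ler_wpM2l gA h3); clear; lra.
have H1 : (riesz_potential s (hardy_source s gam p r U) x + (gam * A * eta)%:E * riesz_potential s (P c) x <=
   ((gam * A)%:E * riesz_potential s (P b) x + (gam * A * eta)%:E * riesz_potential s T x) +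
   (A `^ p * C1)%:E * riesz_potential s (P c) x)%E.
  have g1 : 0 <= gam * A * eta by rewrite !mulr_ge0// ltW.
  have g2 : 0 <= gam * A by rewrite !mulr_ge0// ltW.
  have g3 : 0 <= A `^ p * C1 by rewrite !mulr_ge0 ?powR_ge0.
  have F0 y : 0 <= gam * A * P b y + gam * A * eta * T y by rewrite addr_ge0// mulr_ge0.
  have mF : measurable_fun setT (fun y => gam * A * P b y + gam * A * eta * T y).
    by apply: measurable_funD; apply: measurable_funM => //; exact: measurable_cst.
  rewrite -lin// -[riesz_potential s (fun y => _ + _) x]mul1e -lin//.
  have E1 := lin _ _ 1 (gam * A * eta) msrc (mP c) src0 (P0 c) ler01 g1.
  rewrite mul1e in E1; rewrite -E1.
  apply: ae_ge0_le_integral => //.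
  - move=> y _; rewrite mule_ge0 ?heat_integral_ge0// lee_fin mul1r addr_ge0//.
    by apply: mulr_ge0.
  - apply: measurable_riesz_integrand; apply: measurable_funD; apply: measurable_funM => //; exact: measurable_cst.
  - move=> y _; rewrite mule_ge0 ?heat_integral_ge0// lee_fin mul1r addr_ge0//.
    by apply: mulr_ge0.
  - apply: measurable_riesz_integrand; apply: measurable_funD; apply: measurable_funM => //; exact: measurable_cst.
  apply: filterS (ae_neq 0) => y y0 _.
  by rewrite lee_wpmul2l ?heat_integral_ge0// lee_fin !mul1r key.
move: H1; rewrite !IP// BE FE.
have := tail r rho x r0 rho1 rho2 xr'; rewrite -/(riesz_potential s T x).
have : (0 <= riesz_potential s T x)%E by exact: riesz_potential_ge0.
have : (0 <= riesz_potential s (hardy_source s gam p r U) x)%E by exact: riesz_potential_ge0.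
case: (riesz_potential s T x) => [t||//]; last by rewrite leye_eq.
case: (riesz_potential s _ x) => [S||//]; last by rewrite !addye// -!EFinM -!EFinD leye_eq.
rewrite -!EFinM -!EFinD !lee_fin => S0 t0 tle H1.
rewrite /U in_ball//.
set X := enorm x `^ (- c) in H1 *; set Y := enorm x `^ (- b) in H1 *.
have rX : r `^ (- c) <= X.
  by rewrite /X !powRN lef_pV2 ?posrE ?powR_gt0//; apply: ge0_ler_powR; rewrite ?nnegrE ltW.
have t1 : t <= (th - 1) / 3 * r `^ (- c) * B.
  apply: (le_trans tle); apply: (le_trans (ler_wpM2l (ltW CT0) rhoK)).
  by rewrite /K1 mulrCA mulfV ?mulr1// gt_eqF.
have kS : G^-1 * S <= A * Y - A * eta * th * X + A * eta * (B)^-1 * t + A * eta * (th - 1) / 3 * X.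
  have Gi0 : 0 < G^-1 by rewrite invr_gt0.
  have H2 : S <= gam * A * (B * Y) + gam * A * eta * t + A `^ p * C1 * (F * X) - gam * A * eta * (F * X) by move: H1; clear; lra.
  apply: (le_trans (ler_wpM2l (ltW Gi0) H2)); rewrite le_eqVlt; apply/orP; left; apply/eqP.
  rewrite Ap /th -gE.
  by field; rewrite !gt_eqF.
have t2 : (B)^-1 * t <= (th - 1) / 3 * r `^ (- c).
  by rewrite mulrC ler_pdivrMr.
have Ae0 : 0 < A * eta by rewrite mulr_gt0.
apply: (le_trans (lerD (lexx e) kS)).
have t3 := ler_wpM2l (ltW Ae0) t2.
have th0 : 0 < (th - 1) / 3 by rewrite divr_gt0.
have t4 := ler_wpM2l (mulr_ge0 (ltW Ae0) (ltW th0)) rX.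
clearbody th.
rewrite /e (_ : A * (Y - eta * X) = A * Y - A * eta * X); last by ring.
move: t3 t4; rewrite !mulrA.
move: (r `^ (- c)) => Rc; move: (A * eta) => D; move: (B^-1) => Bi.
by move: (A * Y); clear => AY t3 t4; lra.
Qed.

End supersolutions.

(** * Integration by parts for functions with bounded support *)

Section coordinate_calculus.
Context {R : realType}.
Local Notation leb := (@lebesgue_measure R).

(** Reduces directional derivatives to derivatives on the line. *)
Lemma derive_slice n (f : 'rV[R]_n -> R) (x v : 'rV[R]_n) (df : R) :
  is_derive (0 : R) 1 (fun t : R => f (t *: v + x)) df -> is_derive x v f df.
Proof.
have E : (fun h : R => h^-1 *: (((fun t : R => f (t *: v + x)) \o shift 0) (h *: (1 : R)) -
    (fun t : R => f (t *: v + x)) 0)) = (fun h => h^-1 *: ((f \o shift x) (h *: v) - f x)).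
  by apply/funext => h /=; rewrite addr0 scale0r add0r [h *: 1]mulr1.
move=> [d1 d2]; split; first by move: d1; rewrite /derivable E.
by rewrite -d2 /derive E.
Qed.

Lemma slice_cons n (f : 'rV[R]_n.+1 -> R) (w : 'rV[R]_n) (x : R) :
  derivable f (rV_cons (x, w)) (delta_mx ord0 ord0) ->
  is_derive x 1 (fun t : R => f (rV_cons (t, w))) ('D_(delta_mx ord0 ord0) f (rV_cons (x, w))).
Proof.
have E : (fun h : R => h^-1 *: (((fun t : R => f (rV_cons (t, w))) \o shift x) (h *: (1 : R)) -
    (fun t : R => f (rV_cons (t, w))) x)) =
    (fun h => h^-1 *: ((f \o shift (rV_cons (x, w))) (h *: (delta_mx ord0 ord0 : 'rV[R]_n.+1)) - f (rV_cons (x, w)))).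
  apply/funext => h /=; congr (_ *: (f _ - _)); apply/rowP => j; rewrite !mxE eqxx/=.
  case: (unliftP ord0 j) => [k|] ->; rewrite ?liftK ?unlift_none/= ?eqxx.
    by rewrite mulr0 add0r.
  by rewrite mulr1 [h *: 1]mulr1.
by move=> d1; split; [move: d1; rewrite /derivable E|rewrite /derive E].
Qed.

Lemma slice_lift n (f : 'rV[R]_n.+1 -> R) (x : R) (w : 'rV[R]_n) (j : 'I_n) :
  derivable f (rV_cons (x, w)) (delta_mx ord0 (lift ord0 j)) ->
  is_derive w (delta_mx ord0 j) (fun v => f (rV_cons (x, v)))
    ('D_(delta_mx ord0 (lift ord0 j)) f (rV_cons (x, w))).
Proof.
have E : (fun h : R => h^-1 *: (((fun v => f (rV_cons (x, v))) \o shift w) (h *: (delta_mx ord0 j : 'rV[R]_n)) -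
    (fun v => f (rV_cons (x, v))) w)) =
    (fun h => h^-1 *: ((f \o shift (rV_cons (x, w))) (h *: (delta_mx ord0 (lift ord0 j) : 'rV[R]_n.+1)) - f (rV_cons (x, w)))).
  apply/funext => h /=; congr (_ *: (f _ - _)); apply/rowP => k; rewrite !mxE eqxx/=.
  case: (unliftP ord0 k) => [l|] ->; rewrite ?liftK ?unlift_none/=.
    by rewrite !mxE eqxx/= (inj_eq lift_inj).
  by rewrite mulr0 add0r.
by move=> d1; split; [move: d1; rewrite /derivable E|rewrite /derive E].
Qed.

Lemma continuous_rV_cons_l n (w : 'rV[R]_n) : continuous (fun t : R => rV_cons (t, w)).
Proof.
move=> t A /nbhs_ballP [e /= e0 eA]; apply/nbhs_ballP; exists e => // u tu.
apply: eA; split => // i j; rewrite !mxE; case: (unlift ord0 j) => [k|//].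
exact: ballxx.
Qed.

Lemma continuous_rV_cons_r n (t : R) : continuous (fun w : 'rV[R]_n => rV_cons (t, w)).
Proof.
move=> w A /nbhs_ballP [e /= e0 eA]; apply/nbhs_ballP; exists e => // u [_ tu].
apply: eA; split => // i j; rewrite !mxE; case: (unlift ord0 j) => [k|]; last exact: ballxx.
exact: tu.
Qed.

Lemma continuous_slice_l n (f : 'rV[R]_n.+1 -> R) (w : 'rV[R]_n) :
  continuous f -> continuous (fun t : R => f (rV_cons (t, w))).
Proof. by move=> cf t; apply: continuous_comp; [exact: continuous_rV_cons_l|exact: cf]. Qed.

Lemma continuous_slice_r n (f : 'rV[R]_n.+1 -> R) (t : R) :
  continuous f -> continuous (fun w : 'rV[R]_n => f (rV_cons (t, w))).
Proof. by move=> cf w; apply: continuous_comp; [exact: continuous_rV_cons_r|exact: cf]. Qed.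

Definition box_supported n (M : R) (f : 'rV[R]_n -> R) :=
  forall (x : 'rV[R]_n) (i : 'I_n), M < `|x ord0 i| -> f x = 0.

Lemma box_supported_derive n (M : R) (f : 'rV[R]_n -> R) v :
  box_supported M f -> box_supported M (fun x => 'D_v f x).
Proof.
move=> f0 x i xi.
rewrite (@near_eq_derive _ _ _ f (cst 0) x v); first by rewrite derive_cst.
have := @coord_continuous R 1 n ord0 i x => /cvg_norm c.
have /c h : nbhs `|x ord0 i| [set t : R | M < t] by apply: lt_nbhsr.
by near=> y; rewrite (f0 y i)//; near: y; exact: h.
Unshelve. all: by end_near. Qed.

(** A continuous function with bounded support is dominated by a Gaussian, which settles at once
    all its integrability questions. *)
Lemma box_supported_gauss n (M : R) (f : 'rV[R]_n -> R) : continuous f -> box_supported M f ->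
  exists2 C, 0 <= C & forall x, `|f x| <= C * expR (- dot x x).
Proof.
move=> cf f0.
pose g x := f x * expR (dot x x).
have cd : continuous (fun x : 'rV[R]_n => dot x x).
  rewrite /dot; apply: (@continuous_big R 'I_n +%R) => [|i _]; first exact: add_continuous.
  by move=> x; apply: (@cvgM _ _ (nbhs x)); exact: (@coord_continuous R 1 n ord0 i x).
have cg : continuous g.
  move=> x; apply: (@cvgM _ _ (nbhs x)); first exact: cf.
  apply: continuous_comp; first exact: cd.
  exact: continuous_expR.
pose K := [set v : 'rV[R]_n | forall i : 'I_n, `[(- M), M]%classic (v ord0 i : R)].
have cK : compact K 
  by apply: (@rV_compact R n (fun=> `[(- M), M]%classic)) => i; exact: segment_compact.
have : compact (g @` K) by apply: continuous_compact => //; exact: continuous_subspaceT.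
move=> /compact_bounded[B [_ /(_ (Num.max 0 B + 1))]].
have -> : B < Num.max 0 B + 1 by rewrite (le_lt_trans (y := Num.max 0 B)) ?ltrDl// le_max lexx orbT.
move=> /(_ isT) gB.
have C0 : 0 <= Num.max 0 B + 1 by rewrite addr_ge0// le_max lexx.
exists (Num.max 0 B + 1) => // x.
have [Kx|nKx] := pselect (K x).
  rewrite expRN -ler_pdivrMr ?invr_gt0 ?expR_gt0// invrK.
  have : `|g x| <= Num.max 0 B + 1 by apply: gB; exists x.
  by rewrite /g normrM (ger0_norm (expR_ge0 _)).
suff -> : f x = 0 by rewrite normr0 mulr_ge0 ?expR_ge0.
have [i xi] : exists i, M < `|x ord0 i|.
  apply: contrapT => h; apply: nKx => i /=; rewrite in_itv/= -ler_norml.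
  by rewrite leNgt; apply/negP => xi; apply: h; exists i.
exact: f0 xi.
Qed.

Lemma integrable_gauss0 n : (lebesgue_rV R n).-integrable setT (EFin \o (fun x => expR (- dot x x))).
Proof.
have := @integrable_gauss_rV R n 1 0 ltr01; apply: eq_integrable => // x _ /=.
by rewrite mul1r subr0.
Qed.

Lemma integrable_box_supported n (M : R) (f : 'rV[R]_n -> R) : continuous f -> box_supported M f ->
  (lebesgue_rV R n).-integrable setT (EFin \o f).
Proof.
move=> cf f0; have [C C0 h] := box_supported_gauss cf f0.
apply: (@integrable_le _ _ _ _ f (fun x => C * expR (- dot x x))) => //.
  exact: continuous_measurable_rV.
exact: (integrableZl measurableT C (@integrable_gauss0 n)).
Qed.

(** The fundamental theorem of calculus on an interval that contains the support. *)
Lemma Rintegral_derive0 (M : R) (f df : R -> R) : continuous df ->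
  (forall x : R, is_derive x 1 f (df x)) -> (forall x : R, M < `|x| -> f x = 0 /\ df x = 0) ->
  \int[leb]_x df x = 0.
Proof.
move=> cdf dfE f0.
pose a := Num.max 0 M + 1.
have a0 : 0 < a by rewrite ltr_pwDr// le_max lexx.
have aM : M < a by rewrite (le_lt_trans (y := Num.max 0 M)) ?ltrDl// le_max lexx orbT.
rewrite /Rintegral (_ : (\int[leb]_x (df x)%:E)%E = (\int[leb]_(x in `[(- a)%R, a%R]%classic) (df x)%:E)%E); last first.
  rewrite [RHS]integral_mkcond; apply: eq_integral => x _; rewrite patchE.
  case: ifPn => //; rewrite notin_setE /= in_itv/= -ler_norml => /negP; rewrite -ltNge => xa.
  by have [_ ->] := f0 x (lt_trans aM xa).
rewrite (@continuous_FTC2 R df f).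
- have [-> _] : f a = 0 /\ df a = 0 by apply: f0; rewrite ger0_norm// ltW.
  have [-> _] : f (- a) = 0 /\ df (- a) = 0 by apply: f0; rewrite normrN ger0_norm// ltW.
  by rewrite subee.
- by rewrite ltrNl (lt_trans _ a0)// oppr_lt0.
- exact: continuous_subspaceT.
- have cf : continuous f.
    move=> x; apply: differentiable_continuous; apply/derivable1_diffP.
    by have [] := dfE x.
  split.
  + by move=> x _; have [] := dfE x.
  + by apply: cvg_at_right_filter; exact: cf.
  + by apply: cvg_at_left_filter; exact: cf.
- by move=> x _; rewrite derive1E; have [_ ->] := dfE x.
Qed.

(** By induction on the dimension: the derivative in the first coordinate is integrated over that
    coordinate first, after Fubini, and any other one is treated by induction on each slice. *)
Lemma integral_derive0 n (M : R) (f : 'rV[R]_n -> R) (i : 'I_n) :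
  (forall x, derivable f x (delta_mx ord0 i)) ->
  continuous (fun x => 'D_(delta_mx ord0 i) f x) ->
  box_supported M f -> \int[lebesgue_rV R n]_x 'D_(delta_mx ord0 i) f x = 0.
Proof.
elim: n f i => [f []//|n IH] f i df cdf f0.
have f1 := @box_supported_derive _ _ _ (delta_mx ord0 i) f0.
have If := integrable_box_supported cdf f1.
have Ic := integrable_rV_cons If.
rewrite integral_rVS//.
case: (unliftP ord0 i) => [j|] iE; subst i.
  rewrite [LHS](_ : _ = \int[leb]_x (0 : R)); last first.
    apply: eq_Rintegral => x _.
    have E v := @derive_val _ _ _ _ _ _ _ (@slice_lift n f x v j (df _)).
    rewrite -[RHS](IH (fun v => f (rV_cons (x, v))) j).
    + by apply: eq_Rintegral => v _; rewrite E.
    + by move=> v; have [] := @slice_lift n f x v j (df _).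
    + rewrite [X in continuous X](_ : _ = fun v => 'D_(delta_mx ord0 (lift ord0 j)) f (rV_cons (x, v))).
        exact: (continuous_slice_r cdf).
      by apply/funext => v; rewrite E.
    + move=> v k vk; apply: (f0 _ (lift ord0 k)).
      by rewrite mxE liftK.
  by rewrite Rintegral_cst// mul0r.
rewrite (@Rintegral_fubini _ _ _ _ _ leb (lebesgue_rV R n)
  (fun z : measurableTypeR R * 'rV[R]_n => 'D_(delta_mx ord0 ord0) f (rV_cons z))); last 2 first.
- by have /integrableP[/measurable_EFinP] := Ic.
- by have /integrableP[m] := Ic; rewrite fubini_tonelli1//; exact: measurableT_comp.
rewrite [LHS](_ : _ = \int[lebesgue_rV R n]_v (0 : R)); last first.
  apply: eq_Rintegral => v _.
  apply: (@Rintegral_derive0 M (fun t => f (rV_cons (t, v)))).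
  + exact: (continuous_slice_l cdf).
  + by move=> t; apply: slice_cons.
  + move=> t tM; split; first by apply: (f0 _ ord0); rewrite mxE unlift_none.
    by apply: (f1 _ ord0); rewrite mxE unlift_none.
by rewrite /Rintegral integral0.
Qed.

End coordinate_calculus.

(** * Cosine transforms of test functions *)

Section cosine_transform.
Context {R : realType} {n : nat}.
Local Notation leb := (@lebesgue_measure R).
Local Notation mu := (lebesgue_rV R n).
Implicit Types f g : 'rV[R]_n -> R.

Lemma continuous_rVB f g : continuous f -> continuous g -> continuous (fun x => f x - g x).
Proof. by move=> cf cg x; apply: (@cvgB _ _ _ (nbhs x)); [exact: cf|exact: cg]. Qed.

Lemma continuous_rVM f g : continuous f -> continuous g -> continuous (fun x => f x * g x).
Proof. by move=> cf cg x; apply: (@cvgM _ _ (nbhs x)); [exact: cf|exact: cg]. Qed.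

Lemma continuous_cos_dot (z : 'rV[R]_n) (theta : R) : continuous (fun x => cos (dot z x + theta)).
Proof.
have cd : continuous (fun x => dot z x).
  rewrite /dot; apply: (@continuous_big R 'I_n +%R) => [|i _]; first exact: add_continuous.
  apply: (@continuous_rVM (fun=> z ord0 i) (fun x => x ord0 i)); first exact: (@cst_continuous 'rV[R]_n R).
  exact: (@coord_continuous R 1 n ord0 i).
move=> x; apply: (@continuous_comp _ _ _ (fun x => dot z x + theta) cos x); last exact: continuous_cos.
by apply: (@cvgD _ _ _ (nbhs x)); [exact: cd|exact: cvg_cst].
Qed.

(** The phase makes this one real function carry the real and imaginary parts of the Fourier
    transform, as well as its product with exp(i zeta . x). *)
Definition cos_transform f (z : 'rV[R]_n) (theta : R) : R :=
  \int[mu]_x (f x * cos (dot z x + theta)).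

(** Test functions, freed from the set that contains their support. *)
Definition smooth_boxed f := smooth f /\ exists M, box_supported M f.

Lemma iter_partialB f g l : smooth f -> smooth g ->
  iter_partial l (fun x => f x - g x) = (fun x => iter_partial l f x - iter_partial l g x).
Proof.
move=> sf sg; elim: l => //= i l ->; apply/funext => x; rewrite /partial.
by rewrite deriveB; [|exact: (sf l).2|exact: (sg l).2].
Qed.

Lemma smooth_boxedB f g : smooth_boxed f -> smooth_boxed g -> smooth_boxed (fun x => f x - g x).
Proof.
move=> [sf [M fM]] [sg [M' gM]]; split.
  move=> l; rewrite iter_partialB//; split.
    by apply: continuous_rVB; [exact: (sf l).1|exact: (sg l).1].
  by move=> i x; apply: derivableB; [exact: (sf l).2|exact: (sg l).2].
exists (Num.max M M') => x i xi.
rewrite (fM x i) ?(gM x i) ?subrr//; apply: le_lt_trans xi.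
  by rewrite le_max lexx orbT.
by rewrite le_max lexx.
Qed.

Lemma smooth_boxed_partial f i : smooth_boxed f -> smooth_boxed (partial i f).
Proof.
move=> [sf [M fM]]; split; last by exists M; exact: box_supported_derive.
move=> l; have -> : iter_partial l (partial i f) = iter_partial (rcons l i) f.
  by rewrite /iter_partial foldr_rcons.
exact: sf.
Qed.

Lemma smooth_boxed_continuous f : smooth_boxed f -> continuous f.
Proof. by move=> [sf _]; exact: (sf [::]).1. Qed.

Lemma smooth_boxed_integrable f : smooth_boxed f -> mu.-integrable setT (EFin \o f).
Proof. by move=> fs; have [_ [M fM]] := fs; exact: integrable_box_supported (smooth_boxed_continuous fs) fM. Qed.

Lemma is_derive_cos_dot (z : 'rV[R]_n) (theta : R) (i : 'I_n) (x : 'rV[R]_n) :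
  is_derive x (delta_mx ord0 i) (fun x => cos (dot z x + theta)) (- z ord0 i * sin (dot z x + theta)).
Proof.
apply: derive_slice.
rewrite (_ : (fun t : R => _) = (fun t : R => cos (t * z ord0 i + (dot z x + theta)))); last first.
  apply/funext => t; congr cos; rewrite addrA; congr (_ + _).
  rewrite /dot (eq_bigr (fun j => t * (z ord0 j * (delta_mx ord0 i : 'rV[R]_n) ord0 j) + z ord0 j * x ord0 j)); last first.
    by move=> j _; rewrite !mxE; ring.
  rewrite big_split/= -mulr_sumr; congr (_ * _ + _).
  rewrite (bigD1 i)//= big1 ?addr0; first by rewrite !mxE !eqxx mulr1.
  by move=> j ji; rewrite !mxE (negbTE ji) andbF mulr0.
have d : is_derive (0:R) (1:R) (fun t : R => t * z ord0 i + (dot z x + theta)) (z ord0 i).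
  have d0 := is_deriveD (is_deriveM (is_derive_id (0 : R) (1 : R)) (is_derive_cst (z ord0 i) (0 : R) (1 : R)))
    (is_derive_cst (dot z x + theta) (0 : R) (1 : R)).
  case: d0 => a b; split; first exact: a.
  apply: (etrans b); rewrite /GRing.scale/=; ring.
have := is_derive1_comp (is_derive_cos _) d.
by rewrite mul0r add0r => h; apply: is_derive_eq h _; ring.
Qed.

(** Integration by parts; the derivative of the cosine is again a cosine, shifted by a
    quarter period. *)
Lemma cos_transform_partial f i z theta : smooth_boxed f ->
  cos_transform (partial i f) z theta = z ord0 i * cos_transform f z (theta - pi / 2).
Proof.
move=> fs; have fs1 := smooth_boxed_partial i fs; have [sf [M fM]] := fs.
have cf := smooth_boxed_continuous fs; have cf1 := smooth_boxed_continuous fs1.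
have cM g t : continuous g -> continuous (fun x => g x * cos (dot z x + t)).
  by move=> cg; apply: continuous_rVM => //; exact: continuous_cos_dot.
have I1 := @integrable_box_supported R n M (fun x => partial i f x * cos (dot z x + theta)) (cM _ _ cf1).
have I2 := @integrable_box_supported R n M (fun x => f x * cos (dot z x + (theta - pi/2))) (cM _ _ cf).
have E x : is_derive x (delta_mx ord0 i) (fun x => f x * cos (dot z x + theta))
    (partial i f x * cos (dot z x + theta) - z ord0 i * (f x * cos (dot z x + (theta - pi / 2)))).
  have d1 : is_derive x (delta_mx ord0 i) f (partial i f x) by apply: derivableP; exact: (sf [::]).2.
  have d2 := is_derive_cos_dot z theta i x.
  case: (is_deriveM d1 d2) => a b; split; first exact: a.
  apply: (etrans b); rewrite /GRing.scale/= addrA (cosB (_ + _)) cos_pihalf sin_pihalf; ring.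
have := @integral_derive0 R n M (fun x => f x * cos (dot z x + theta)) i.
rewrite (_ : (fun x => 'D_(delta_mx ord0 i) _ x) =
  fun x => partial i f x * cos (dot z x + theta) - z ord0 i * (f x * cos (dot z x + (theta - pi / 2)))); last first.
  by apply/funext => x; have [_ ->] := E x.
have b1 : box_supported M (fun x => partial i f x * cos (dot z x + theta)).
  by move=> x k xk; rewrite (@box_supported_derive R n M f (delta_mx ord0 i) fM x k xk : partial i f x = 0) mul0r.
have b2 t : box_supported M (fun x => f x * cos (dot z x + t)).
  by move=> x k xk; rewrite (fM x k xk) mul0r.
move=> H; have : \int[mu]_x (partial i f x * cos (dot z x + theta) - z ord0 i * (f x * cos (dot z x + (theta - pi / 2)))) = 0.
  apply: H => //.
    apply: continuous_rVB; first exact: cM.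
    by apply: (@continuous_rVM (fun=> z ord0 i)); [exact: (@cst_continuous 'rV[R]_n R)|exact: cM].
rewrite RintegralB//; last 2 first.
- exact: I1.
- exact: (integrableZl measurableT (z ord0 i) (I2 (b2 _))).
move/eqP; rewrite subr_eq0 => /eqP H1; rewrite [LHS]H1.
by rewrite RintegralZl//; exact: I2.
Qed.

(** The operator 1 - d^2/dx_i^2, whose symbol 1 + zeta_i^2 never vanishes. *)
Definition bessel i f x : R := f x - partial i (partial i f) x.

Lemma smooth_boxed_bessel f i : smooth_boxed f -> smooth_boxed (bessel i f).
Proof. by move=> fs; apply: smooth_boxedB => //; do 2 apply: smooth_boxed_partial. Qed.

Lemma integrable_mul_cos f z theta : smooth_boxed f ->
  mu.-integrable setT (EFin \o (fun x => f x * cos (dot z x + theta))).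
Proof.
move=> fs; have [_ [M fM]] := fs; apply: (@integrable_box_supported R n M).
  by apply: continuous_rVM; [exact: smooth_boxed_continuous|exact: continuous_cos_dot].
by move=> x k xk; rewrite (fM x k xk) mul0r.
Qed.

Lemma cos_transform_bessel f i z theta : smooth_boxed f ->
  cos_transform (bessel i f) z theta = (1 + z ord0 i ^+ 2) * cos_transform f z theta.
Proof.
move=> fs; have fs1 := smooth_boxed_partial i fs; have fs2 := smooth_boxed_partial i fs1.
have -> : cos_transform (bessel i f) z theta =
    cos_transform f z theta - cos_transform (partial i (partial i f)) z theta.
  rewrite /cos_transform -RintegralB//; [|exact: integrable_mul_cos..].
  by apply: eq_Rintegral => x _; rewrite /bessel mulrBl.
rewrite !cos_transform_partial//.
have -> : cos_transform f z (theta - pi / 2 - pi / 2) = - cos_transform f z theta.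
  rewrite /cos_transform -[RHS]mulN1r -RintegralZl//; last exact: integrable_mul_cos.
  apply: eq_Rintegral => x _; rewrite (_ : _ + (_ - _ - _) = dot z x + theta - pi); last by field.
  by rewrite cosB cospi sinpi; ring.
by ring.
Qed.

Lemma cos_transform_bessels f l z theta : smooth_boxed f ->
  smooth_boxed (foldr bessel f l) /\
  cos_transform (foldr bessel f l) z theta = (\prod_(i <- l) (1 + z ord0 i ^+ 2)) * cos_transform f z theta.
Proof.
move=> fs; elim: l => [|i l [IH1 IH2]] /=; first by rewrite big_nil mul1r.
split; first exact: smooth_boxed_bessel.
by rewrite cos_transform_bessel// IH2 big_cons mulrA.
Qed.

Definition frequency_weight (z : 'rV[R]_n) : R := \prod_i (1 + z ord0 i ^+ 2).

Lemma frequency_weight_gt0 z : 0 < frequency_weight z.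
Proof. by apply: prodr_gt0 => i _; rewrite ltr_pwDl// sqr_ge0. Qed.

Lemma measurable_frequency_weight : measurable_fun setT frequency_weight.
Proof.
rewrite /frequency_weight; apply: measurable_prod => i _.
apply: measurable_funD; first exact: measurable_cst.
apply: measurable_funX; exact: measurable_coord.
Qed.

(** Apply the operator bessel twice in each coordinate. *)
Lemma cos_transform_decay f : smooth_boxed f ->
  exists2 C, 0 <= C & forall z theta, `|cos_transform f z theta| <= C * (frequency_weight z)^-1 ^+ 2.
Proof.
move=> fs; pose l := index_enum 'I_n ++ index_enum 'I_n.
have [hs _] := cos_transform_bessels l 0 0 fs.
exists (\int[mu]_x `|foldr bessel f l x|); first by apply: Rintegral_ge0.
move=> z theta; have [_] := cos_transform_bessels l z theta fs.
rewrite big_cat/= -expr2 -/(frequency_weight z) => E.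
have w0 := frequency_weight_gt0 z.
have -> : cos_transform f z theta = cos_transform (foldr bessel f l) z theta * (frequency_weight z)^-1 ^+ 2.
  by rewrite E mulrAC -exprMn mulfV ?gt_eqF// expr1n mul1r.
rewrite normrM (ger0_norm (_ : 0 <= _ ^+ 2)) ?sqr_ge0// ler_wpM2r ?sqr_ge0//.
have I := integrable_mul_cos z theta hs.
apply: (le_trans (le_normr_Rintegral _ I)) => //.
apply: le_Rintegral => //.
- exact: (integrable_norm I).
- exact: (integrable_norm (smooth_boxed_integrable hs)).
- by move=> x _; rewrite normrM ler_piMr// ler_norml cos_geN1 cos_le1.
Qed.

Lemma integral_frequency_weight : (\int[mu]_z ((frequency_weight z)^-1)%:E)%E = (pi ^+ n)%:E.
Proof.
rewrite -[n in _ ^+ n]card_ord -prodr_const.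
rewrite -(@integral_prod_coord R n (fun _ x => (1 + x ^+ 2)^-1) (fun=> pi)).
- by apply: eq_integral => z _; rewrite /frequency_weight prodfV.
- move=> i; apply: measurable_funTS => //; apply/measurable_funTS.
  exact: continuous_measurable_fun (@continuous_oneDsqrV R).
- by move=> i x; rewrite invr_ge0 addr_ge0// sqr_ge0.
- by move=> i; exact: integral_oneDsqrV.
Qed.

Lemma integrable_frequency_weight : mu.-integrable setT (EFin \o (fun z => (frequency_weight z)^-1)).
Proof.
apply: ge0_integrable.
- rewrite (_ : (fun z => _) = (fun z => frequency_weight z `^ (-1))).
    exact: (measurableT_comp (measurable_powR _) measurable_frequency_weight).
  by apply/funext => z; rewrite powR_inv1// ltW// frequency_weight_gt0.
- by move=> z; rewrite invr_ge0 ltW// frequency_weight_gt0.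
- by rewrite integral_frequency_weight ltry.
Qed.

Lemma dot_le_frequency_weight (z : 'rV[R]_n) : 1 + dot z z <= frequency_weight z.
Proof.
rewrite /dot /frequency_weight.
elim: (index_enum _) => [|i l IH]; first by rewrite !big_nil addr0.
rewrite !big_cons; have h : 0 <= z ord0 i * z ord0 i by rewrite -expr2 sqr_ge0.
have p0 : 0 <= \sum_(j <- l) z ord0 j * z ord0 j by apply: sumr_ge0 => j _; rewrite -expr2 sqr_ge0.
apply: le_trans (ler_wpM2l _ IH); last by rewrite addr_ge0// sqr_ge0.
by rewrite expr2; nra.
Qed.

Lemma enorm_powR_le_frequency_weight s (z : 'rV[R]_n) : 0 < s < 1 ->
  enorm z `^ (2 * s) <= frequency_weight z.
Proof.
move=> /andP[s0 s1]; apply: le_trans (dot_le_frequency_weight z).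
rewrite -sqr_enorm; have e0 := enorm_ge0 z.
have [e1|e1] := leP (enorm z) 1.
  apply: (@le_trans _ _ 1); last by rewrite lerDl sqr_ge0.
  have := @ge0_ler_powR R (2 * s) (mulr_ge0 (ler0n _ 2) (ltW s0)) (enorm z) 1; rewrite powR1 !nnegrE; exact.
apply: (@le_trans _ _ (enorm z ^+ 2)); last by rewrite lerDr.
rewrite -powR_mulrn//; apply: ler_powR; first exact: ltW.
by rewrite ger_pMr ?ltW.
Qed.

End cosine_transform.

(** * Heat flow and Fourier inversion *)

Section double_integral_bound.
Context d1 d2 (T1 : measurableType d1) (T2 : measurableType d2) {R : realType}.
Variables (m1 : {sigma_finite_measure set T1 -> \bar R}) (m2 : {sigma_finite_measure set T2 -> \bar R}).

Lemma double_integral_lt_pinfty (f : T1 * T2 -> R) (g : T1 -> R) (h : T2 -> R) :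
  measurable_fun setT f ->
  m1.-integrable setT (EFin \o g) -> m2.-integrable setT (EFin \o h) ->
  (forall x, 0 <= g x) -> (forall y, 0 <= h y) -> (forall x y, `|f (x, y)| <= g x * h y) ->
  (\int[m1]_x \int[m2]_y `|f (x, y)|%:E < +oo)%E.
Proof.
move=> mf ig ih g0 h0 fgh.
have /integrableP[mg fg] := ig; have /integrableP[mh fh] := ih.
have hE : (\int[m2]_y (h y)%:E < +oo)%E.
  by apply: le_lt_trans fh; apply: ge0_le_integral => //; [by move=> y _; rewrite lee_fin|exact: measurableT_comp|move=> y _ /=; rewrite lee_fin ler_norm].
have gE : (\int[m1]_x (g x)%:E < +oo)%E.
  by apply: le_lt_trans fg; apply: ge0_le_integral => //; [by move=> y _; rewrite lee_fin|exact: measurableT_comp|move=> y _ /=; rewrite lee_fin ler_norm].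
have mhr : measurable_fun setT h by apply/measurable_EFinP.
have mgr : measurable_fun setT g by apply/measurable_EFinP.
apply: (@le_lt_trans _ _ (\int[m1]_x ((g x)%:E * \int[m2]_y (h y)%:E))%E).
  apply: ge0_le_integral => //.
  - by move=> x _; apply: integral_ge0.
  - apply: (@measurable_integral_param _ _ _ _ R m2 (fun p => `|f p|%:E)).
    by apply/measurable_EFinP; exact: measurableT_comp.
  - apply: emeasurable_funM => //.
  - move=> x _; rewrite -ge0_integralZl//; last 2 first.
    + by move=> y _; rewrite lee_fin.
    + by rewrite lee_fin.
    apply: ge0_le_integral => //.
    + by apply/measurable_EFinP; apply: measurableT_comp => //; exact: (measurableT_comp mf (measurable_pair1 x)).
    + by apply: emeasurable_funM.
    + by move=> y _; rewrite -EFinM lee_fin.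
have H0 : (0 <= \int[m2]_y (h y)%:E)%E by apply: integral_ge0 => y _; rewrite lee_fin.
have Hf : (\int[m2]_y (h y)%:E)%E \is a fin_num by rewrite ge0_fin_numE.
rewrite -(fineK Hf) ge0_integralZr//; last 2 first.
- by move=> x _; rewrite lee_fin.
- by rewrite lee_fin fine_ge0.
have G0 : (0 <= \int[m1]_x (g x)%:E)%E by apply: integral_ge0 => x _; rewrite lee_fin.
by apply: lte_mul_pinfty; rewrite ?ge0_fin_numE// ltry.
Qed.

Lemma Rintegral_dominated_cvg (f_ : nat -> T1 -> R) (f g : T1 -> R) :
  (forall k, measurable_fun setT (f_ k)) -> measurable_fun setT f ->
  (forall x, f_ k x @[k --> \oo] --> f x) ->
  m1.-integrable setT (EFin \o g) -> (forall k x, `|f_ k x| <= g x) ->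
  \int[m1]_x f_ k x @[k --> \oo] --> \int[m1]_x f x.
Proof.
move=> mf_ mf cf ig fg.
have h : (\int[m1]_x (f_ k x)%:E)%E @[k --> \oo] --> (\int[m1]_x (f x)%:E)%E.
  have [] := @dominated_convergence _ _ _ m1 setT measurableT (fun k x => (f_ k x)%:E) (fun x => (f x)%:E) (fun x => (g x)%:E).
  - by move=> k; apply/measurable_EFinP.
  - by apply/measurable_EFinP.
  - by apply: aeW => x _; apply: cvg_EFin; [exact: nearW|exact: cf].
  - by [].
  - by apply: aeW => x k _; rewrite /= lee_fin.
  - by [].
have ifx : m1.-integrable setT (EFin \o f).
  apply: (integrable_le mf _ ig) => x.
  have c : `|f_ k x| @[k --> \oo] --> `|f x| by exact: (cvg_norm (cf x)).
  by apply: (ler_cvg_to c (cvg_cst (g x))); exact: nearW.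
apply: fine_cvg; rewrite fineK//.
exact: (integrable_fin_num measurableT ifx).
Qed.

End double_integral_bound.

Section heat_semigroup.
Context {R : realType} {n : nat}.
Local Notation leb := (@lebesgue_measure R).
Local Notation mu := (lebesgue_rV R n).
Implicit Types (f : 'rV[R]_n -> R) (x y z : 'rV[R]_n).

Lemma measurable_cos_transform d (T : measurableType d) f (g : T -> R) (z : T -> 'rV[R]_n) :
  measurable_fun setT f -> measurable_fun setT g -> measurable_fun setT z ->
  measurable_fun setT (fun t => cos_transform f (z t) (g t)).
Proof.
move=> mf mg mz.
apply: (@measurable_Rintegral_param _ _ _ _ R mu (fun p : T * 'rV[R]_n => f p.2 * cos (dot (z p.1) p.2 + g p.1))).
apply: measurable_funM; first exact: measurableT_comp mf (@measurable_snd _ _ _ _).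
apply: (measurableT_comp (continuous_measurable_fun (@continuous_cos _))).
apply: measurable_funD; last exact: measurableT_comp mg (@measurable_fst _ _ _ _).
by apply: measurable_dot; [exact: measurableT_comp mz (@measurable_fst _ _ _ _)|exact: measurable_snd].
Qed.

Lemma cos_transform_phase f z theta : smooth_boxed f ->
  cos_transform f z theta = cos_transform f z 0 * cos theta + cos_transform f z (pi / 2) * sin theta.
Proof.
move=> fs; have I t := integrable_mul_cos z t fs.
have Z a t : mu.-integrable setT (EFin \o (fun x => (f x * cos (dot z x + t)) * a)).
  exact: (integrableZr measurableT a (I t)).
rewrite /cos_transform -!RintegralZr//; [|exact: I..].
rewrite -RintegralD//; [|exact: Z..].
apply: eq_Rintegral => x _.
by rewrite addr0 !cosD cos_pihalf sin_pihalf; ring.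
Qed.

(** Each frequency is an eigenfunction of the heat semigroup. *)
Lemma heat_cos_transform f tau z y theta : smooth_boxed f ->
  \int[mu]_x (heat_kernel tau (x - y) * cos_transform f z (- (dot z x + theta))) =
  expR (- (expR tau * dot z z)) * cos_transform f z (- (dot z y + theta)).
Proof.
move=> fs; set a := expR (- tau) / 4; have a0 : 0 < a by rewrite divr_gt0// expR_gt0.
have p0 := pi_gt0 R.
have G t : \int[mu]_x (heat_kernel tau (x - y) * cos (dot (- z) x + t)) =
    expR (- (expR tau * dot z z)) * cos (dot (- z) y + t).
  rewrite /heat_kernel /gauss_kernel -/a.
  under eq_Rintegral do rewrite -mulrA.
  rewrite RintegralZl//; last first.
    apply: (integrable_le _ _ (@integrable_gauss_rV R n a y a0)).
      apply: measurable_funM; first by have /integrableP[/measurable_EFinP] := @integrable_gauss_rV R n a y a0.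
      exact: continuous_measurable_rV (@continuous_cos_dot R n _ _).
    by move=> x; rewrite normrM (ger0_norm (expR_ge0 _)) ler_piMr ?expR_ge0// ler_norml cos_geN1 cos_le1.
  rewrite integral_gauss_cos_rV// mulrA mulrA -exprMn -sqrtrM; last by apply: divr_ge0; exact: ltW.
  rewrite (_ : a / pi * (pi / a) = 1); last by rewrite mulrA divfK ?divff ?gt_eqF.
  rewrite sqrtr1 expr1n mul1r; congr (expR (- _) * _).
  have -> : dot (- z) (- z) = dot z z by rewrite /dot; apply: eq_bigr => i _; rewrite !mxE mulrNN.
  by rewrite /a expRN; have := expR_gt0 tau; move=> /lt0r_neq0 ?; field.
have E x : cos_transform f z (- (dot z x + theta)) =
   cos_transform f z 0 * cos (dot (- z) x - theta) + cos_transform f z (pi / 2) * cos (dot (- z) x + (- theta - pi / 2)).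
  have -> : dot (- z) x = - dot z x by rewrite /dot -sumrN; apply: eq_bigr => i _; rewrite !mxE mulNr.
  rewrite cos_transform_phase// opprD; congr (_ + _ * _).
  by rewrite addrA cosB cos_pihalf sin_pihalf; ring.
have IG t : mu.-integrable setT (EFin \o (fun x => heat_kernel tau (x - y) * cos (dot (- z) x + t))).
  rewrite /heat_kernel /gauss_kernel -/a.
  apply: (integrable_le _ _ (integrableZl measurableT (Num.sqrt (a / pi) ^+ n) (@integrable_gauss_rV R n a y a0))).
    apply: measurable_funM.
      apply: measurable_funM; first exact: measurable_cst.
      by have /integrableP[/measurable_EFinP] := @integrable_gauss_rV R n a y a0.
    exact: continuous_measurable_rV (@continuous_cos_dot R n _ _).
  move=> x; have h : 0 <= Num.sqrt (a / pi) ^+ n * expR (- (a * dot (x - y) (x - y))).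
    by rewrite mulr_ge0 ?expR_ge0 ?exprn_ge0 ?sqrtr_ge0.
  by rewrite normrM (ger0_norm h) ler_piMr// ler_norml cos_geN1 cos_le1.
under eq_Rintegral do rewrite E mulrDr mulrCA [X in _ + X]mulrCA.
rewrite RintegralD//; last 2 first.
- exact: (integrableZl measurableT _ (IG _)).
- exact: (integrableZl measurableT _ (IG _)).
rewrite !RintegralZl//; [|exact: IG..].
by rewrite !G E mulrDr; congr (_ + _); rewrite mulrCA.
Qed.

Definition heat_flow tau f x : R := \int[mu]_y (heat_kernel tau (x - y) * f y).

Lemma integrable_heat_kernelM f tau x : smooth_boxed f ->
  mu.-integrable setT (EFin \o (fun y => heat_kernel tau (x - y) * f y)).
Proof.
move=> fs; have If := smooth_boxed_integrable fs.
apply: (integrable_le _ _ (integrableZl measurableT (Num.sqrt (expR (- tau) / 4 / pi) ^+ n) (integrable_norm If))).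
  apply: measurable_funM; last by have /integrableP[/measurable_EFinP] := If.
  by apply: measurable_heat_kernel; [exact: measurable_cst|apply: measurable_subrV; [exact: measurable_cst|exact: measurable_id]].
move=> y; rewrite normrM ler_wpM2r// ger0_norm ?heat_kernel_ge0//.
rewrite /heat_kernel /gauss_kernel ler_piMr ?exprn_ge0 ?sqrtr_ge0//.
by rewrite -expR0 ler_expR oppr_le0 mulr_ge0 ?dot_ge0// divr_ge0// expR_ge0.
Qed.

Definition fourier_const : R := (2 * pi)^-1 ^+ n.

(** Fourier inversion with a Gaussian cut-off of the frequencies, which makes Fubini available. The
    phase theta survives as the factor cos theta because the odd part integrates to 0. *)
Lemma heat_inversion f tau x theta : smooth_boxed f ->
  fourier_const * \int[mu]_z (expR (- (expR tau * dot z z)) * cos_transform f z (- (dot z x + theta))) =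
  cos theta * heat_flow tau f x.
Proof.
move=> fs; have If := smooth_boxed_integrable fs.
have mf : measurable_fun setT f by exact: continuous_measurable_rV (smooth_boxed_continuous fs).
have t0 := expR_gt0 tau; have p0 := pi_gt0 R.
have Ig := @integrable_gauss_rV R n (expR tau) 0 t0.
pose F (p : 'rV[R]_n * 'rV[R]_n) := expR (- (expR tau * dot p.1 p.1)) * (f p.2 * cos (dot p.1 p.2 - (dot p.1 x + theta))).
have mF : measurable_fun setT F.
  apply: measurable_funM.
    by apply: measurable_gauss_rV; exact: measurable_fst.
  apply: measurable_funM; first exact: measurableT_comp mf (@measurable_snd _ _ _ _).
  apply: (measurableT_comp (continuous_measurable_fun (@continuous_cos _))).
  apply: measurable_funB; first by apply: measurable_dot; [exact: measurable_fst|exact: measurable_snd].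
  apply: measurable_funD; last exact: measurable_cst.
  by apply: measurable_dot; [exact: measurable_fst|exact: measurable_cst].
have bF : (\int[mu]_z \int[mu]_y `|F (z, y)|%:E < +oo)%E.
  apply: (@double_integral_lt_pinfty _ _ _ _ R mu mu F (fun z => expR (- (expR tau * dot (z - 0) (z - 0)))) (fun y => `|f y|)) => //.
  - exact: integrable_norm.
  - move=> z y; rewrite /F/= subr0 !normrM (ger0_norm (expR_ge0 _)) ler_wpM2l ?expR_ge0//.
    by rewrite ler_piMr// ler_norml cos_geN1 cos_le1.
have -> : \int[mu]_z (expR (- (expR tau * dot z z)) * cos_transform f z (- (dot z x + theta))) =
    \int[mu]_z \int[mu]_y F (z, y).
  apply: eq_Rintegral => z _; rewrite /cos_transform -RintegralZl//.
  exact: integrable_mul_cos.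
rewrite Rintegral_fubini//.
have inner y : \int[mu]_z F (z, y) = f y * (Num.sqrt (pi / expR tau) ^+ n * expR (- (dot (x - y) (x - y) / (4 * expR tau))) * cos theta).
  rewrite /F/=.
  have -> : cos theta = cos (dot (y - x) 0 - theta).
    by rewrite (_ : dot _ 0 = 0) ?sub0r ?cosN// /dot big1// => i _; rewrite [X in _ * X]mxE mulr0.
  rewrite dotBC -integral_gauss_cos_rV// -RintegralZl//; last first.
    apply: (integrable_le _ _ Ig).
      apply: measurable_funM; first by have /integrableP[/measurable_EFinP] := Ig.
      exact: continuous_measurable_rV (@continuous_cos_dot R n _ _).
    by move=> z; rewrite normrM (ger0_norm (expR_ge0 _)) ler_piMr ?expR_ge0// ler_norml cos_geN1 cos_le1.
  apply: eq_Rintegral => z _; rewrite subr0 mulrCA; congr (_ * (_ * cos _)).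
  by rewrite /dot opprD addrA -sumrB; congr (_ - _); apply: eq_bigr => i _; rewrite !mxE; ring.
under eq_Rintegral do rewrite inner.
have kE : Num.sqrt (pi / expR tau) ^+ n = fourier_const^-1 * Num.sqrt (expR (- tau) / 4 / pi) ^+ n.
  rewrite /fourier_const -exprVn invrK -exprMn; congr (_ ^+ _).
  have -> : pi / expR tau = (2 * pi) ^+ 2 * (expR (- tau) / 4 / pi).
    by rewrite expRN; move: (lt0r_neq0 t0) (lt0r_neq0 p0); move: (pi) (expR tau) => q t ? ?; field; apply/andP.
  by rewrite sqrtrM ?sqr_ge0// sqrtr_sqr ger0_norm// mulr_ge0// ltW.
have k0 : fourier_const != 0.
  by rewrite /fourier_const expf_neq0// invr_neq0// mulf_neq0// lt0r_neq0.
rewrite /heat_flow [LHS](_ : _ = fourier_const * \int[mu]_y ((fourier_const^-1 * cos theta) * (heat_kernel tau (x - y) * f y))).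
  rewrite RintegralZl//; last exact: integrable_heat_kernelM.
  by rewrite !mulrA divff// mul1r.
congr (_ * _); apply: eq_Rintegral => y _; rewrite kE /heat_kernel /gauss_kernel.
have -> : dot (x - y) (x - y) / (4 * expR tau) = expR (- tau) / 4 * dot (x - y) (x - y).
  by rewrite expRN; move: (lt0r_neq0 t0) => ?; field.
ring.
Qed.

(** The heat flow reproduces a bounded continuous function as the time tends to 0: the second
    moment of the kernel controls the part of the integral far from the diagonal. *)
Lemma heat_flow_cvg f x : smooth_boxed f ->
  heat_flow (- ln (4 * k.+1%:R)) f x @[k --> \oo] --> f x.
Proof.
move=> fs; have [_ [M fM]] := fs; have cf := smooth_boxed_continuous fs.
have [B B0 fB'] := box_supported_gauss cf fM.
have fB y : `|f y| <= B.
  by apply: (le_trans (fB' y)); rewrite ler_piMr// -expR0 ler_expR oppr_le0 dot_ge0.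
have If := smooth_boxed_integrable fs.
have mf : measurable_fun setT f by exact: continuous_measurable_rV cf.
apply/cvgrPdist_le => e e0.
have [d d0 fd] : exists2 d, 0 < d & forall y, dot (x - y) (x - y) < d ^+ 2 -> `|f y - f x| <= e / 2.
  have e2 : 0 < e / 2 by rewrite divr_gt0.
  have /cvgrPdist_le/(_ _ e2)/nbhs_ballP[d /= d0 h] := cf x.
  exists d => // y yd; rewrite distrC; apply: h; split => // i j.
  rewrite /ball/= (ord1 i) -(@ltr_pXn2r _ 2)// ?nnegrE ?ltW//; apply: le_lt_trans yd.
  rewrite /dot (bigD1 j)//= !mxE -expr2 real_normK ?num_real// lerDl.
  by apply: sumr_ge0 => k _; rewrite -expr2 sqr_ge0.
pose S : R := Num.sqrt 2 ^+ n; have S0 : 0 <= S by rewrite exprn_ge0 ?sqrtr_ge0.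
pose K := 2 * B / d ^+ 2; have K0 : 0 <= K by apply: divr_ge0; [rewrite mulr_ge0|exact: sqr_ge0].
near=> k; set a : R := k.+1%:R; have a0 : 0 < a by rewrite ltr0n.
have -> : heat_flow (- ln (4 * a)) f x = \int[mu]_y (gauss_kernel a (x - y) * f y).
  apply: eq_Rintegral => y _; rewrite /heat_kernel opprK lnK ?posrE ?mulr_gt0//.
  by congr (gauss_kernel _ _ * _); field.
have mG b : measurable_fun setT (fun y => gauss_kernel b (x - y)).
  apply: measurable_funM; first exact: measurable_cst.
  by apply: measurable_gauss_rV; apply: measurable_subrV; [exact: measurable_cst|exact: measurable_id].
have IG b : 0 < b -> \int[mu]_y gauss_kernel b (x - y) = 1 /\ mu.-integrable setT (EFin \o (fun y => gauss_kernel b (x - y))).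
  move=> b0; have E : (\int[mu]_y (gauss_kernel b (x - y))%:E = 1)%E.
    rewrite -(integral_gauss_kernel x b0); apply: eq_integral => y _.
    by rewrite /gauss_kernel dotBC.
  split; first by rewrite /Rintegral E.
  by apply: ge0_integrable => // [y|]; [exact: gauss_kernel_ge0|rewrite E ltry].
have [G1 G2] := IG _ a0; have a20 : 0 < a / 2 by rewrite divr_gt0.
have [G3 G4] := IG _ a20.
have key y : `|gauss_kernel a (x - y) * f x - gauss_kernel a (x - y) * f y| <=
    e / 2 * gauss_kernel a (x - y) + K * (2 / a) * S * gauss_kernel (a / 2) (x - y).
  rewrite -mulrBr normrM (ger0_norm (gauss_kernel_ge0 _ _)).
  set r := dot (x - y) (x - y); have r0 : 0 <= r by exact: dot_ge0.
  have h1 : `|f x - f y| <= e / 2 + K * r.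
    have [yd|yd] := ltP r (d ^+ 2).
      by rewrite distrC (le_trans (fd y yd))// lerDl mulr_ge0.
    apply: (@le_trans _ _ (2 * B)); first by apply: (le_trans (ler_normB _ _)); have := fB x; have := fB y; lra.
    have : 2 * B <= K * r by rewrite /K mulrAC ler_pdivlMr ?exprn_gt0// ler_wpM2l ?mulr_ge0.
    by move: e0; lra.
  have h2 : r * gauss_kernel a (x - y) <= (2 / a) * S * gauss_kernel (a / 2) (x - y).
    have -> : gauss_kernel a (x - y) = S * gauss_kernel (a / 2) (x - y) * expR (- (a / 2 * r)).
      rewrite /gauss_kernel -/r /S mulrA -exprMn -sqrtrM// mulrAC -[RHS]mulrA -expRD.
      have p0 : pi != 0 :> R by rewrite lt0r_neq0// pi_gt0.
      have -> : 2 * (a / 2 / pi) = a / pi by rewrite mulrA mulrCA divff// mulr1.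
      by rewrite -opprD -mulrDl -splitr.
    have := gauss_kernel_ge0 (a / 2) (x - y); set g := gauss_kernel (a / 2) (x - y) => g0.
    rewrite (_ : r * _ = S * g * (r * expR (- (a / 2 * r)))); last by ring.
    rewrite (_ : 2 / a * S * g = S * g * (2 / a)); last by ring.
    rewrite ler_wpM2l ?mulr_ge0//.
    rewrite expRN ler_pdivrMr ?expR_gt0//.
    have := expR_ge1Dx (a / 2 * r); set E := expR _ => hE.
    rewrite (_ : r = 2 / a * (a / 2 * r)); last by field; rewrite lt0r_neq0.
    by rewrite ler_wpM2l ?divr_ge0 ?ltW//; lra.
  apply: (le_trans (ler_wpM2l (gauss_kernel_ge0 _ _) h1)).
  rewrite mulrDr mulrC lerD2l -[leRHS]mulrA -[leRHS]mulrA mulrCA ler_wpM2l//.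
  by rewrite mulrC mulrA.
have Ix : mu.-integrable setT (EFin \o (fun y => gauss_kernel a (x - y) * f x)).
  exact: (integrableZr measurableT (f x) G2).
have Iy : mu.-integrable setT (EFin \o (fun y => gauss_kernel a (x - y) * f y)).
  apply: (integrable_le _ _ (integrableZl measurableT B G2)).
    exact: measurable_funM.
  by move=> y; rewrite normrM (ger0_norm (gauss_kernel_ge0 _ _)) mulrC ler_wpM2r ?gauss_kernel_ge0.
rewrite -[X in X - _]mul1r -G1 -RintegralZr// -RintegralB//.
have Ixy : mu.-integrable setT (EFin \o (fun y => gauss_kernel a (x - y) * f x - gauss_kernel a (x - y) * f y)).
  exact: (integrableB measurableT Ix Iy).
apply: (le_trans (le_normr_Rintegral measurableT Ixy)).
apply: (@le_trans _ _ (\int[mu]_y (e / 2 * gauss_kernel a (x - y) + K * (2 / a) * S * gauss_kernel (a / 2) (x - y)))).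
  apply: le_Rintegral => //.
  - exact: integrable_norm Ixy.
  - exact: (integrableD measurableT (integrableZl measurableT (e / 2) G2) (integrableZl measurableT (K * (2 / a) * S) G4)).
rewrite RintegralD//; last 2 first.
- exact: (integrableZl measurableT (e / 2) G2).
- exact: (integrableZl measurableT (K * (2 / a) * S) G4).
have -> : \int[mu]_y (e / 2 * gauss_kernel a (x - y)) = e / 2.
  by rewrite (RintegralZl (e / 2) measurableT G2) G1 mulr1.
have -> : \int[mu]_y (K * (2 / a) * S * gauss_kernel (a / 2) (x - y)) = K * (2 / a) * S.
  by rewrite (RintegralZl (K * (2 / a) * S) measurableT G4) G3 mulr1.
rewrite [leRHS]splitr lerD2l.
rewrite (_ : K * (2 / a) * S = K * 2 * S / a); last by field; rewrite lt0r_neq0.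
rewrite ler_pdivrMr//.
have : K * 2 * S / (e / 2) <= a.
  apply: (@le_trans _ _ k%:R); last by rewrite /a ler_nat.
  by near: k; exact: nbhs_infty_ger.
have e20 : 0 < e / 2 by rewrite divr_gt0.
by rewrite (ler_pdivrMr _ _ e20) [a * _]mulrC.
Unshelve. all: by end_near. Qed.

Lemma integrable_cos_transform f (g : 'rV[R]_n -> R) : smooth_boxed f -> measurable_fun setT g ->
  mu.-integrable setT (EFin \o (fun z => cos_transform f z (g z))).
Proof.
move=> fs mg; have [C C0 h] := cos_transform_decay fs.
apply: (integrable_le _ _ (integrableZl measurableT C (@integrable_frequency_weight R n))).
  apply: measurable_cos_transform => //; exact: continuous_measurable_rV (smooth_boxed_continuous fs).
move=> z; apply: (le_trans (h z _)); rewrite ler_wpM2l// expr2; have w0 := frequency_weight_gt0 z.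
apply: ler_piMr; first by rewrite invr_ge0 ltW.
rewrite invf_le1 ?frequency_weight_gt0//; apply: le_trans (dot_le_frequency_weight z).
by rewrite lerDl dot_ge0.
Qed.

Lemma measurable_phase x theta : measurable_fun setT (fun z : 'rV[R]_n => - (dot z x + theta)).
Proof.
apply: measurable_funN; apply: measurable_funD; last exact: measurable_cst.
by apply: measurable_dot; [exact: measurable_id|exact: measurable_cst].
Qed.

(** The limit of heat_inversion as the time tends to 0. *)
Lemma cos_transform_inversion f x theta : smooth_boxed f ->
  fourier_const * \int[mu]_z cos_transform f z (- (dot z x + theta)) = cos theta * f x.
Proof.
move=> fs; pose tau (k : nat) : R := - ln (4 * k.+1%:R).
have mC := measurable_cos_transform (continuous_measurable_rV (smooth_boxed_continuous fs)) (measurable_phase x theta) (@measurable_id _ 'rV[R]_n setT).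
have IC := integrable_cos_transform fs (measurable_phase x theta).
have c1 : \int[mu]_z (expR (- (expR (tau k) * dot z z)) * cos_transform f z (- (dot z x + theta))) @[k --> \oo] -->
    \int[mu]_z cos_transform f z (- (dot z x + theta)).
  apply: (@Rintegral_dominated_cvg _ _ R mu (fun k z => expR (- (expR (tau k) * dot z z)) * cos_transform f z (- (dot z x + theta)))
    (fun z => cos_transform f z (- (dot z x + theta))) (fun z => `|cos_transform f z (- (dot z x + theta))|)) => //; last 2 first.
  - exact: integrable_norm.
  - move=> k z; rewrite normrM (ger0_norm (expR_ge0 _)) ler_piMl//.
    by rewrite -expR0 ler_expR oppr_le0 mulr_ge0 ?expR_ge0 ?dot_ge0.
  - move=> k; apply: measurable_funM => //.
    by apply: measurable_gauss_rV; exact: measurable_id.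
  - move=> z; rewrite -[X in _ --> X]mul1r; apply: cvgM; last exact: cvg_cst.
    suff c0 : - (expR (tau k) * dot z z) @[k --> \oo] --> (0 : R).
      by have := cvg_comp _ _ c0 (@continuous_expR R 0); rewrite expR0.
    rewrite -oppr0; apply: cvgN; rewrite -[X in _ --> X](mul0r (dot z z)).
    apply: cvgM; last exact: cvg_cst.
    rewrite (_ : (fun k => expR (tau k)) = (fun k => 4^-1 * k.+1%:R^-1)); last first.
      by apply/funext => k; rewrite /tau expRN lnK ?posrE ?mulr_gt0// invfM.
    rewrite -[X in _ --> X](mulr0 (4^-1 : R)); apply: cvgM; first exact: cvg_cst.
    exact: cvg_harmonic.
have c2 : cos theta * heat_flow (tau k) f x @[k --> \oo] --> cos theta * f x.
  by apply: cvgM; [exact: cvg_cst|exact: heat_flow_cvg].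
have c3 : fourier_const * \int[mu]_z (expR (- (expR (tau k) * dot z z)) * cos_transform f z (- (dot z x + theta))) @[k --> \oo] -->
    fourier_const * \int[mu]_z cos_transform f z (- (dot z x + theta)).
  by apply: cvgM; [exact: cvg_cst|exact: c1].
rewrite -[LHS](cvg_lim (@Rhausdorff R) c3) -[RHS](cvg_lim (@Rhausdorff R) c2).
by under eq_fun do rewrite heat_inversion//.
Qed.

End heat_semigroup.

(** * The fractional Laplacian through the heat flow *)

Section Rintegral_tools.
Context d (T : measurableType d) {R : realType} (m : {measure set T -> \bar R}).

Lemma ae_eq_Rintegral (f g : T -> R) : measurable_fun setT f -> measurable_fun setT g ->
  {ae m, forall x, f x = g x} -> \int[m]_x f x = \int[m]_x g x.
Proof.
move=> mf mg fg; congr fine; apply: ae_eq_integral => //; [exact/measurable_EFinP..|].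
by apply: filterS fg => x + _ => ->.
Qed.

Lemma normr_Rintegral_le (f : T -> R) (B : R) : measurable_fun setT f ->
  (\int[m]_x `|f x|%:E <= B%:E)%E -> `|\int[m]_x f x| <= B.
Proof.
move=> mf fB; have fi : m.-integrable setT (EFin \o f).
  by apply/integrableP; split; [exact/measurable_EFinP|exact: le_lt_trans (ltry B)].
apply: (le_trans (le_normr_Rintegral measurableT fi)).
rewrite -lee_fin /Rintegral fineK//.
exact: (integrable_fin_num measurableT (integrable_norm fi)).
Qed.

(** Holds for every nonnegative measurable h: when its integral is infinite, both sides are 0 by the
    convention on real-valued integrals. *)
Lemma ge0_RintegralZr (h : T -> R) (c : R) : measurable_fun setT h -> (forall x, 0 <= h x) ->
  \int[m]_x (h x * c) = \int[m]_x h x * c.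
Proof.
move=> mh h0; have [hi|hi] := pselect (m.-integrable setT (EFin \o h)).
  by rewrite RintegralZr.
have hoo : (\int[m]_x (h x)%:E = +oo)%E.
  apply/eqP; rewrite -leye_eq leNgt; apply/negP => hlt; apply: hi; exact: ge0_integrable.
have pos b : 0 < b -> (\int[m]_x (h x * b)%:E = +oo)%E.
  move=> b0; under eq_integral do rewrite mulrC.
  by rewrite ge0_integralZl_real ?ltW// hoo gt0_muley// lte_fin.
rewrite /Rintegral hoo mul0r.
have [c0|c0|->] := ltgtP c 0.
- rewrite [X in fine X](_ : _ = (- \int[m]_x (h x * - c)%:E)%E); first by rewrite pos ?oppr_gt0.
  rewrite -integral_ge0N; first by apply: eq_integral => x _; rewrite -EFinN mulrN opprK.
  by move=> x _; rewrite lee_fin mulr_ge0// oppr_ge0 ltW.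
- by rewrite pos.
- by under eq_integral do rewrite mulr0; rewrite integral0.
Qed.

End Rintegral_tools.

Section fractional_multiplier.
Context {R : realType} {n' : nat}.
Local Notation n := n'.+1.
Local Notation leb := (@lebesgue_measure R).
Local Notation mu := (lebesgue_rV R n).
Implicit Types (f : 'rV[R]_n -> R) (x y z : 'rV[R]_n).
#[local] Arguments lebesgue_rV : simpl never.

(** The real part of the fractional Laplacian of f at x for theta = 0, and its imaginary part for
    theta = - pi/2. *)
Definition frac_multiplier s f x theta : R := @fourier_const R n *
  \int[mu]_z (enorm z `^ (2 * s) * cos_transform f z (- (dot z x + theta))).

Lemma enorm_powR2 (z : 'rV[R]_n) (s : R) : enorm z `^ (2 * s) = dot z z `^ s.
Proof. by rewrite powRrM powR_mulrn ?enorm_ge0// sqr_enorm. Qed.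

Lemma fourier_const_ge0 : 0 <= @fourier_const R n.
Proof. by rewrite exprn_ge0// invr_ge0 mulr_ge0// pi_ge0. Qed.

Section test_function.
Variables (s : R) (f : 'rV[R]_n -> R).
Hypotheses (s01 : 0 < s < 1) (fs : smooth_boxed f).

Let s0 : 0 < s. Proof. by case/andP: s01. Qed.
Let mf : measurable_fun setT f. Proof. exact: continuous_measurable_rV (smooth_boxed_continuous fs). Qed.
Let If := smooth_boxed_integrable fs.

Lemma frac_integrand_le : exists2 C, 0 <= C & forall z theta,
  `|enorm z `^ (2 * s) * cos_transform f z theta| <= C * (frequency_weight z)^-1.
Proof.
have [C C0 h] := cos_transform_decay fs; exists C => // z theta.
have w0 := frequency_weight_gt0 z.
rewrite normrM (ger0_norm (powR_ge0 _ _)).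
apply: (@le_trans _ _ (frequency_weight z * (C * (frequency_weight z)^-1 ^+ 2))).
  by apply: ler_pM => //; [exact: powR_ge0|exact: enorm_powR_le_frequency_weight].
by rewrite mulrCA expr2 mulVKf// gt_eqF.
Qed.

Lemma measurable_frac_integrand d (T : measurableType d) (z : T -> 'rV[R]_n) (g : T -> R) :
  measurable_fun setT z -> measurable_fun setT g ->
  measurable_fun setT (fun t => enorm (z t) `^ (2 * s) * cos_transform f (z t) (g t)).
Proof.
move=> mz mg; apply: measurable_funM; last exact: measurable_cos_transform.
exact: measurableT_comp (measurable_powR _) (measurable_enorm mz).
Qed.

Lemma integrable_frac_integrand x theta :
  mu.-integrable setT (EFin \o (fun z => enorm z `^ (2 * s) * cos_transform f z (- (dot z x + theta)))).
Proof.
have [C C0 h] := frac_integrand_le.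
apply: (integrable_le _ _ (integrableZl measurableT C (@integrable_frequency_weight R n))) => [|z]; last exact: h.
exact: measurable_frac_integrand (@measurable_id _ _ setT) (measurable_phase x theta).
Qed.

Lemma measurable_frac_multiplier : measurable_fun setT (fun x => frac_multiplier s f x 0).
Proof.
apply: measurable_funM; first exact: measurable_cst.
apply: (@measurable_Rintegral_param _ _ _ _ R mu (fun p : 'rV[R]_n * 'rV[R]_n => enorm p.2 `^ (2 * s) * cos_transform f p.2 (- (dot p.2 p.1 + 0)))).
apply: measurable_frac_integrand; first exact: measurable_snd.
apply: measurable_funN; apply: measurable_funD; last exact: measurable_cst.
by apply: measurable_dot; [exact: measurable_snd|exact: measurable_fst].
Qed.

(** Replace |zeta|^2s by heat_multiplierE, exchange the integrals and invert at each time. The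
    factor cos theta makes the imaginary part of the fractional Laplacian vanish. *)
Lemma frac_multiplier_heat x theta : frac_multiplier s f x theta =
  (heat_multiplier_const s)^-1 * \int[leb]_tau (expR (- (s * tau)) * (cos theta * (f x - heat_flow tau f x))).
Proof.
have c0 := heat_multiplier_const_gt0 s01.
pose W z := cos_transform f z (- (dot z x + theta)).
have mW : measurable_fun setT W by exact: measurable_cos_transform (measurable_phase x theta) (@measurable_id _ _ setT).
have IW : mu.-integrable setT (EFin \o W) by exact: integrable_cos_transform (measurable_phase x theta).
pose H (p : 'rV[R]_n * R) : R := expR (- (s * p.2)) * (1 - expR (- (dot p.1 p.1 * expR p.2))).
have H0 p : 0 <= H p.
  by rewrite mulr_ge0 ?expR_ge0// subr_ge0 -expR0 ler_expR oppr_le0 mulr_ge0 ?dot_ge0 ?expR_ge0.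
have md : measurable_fun setT (fun p : 'rV[R]_n * measurableTypeR R => dot p.1 p.1).
  by apply: measurable_dot; exact: measurable_fst.
have mH : measurable_fun setT (H : 'rV[R]_n * measurableTypeR R -> R) by rewrite /H; mfun.
have HE z : (\int[leb]_tau (H (z, tau))%:E)%E = (enorm z `^ (2 * s) * heat_multiplier_const s)%:E.
  by rewrite enorm_powR2 -heat_multiplierE// dot_ge0.
pose F (p : 'rV[R]_n * measurableTypeR R) : R := H p * W p.1.
have mF : measurable_fun setT F.
  by apply: measurable_funM => //; exact: measurableT_comp mW (@measurable_fst _ _ _ _).
have bF : (\int[mu]_z \int[leb]_tau `|F (z, tau)|%:E < +oo)%E.
  have /integrableP[_] := integrableZr measurableT (heat_multiplier_const s) (integrable_frac_integrand x theta).
  apply: le_lt_trans; rewrite le_eqVlt; apply/orP; left; apply/eqP.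
  apply: eq_integral => z _ /=; rewrite mulrAC normrM.
  rewrite [X in (X * _)%R]ger0_norm; last by rewrite mulr_ge0 ?powR_ge0// ltW.
  rewrite mulrC EFinM -HE -ge0_integralZl_real//; last by exact: measurableT_comp mH (measurable_pair1 z).
  apply: eq_integral => tau _; rewrite /F/= normrM mulrC; congr (_ * _)%:E.
  by rewrite ger0_norm.
have Fz z : \int[leb]_tau F (z, tau) = heat_multiplier_const s * (enorm z `^ (2 * s) * W z).
  rewrite /F/= (@ge0_RintegralZr _ _ R leb (fun tau => H (z, tau)))//.
    by rewrite /Rintegral HE/= mulrAC mulrC.
  exact: measurableT_comp mH (measurable_pair1 z).
rewrite /frac_multiplier -/W.
have -> : \int[mu]_z (enorm z `^ (2 * s) * W z) = (heat_multiplier_const s)^-1 * \int[mu]_z \int[leb]_tau F (z, tau).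
  under [in RHS]eq_Rintegral do rewrite Fz.
  by rewrite RintegralZl ?mulKf ?gt_eqF//; exact: integrable_frac_integrand.
rewrite mulrCA; congr (_ * _); rewrite Rintegral_fubini//.
have Ft tau : @fourier_const R n * \int[mu]_z F (z, tau) =
   expR (- (s * tau)) * (cos theta * (f x - heat_flow tau f x)).
  have E : forall z, expR (- (expR tau * dot z z)) = expR (- (dot z z * expR tau)) by move=> z; rewrite mulrC.
  have mE : measurable_fun setT (fun z : 'rV[R]_n => expR (- (dot z z * expR tau))).
    by under eq_fun do rewrite -E; apply: measurable_gauss_rV; exact: measurable_id.
  have IE : mu.-integrable setT (EFin \o (fun z => expR (- (dot z z * expR tau)) * W z)).
    apply: (integrable_le _ _ (integrable_norm IW)); first exact: measurable_funM.
    move=> z; rewrite normrM (ger0_norm (expR_ge0 _)) ler_piMl//.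
    by rewrite -expR0 ler_expR oppr_le0 mulr_ge0 ?expR_ge0 ?dot_ge0.
  rewrite /F/H/=.
  under eq_Rintegral do rewrite -mulrA mulrBl mul1r.
  rewrite RintegralZl//; last exact: (integrableB measurableT IW IE).
  rewrite RintegralB// mulrCA; congr (_ * _); rewrite mulrBr [in RHS]mulrBr.
  rewrite -(cos_transform_inversion x theta fs) -(heat_inversion tau x theta fs); congr (_ - _ * _).
  by apply: eq_Rintegral => z _; rewrite E.
have IF : leb.-integrable setT (EFin \o (fun tau => \int[mu]_z F (z, tau))).
  have mF' : measurable_fun setT (fun p : measurableTypeR R * 'rV[R]_n => F (p.2, p.1)).
    by apply: (measurableT_comp mF); exact: measurable_swap.
  apply: (@integrable_Rintegral_param _ _ _ _ R leb mu (fun p => F (p.2, p.1))) => //.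
  rewrite -(@fubini_tonelli _ _ _ _ R mu leb (fun p => `|F p|%:E))//.
  by apply/measurable_EFinP; exact: measurableT_comp.
by rewrite -RintegralZl//; apply: eq_Rintegral => tau _; rewrite Ft.
Qed.

End test_function.

End fractional_multiplier.

(** * Decay of the fractional Laplacian of a test function *)

Section decaying_function.
Context {R : realType} {n' : nat}.
Local Notation n := n'.+1.
Local Notation mu := (lebesgue_rV R n).
Implicit Types x : 'rV[R]_n.
#[local] Arguments lebesgue_rV : simpl never.
Variables (s : R) (g : 'rV[R]_n -> R).
Hypotheses (s0 : 0 < s) (sn : 2 * s < n%:R).
Hypotheses (mg : measurable_fun setT g) (g0 : forall x, 0 <= g x).
Hypothesis g_bounded : exists2 C, 0 <= C & forall x, g x <= C.
Hypothesis g_far : exists rho C, [/\ 1 <= rho, 0 <= C &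
  forall x, rho <= enorm x -> g x <= C * enorm x `^ (- (n%:R + 2 * s))].

Lemma sqrt_weight_le (t : R) x : 1 <= t -> enorm x <= t -> Num.sqrt (2 + 2 * dot x x) <= 2 * t.
Proof.
move=> t1 xt; have t0 : 0 <= t by exact: le_trans t1.
rewrite -[leRHS]ger0_norm ?mulr_ge0// -sqrtr_sqr ler_wsqrtr//.
rewrite -sqr_enorm; have : enorm x ^+ 2 <= t ^+ 2 by rewrite ler_sqr ?nnegrE ?enorm_ge0.
nra.
Qed.

(** At infinity the weight behaves like |x|^-(n+a+del), which dominates g(x) |x|^-a as long as
    del <= 2s, while del > 0 keeps the weight integrable when a = 0. *)
Lemma decaying_le_weight (a del : R) : 0 <= a -> 0 < del -> del <= 2 * s -> exists2 C, 0 <= C &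
  forall x, x != 0 -> g x * enorm x `^ (- a) <= C * riesz_weight s (a + del) x.
Proof.
move=> a0 d0 ds.
have [C1 C10 h1] := g_bounded.
have [rho [C2 [rho1 C20 h2]]] := g_far.
pose Q := n%:R - 2 * s; have Q0 : 0 <= Q by rewrite subr_ge0 ltW.
have rho0 : 0 < rho by exact: lt_le_trans rho1.
pose C := C1 * rho `^ (2 * s + del) * (2 * rho) `^ Q + C2 * 2 `^ Q.
have C0 : 0 <= C by rewrite addr_ge0// ?mulr_ge0 ?powR_ge0.
exists C => // x x0; have e0 : 0 < enorm x by rewrite enorm_gt0.
have split_pow p q : enorm x `^ (p + q) = enorm x `^ p * enorm x `^ q.
  by rewrite powRD//; apply/implyP => _; rewrite gt_eqF.
have S0 : 0 < Num.sqrt (2 + 2 * dot x x) by rewrite sqrtr_gt0 ltr_pwDl// mulr_ge0// dot_ge0.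
have wt t : 1 <= t -> enorm x <= t ->
    enorm x `^ (- (2 * s + (a + del))) * (2 * t) `^ (- Q) <= riesz_weight s (a + del) x.
  move=> t1 xt; rewrite /riesz_weight ler_wpM2l ?powR_ge0// !powRN lef_pV2 ?posrE ?powR_gt0//; last first.
    by rewrite mulr_gt0// (lt_le_trans _ t1).
  apply: ge0_ler_powR => //; rewrite ?nnegrE ?sqrtr_ge0//; last exact: sqrt_weight_le.
  by rewrite mulr_ge0// (le_trans _ t1).
have [xr|/ltW xr] := leP (enorm x) rho.
  apply: le_trans (ler_wpM2l C0 (wt _ rho1 xr)).
  have rQ : (2 * rho) `^ Q * (2 * rho) `^ (- Q) = 1.
    by rewrite powRN mulfV// gt_eqF// powR_gt0// mulr_gt0.
  apply: (@le_trans _ _ (C1 * rho `^ (2 * s + del) * (2 * rho) `^ Q * (enorm x `^ (- (2 * s + (a + del))) * (2 * rho) `^ (- Q)))); last first.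
    by rewrite ler_wpM2r ?mulr_ge0 ?powR_ge0// lerDl mulr_ge0 ?powR_ge0.
  rewrite (_ : _ * (_ * _) = C1 * (rho `^ (2 * s + del) * enorm x `^ (- (2 * s + (a + del)))) * ((2 * rho) `^ Q * (2 * rho) `^ (- Q))); last by ring.
  rewrite rQ mulr1 ler_pM ?powR_ge0//.
  rewrite (_ : - a = (2 * s + del) + - (2 * s + (a + del))); last by ring.
  rewrite split_pow ler_wpM2r ?powR_ge0//; apply: ge0_ler_powR; [|by rewrite nnegrE ltW..|exact: xr].
  by apply: ltW; rewrite addr_gt0// mulr_gt0.
have x1 : 1 <= enorm x by exact: le_trans xr.
apply: le_trans (ler_wpM2l C0 (wt _ x1 (lexx _))).
have rQ : 2 `^ Q * 2 `^ (- Q) = 1 :> R by rewrite powRN mulfV// gt_eqF// powR_gt0.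
apply: (@le_trans _ _ (C2 * 2 `^ Q * (enorm x `^ (- (2 * s + (a + del))) * (2 * enorm x) `^ (- Q)))); last first.
  by rewrite ler_wpM2r ?mulr_ge0 ?powR_ge0// lerDr !mulr_ge0 ?powR_ge0.
rewrite powRM ?enorm_ge0//.
rewrite (_ : _ * (_ * _) = C2 * (enorm x `^ (- (2 * s + (a + del))) * enorm x `^ (- Q)) * (2 `^ Q * 2 `^ (- Q))); last by ring.
rewrite rQ mulr1 -split_pow.
apply: (le_trans (ler_wpM2r (powR_ge0 _ _) (h2 x xr))).
rewrite -mulrA -split_pow ler_wpM2l//; apply: ler_powR => //.
by rewrite /Q; lra.
Qed.

Lemma decaying_le_power (a : R) : 0 < a -> a < n%:R - 2 * s -> exists2 C, 0 <= C &
  forall x, x != 0 -> g x <= C * enorm x `^ (- (2 * s + a)).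
Proof.
move=> a0 aQ.
have [C1 C10 h1] := g_bounded.
have [rho [C2 [rho1 C20 h2]]] := g_far.
have rho0 : 0 < rho by exact: lt_le_trans rho1.
have C0 : 0 <= C1 * rho `^ (2 * s + a) + C2 by rewrite addr_ge0// mulr_ge0 ?powR_ge0.
exists (C1 * rho `^ (2 * s + a) + C2) => // x x0; have e0 : 0 < enorm x by rewrite enorm_gt0.
have [xr|/ltW xr] := leP (enorm x) rho.
  apply: (@le_trans _ _ (C1 * rho `^ (2 * s + a) * enorm x `^ (- (2 * s + a)))); last first.
    by rewrite ler_wpM2r ?powR_ge0// lerDl.
  rewrite powRN -mulrA -[leLHS]mulr1 ler_pM// ler_pdivlMr ?powR_gt0// mul1r.
  apply: ge0_ler_powR; [|by rewrite nnegrE ltW..|exact: xr].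
  by apply: ltW; rewrite addr_gt0// mulr_gt0.
apply: (le_trans (h2 x xr)); apply: ler_pM; rewrite ?powR_ge0//.
  by rewrite lerDr mulr_ge0 ?powR_ge0.
apply: ler_powR; first exact: le_trans xr.
rewrite lerN2 addrC lerD2r; apply: ltW; apply: (lt_trans aQ).
by rewrite ltrBlDr ltrDl mulr_gt0.
Qed.

Lemma integral_decaying_power (a : R) : 0 <= a -> a < n%:R - 2 * s ->
  (\int[mu]_x (g x * enorm x `^ (- a))%:E < +oo)%E.
Proof.
move=> a0 aQ.
pose del := Num.min (2 * s) ((n%:R - 2 * s - a) / 2).
have d0 : 0 < del by rewrite lt_min mulr_gt0//= divr_gt0// subr_gt0.
have ds : del <= 2 * s by rewrite ge_min lexx.
have dQ : a + del < n%:R - 2 * s.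
  have : del <= (n%:R - 2 * s - a) / 2 by rewrite ge_min lexx orbT.
  by move: aQ; lra.
have [C C0 h] := decaying_le_weight a0 d0 ds.
apply: (@le_lt_trans _ _ (\int[mu]_x (C * riesz_weight s (a + del) x)%:E)%E); last first.
  rewrite ge0_integralZl_real//; last 2 first.
  - exact: measurable_riesz_weight.
  - by move=> x; exact: riesz_weight_ge0.
  have ad0 : 0 < a + del by rewrite ltr_pwDr.
  have := integral_riesz_weight s0 ad0 dQ.
  set I := (\int[mu]__ _)%E => Ioo; have I0 : (0 <= I)%E by apply: integral_ge0 => x _; rewrite lee_fin riesz_weight_ge0.
  by apply: lte_mul_pinfty; rewrite ?lee_fin.
apply: ae_ge0_le_integral => //.
- by move=> x _; rewrite lee_fin mulr_ge0 ?powR_ge0.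
- apply/measurable_EFinP; apply: measurable_funM => //; exact: measurable_enorm_powR.
- by move=> x _; rewrite lee_fin mulr_ge0 ?riesz_weight_ge0.
- apply/measurable_EFinP; apply: measurable_funM; first exact: measurable_cst.
  exact: measurable_riesz_weight.
by apply: filterS (ae_neq 0) => x x0 _; rewrite lee_fin; exact: h.
Qed.

End decaying_function.

Section fractional_decay.
Context {R : realType} {n' : nat}.
Local Notation n := n'.+1.
Local Notation leb := (@lebesgue_measure R).
Local Notation mu := (lebesgue_rV R n).
Implicit Types (x y z : 'rV[R]_n).
#[local] Arguments lebesgue_rV : simpl never.
Variables (s : R) (f : 'rV[R]_n -> R).
Hypotheses (s01 : 0 < s < 1) (sn : 2 * s < n%:R) (fs : smooth_boxed f).
Local Notation L := (fun x => frac_multiplier s f x 0).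

Let s0 : 0 < s. Proof. by case/andP: s01. Qed.
Let mf : measurable_fun setT f. Proof. exact: continuous_measurable_rV (smooth_boxed_continuous fs). Qed.
Let If : mu.-integrable setT (EFin \o f). Proof. exact: smooth_boxed_integrable. Qed.

Lemma frac_multiplier_bounded : exists2 C, 0 <= C & forall x, `|L x| <= C.
Proof.
have [C C0 h] := frac_integrand_le s01 fs.
exists (@fourier_const R n * (C * pi ^+ n)).
  by rewrite mulr_ge0 ?fourier_const_ge0// mulr_ge0// exprn_ge0// pi_ge0.
move=> x; rewrite normrM (ger0_norm fourier_const_ge0) ler_wpM2l ?fourier_const_ge0//.
apply: normr_Rintegral_le.
  exact: measurable_frac_integrand (@measurable_id _ _ setT) (measurable_phase x 0).
apply: (@le_trans _ _ (\int[mu]_z (C * (frequency_weight z)^-1)%:E)%E).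
  apply: ge0_le_integral => //.
  - apply/measurable_EFinP; apply: measurableT_comp => //.
    exact: measurable_frac_integrand (@measurable_id _ _ setT) (measurable_phase x 0).
  - apply/measurable_EFinP; apply: measurable_funM; first exact: measurable_cst.
    by have /integrableP[/measurable_EFinP] := @integrable_frequency_weight R n.
  - by move=> z _; rewrite lee_fin.
rewrite ge0_integralZl_real ?integral_frequency_weight//.
- by have /integrableP[/measurable_EFinP] := @integrable_frequency_weight R n.
- by move=> z; rewrite invr_ge0 ltW// frequency_weight_gt0.
Qed.

(** Far from the support of f, f vanishes at x and |x - y| >= |x|/2 for y in the support, so
    frac_multiplier_heat bounds L by the integral of |f| times heat_integral (- s) (x/2). *)
Lemma frac_multiplier_far : exists rho C, [/\ 1 <= rho, 0 <= C &
  forall x, rho <= enorm x -> `|L x| <= C * enorm x `^ (- (n%:R + 2 * s))].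
Proof.
have [_ [M fM]] := fs.
have n1 : 1 <= n%:R :> R by rewrite ler1n.
pose rho : R := 1 + 2 * n%:R * `|M|.
have rho1 : 1 <= rho by rewrite lerDl !mulr_ge0.
have f_supp y : f y != 0 -> dot y y <= n%:R * M ^+ 2.
  move=> fy; rewrite /dot; apply: (@le_trans _ _ (\sum_(i < n) M ^+ 2)); last first.
    by rewrite sumr_const card_ord mulr_natl.
  apply: ler_sum => i _; have yM : `|y ord0 i| <= M.
    by rewrite leNgt; apply/negP => h; move: fy; rewrite (fM y i h) eqxx.
  rewrite -expr2 -real_normK ?num_real// ler_sqr ?nnegrE//.
  exact: le_trans yM.
have rhoM : 4 * (n%:R * M ^+ 2) < rho ^+ 2.
  rewrite -[M ^+ 2]real_normK ?num_real// /rho; move: (`|M|) (normr_ge0 M) => m m0.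
  move: n1; move: (n%:R : R) => k k1.
  have : m ^+ 2 * k <= m ^+ 2 * k ^+ 2 by rewrite ler_wpM2l ?sqr_ge0//; nra.
  have : 0 <= k * m by rewrite mulr_ge0// (le_trans _ k1).
  nra.
pose q := n%:R + 2 * s.
pose K := @heat_integral_const R n (- s) * 2 `^ q.
have ns : - s < n%:R / 2 by apply: (@lt_trans _ _ 0); rewrite ?oppr_lt0// divr_gt0.
have K0 : 0 <= K by rewrite mulr_ge0 ?powR_ge0// ltW// heat_integral_const_gt0.
pose J := \int[mu]_y `|f y|; have J0 : 0 <= J by exact: Rintegral_ge0.
have JE : (\int[mu]_y (`|f y|)%:E = J%:E)%E.
  by rewrite /J /Rintegral fineK//; exact: (integrable_fin_num measurableT (integrable_norm If)).
have c0 := heat_multiplier_const_gt0 s01.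
exists rho, ((heat_multiplier_const s)^-1 * (K * J)); split => //.
  by apply: mulr_ge0; [rewrite invr_ge0 ltW|exact: mulr_ge0].
move=> x xr; have x0 : 0 < enorm x by apply: lt_le_trans xr; exact: lt_le_trans rho1.
have xr2 : 4 * (n%:R * M ^+ 2) < dot x x.
  by apply: (lt_le_trans rhoM); rewrite -sqr_enorm ler_sqr ?nnegrE// ltW// (lt_le_trans _ rho1).
have fx : f x = 0.
  apply/eqP; apply: contraTT xr2 => /f_supp h; rewrite -leNgt.
  by have := dot_ge0 x; move: h; move: (dot x x) (n%:R * M ^+ 2) => X Y; lra.
have ci0 : 0 <= (heat_multiplier_const s)^-1 by rewrite invr_ge0 ltW.
rewrite frac_multiplier_heat// normrM (ger0_norm ci0) -mulrA ler_wpM2l//.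
have mhk : measurable_fun setT (fun p : measurableTypeR R * 'rV[R]_n => heat_kernel p.1 (x - p.2)).
  apply: measurable_heat_kernel; first exact: measurable_fst.
  by apply: measurable_subrV; [exact: measurable_cst|exact: measurable_snd].
have mflow : measurable_fun setT (fun tau : measurableTypeR R => heat_flow tau f x).
  apply: (@measurable_Rintegral_param _ _ _ _ R mu (fun p : measurableTypeR R * 'rV[R]_n => heat_kernel p.1 (x - p.2) * f p.2)).
  by apply: measurable_funM => //; exact: measurableT_comp mf (@measurable_snd _ _ _ _).
have mint : measurable_fun setT (fun tau : R => expR (- (s * tau)) * (cos 0 * (f x - heat_flow tau f x))).
  by mfun.
apply: normr_Rintegral_le => //.
pose F (p : measurableTypeR R * 'rV[R]_n) : R := expR (- (s * p.1)) * (heat_kernel p.1 (x - p.2) * `|f p.2|).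
have F0 p : 0 <= F p by rewrite !mulr_ge0 ?expR_ge0 ?heat_kernel_ge0.
have mF : measurable_fun setT F.
  apply: measurable_funM; first by mfun.
  apply: measurable_funM => //; apply: measurableT_comp => //.
  exact: measurableT_comp mf (@measurable_snd _ _ _ _).
apply: (@le_trans _ _ (\int[leb]_tau \int[mu]_y (F (tau, y))%:E)%E).
  apply: ge0_le_integral => //.
  - by apply/measurable_EFinP; exact: measurableT_comp.
  - by apply: (@measurable_integral_param _ _ _ _ R mu (fun p => (F p)%:E)); exact/measurable_EFinP.
  - move=> tau _; rewrite cos0 mul1r fx sub0r mulrN normrN normrM (ger0_norm (expR_ge0 _)).
    rewrite /F/= ge0_integralZl_real ?expR_ge0//; last 2 first.
    + apply: measurable_funM; first exact: measurableT_comp mhk (measurable_pair1 tau).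
      exact: measurableT_comp.
    + by move=> y; rewrite mulr_ge0 ?heat_kernel_ge0.
    rewrite EFinM lee_wpmul2l ?lee_fin ?expR_ge0//.
    have Ih := integrable_heat_kernelM tau x fs.
    apply: (@le_trans _ _ ((\int[mu]_y `|heat_kernel tau (x - y) * f y|)%:E)).
      by rewrite lee_fin; exact: le_normr_Rintegral.
    rewrite /Rintegral fineK; last exact: (integrable_fin_num measurableT (integrable_norm Ih)).
    by under eq_integral do rewrite normrM ger0_norm ?heat_kernel_ge0//.
rewrite (@fubini_tonelli _ _ _ _ R leb mu (fun p => (F p)%:E)); last 2 first.
- exact/measurable_EFinP.
- by move=> p; rewrite lee_fin.
apply: (@le_trans _ _ (\int[mu]_y ((K * enorm x `^ (- q)) * `|f y|)%:E)%E).
  apply: ge0_le_integral => //.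
  - by move=> y _; apply: integral_ge0 => tau _; rewrite lee_fin.
  - apply: (@measurable_integral_param _ _ _ _ R leb (fun p : 'rV[R]_n * measurableTypeR R => (F (p.2, p.1))%:E)).
    by apply/measurable_EFinP; apply: (measurableT_comp mF); exact: measurable_swap.
  - apply/measurable_EFinP; apply: measurable_funM; first exact: measurable_cst.
    exact: measurableT_comp.
  move=> y _; have [fy0|fy] := eqVneq (f y) 0.
    rewrite integral0_eq; first by rewrite fy0 normr0 mulr0.
    by move=> tau _; rewrite /F/= fy0 normr0 !mulr0.
  rewrite (_ : \int[leb]_tau _ = (`|f y|%:E * heat_integral (- s) (x - y)))%E; last first.
    rewrite /heat_integral -ge0_integralZl_real//.
    + by apply: eq_integral => tau _; rewrite /F/= mulNr; congr EFin; ring.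
    + apply: measurable_funM; first by mfun.
      by apply: measurable_heat_kernel; [exact: measurable_id|exact: measurable_cst].
    + by move=> tau; rewrite mulr_ge0 ?expR_ge0 ?heat_kernel_ge0.
  rewrite mulrC EFinM lee_wpmul2l ?lee_fin//.
  have half_x : 2^-1 *: x != 0.
    by rewrite scaler_eq0 invr_eq0 pnatr_eq0/= -enorm_gt0.
  apply: (@le_trans _ _ (heat_integral (- s) (2^-1 *: x))).
    apply: heat_integral_le.
    have -> : dot (2^-1 *: x) (2^-1 *: x) = dot x x / 4.
      by rewrite /dot mulr_suml; apply: eq_bigr => i _; rewrite !mxE; field.
    have := dot_le2 x y; have := f_supp y fy; move: xr2.
    move: (dot x x) (dot y y) (dot (x - y) (x - y)) (n%:R * M ^+ 2) => X Y Z B; lra.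
  rewrite heat_integralE//.
  have hc : 0 <= @heat_integral_const R n (- s) by rewrite ltW// heat_integral_const_gt0.
  rewrite lee_fin /K -mulrA ler_wpM2l//.
  rewrite enormZ ger0_norm ?invr_ge0// mulrN opprK -/q powRM ?invr_ge0 ?enorm_ge0//.
  by rewrite -powR_inv1// -powRrM mulN1r opprK.
rewrite ge0_integralZl_real//; last by rewrite mulr_ge0 ?powR_ge0.
  by rewrite JE -EFinM lee_fin /q; rewrite le_eqVlt; apply/orP; left; apply/eqP; ring.
exact: measurableT_comp.
Qed.

Lemma frac_multiplier_le_power (a : R) : 0 < a -> a < n%:R - 2 * s -> exists2 C, 0 <= C &
  forall x, x != 0 -> `|L x| <= C * enorm x `^ (- (2 * s + a)).
Proof.
move=> a0 aQ; apply: (@decaying_le_power _ _ s (fun x => `|L x|)) => //.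
  exact: frac_multiplier_bounded.
exact: frac_multiplier_far.
Qed.

Lemma integral_frac_multiplier_power (a : R) : 0 <= a -> a < n%:R - 2 * s ->
  (\int[mu]_x (`|L x| * enorm x `^ (- a))%:E < +oo)%E.
Proof.
move=> a0 aQ; apply: (@integral_decaying_power _ _ s (fun x => `|L x|)) => //.
- by apply: measurableT_comp => //; exact: measurable_frac_multiplier.
- exact: frac_multiplier_bounded.
- exact: frac_multiplier_far.
Qed.

Lemma integrable_frac_multiplier : mu.-integrable setT (EFin \o L).
Proof.
apply/integrableP; split.
  by apply/measurable_EFinP; exact: measurable_frac_multiplier.
have := @integral_frac_multiplier_power 0 (lexx _); rewrite subr_gt0 => /(_ sn).
by under eq_integral do rewrite oppr0 powRr0 mulr1.
Qed.

End fractional_decay.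

(** * The Riesz potential inverts the fractional Laplacian *)

Section fractional_duality.
Context {R : realType} {n' : nat}.
Local Notation n := n'.+1.
Local Notation leb := (@lebesgue_measure R).
Local Notation mu := (lebesgue_rV R n).
Implicit Types (x y z : 'rV[R]_n).
#[local] Arguments lebesgue_rV : simpl never.
Variables (s : R) (f : 'rV[R]_n -> R).
Hypotheses (s01 : 0 < s < 1) (sn : 2 * s < n%:R) (fs : smooth_boxed f).
Local Notation L := (fun x => frac_multiplier s f x 0).
Local Notation kap := (@fourier_const R n).

Let s0 : 0 < s. Proof. by case/andP: s01. Qed.
Let mf : measurable_fun setT f. Proof. exact: continuous_measurable_rV (smooth_boxed_continuous fs). Qed.
Let mL : measurable_fun setT L. Proof. exact: measurable_frac_multiplier. Qed.

Lemma heat_frac_multiplier tau y :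
  \int[mu]_x (heat_kernel tau (x - y) * L x) =
  kap * \int[mu]_z (enorm z `^ (2 * s) * (expR (- (expR tau * dot z z)) * cos_transform f z (- (dot z y + 0)))).
Proof.
have [C C0 h] := frac_integrand_le s01 fs.
pose F (p : 'rV[R]_n * 'rV[R]_n) : R := heat_kernel tau (p.1 - y) *
  (enorm p.2 `^ (2 * s) * cos_transform f p.2 (- (dot p.2 p.1 + 0))).
have mhk : measurable_fun setT (fun x : 'rV[R]_n => heat_kernel tau (x - y)).
  apply: measurable_heat_kernel; first exact: measurable_cst.
  by apply: measurable_subrV; [exact: measurable_id|exact: measurable_cst].
have mF : measurable_fun setT F.
  apply: measurable_funM; first exact: measurableT_comp mhk (@measurable_fst _ _ _ _).
  apply: (@measurable_frac_integrand R n' s f fs); first exact: measurable_snd.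
  apply: measurable_funN; apply: measurable_funD; last exact: measurable_cst.
  by apply: measurable_dot; [exact: measurable_snd|exact: measurable_fst].
have Ihk : mu.-integrable setT (EFin \o (fun x => heat_kernel tau (x - y))).
  apply: ge0_integrable => //; first by move=> x; exact: heat_kernel_ge0.
  by rewrite integral_gauss_kernel ?ltry// divr_gt0// expR_gt0.
have bF : (\int[mu]_x \int[mu]_z `|F (x, z)|%:E < +oo)%E.
  apply: (@double_integral_lt_pinfty _ _ _ _ R mu mu F (fun x => heat_kernel tau (x - y)) (fun z => C * (frequency_weight z)^-1)) => //.
  - exact: (integrableZl measurableT C (@integrable_frequency_weight R n)).
  - by move=> x; exact: heat_kernel_ge0.
  - by move=> z; rewrite mulr_ge0// invr_ge0 ltW// frequency_weight_gt0.
  - by move=> x z; rewrite /F/= normrM (ger0_norm (heat_kernel_ge0 _ _)) ler_wpM2l ?heat_kernel_ge0.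
have -> : \int[mu]_x (heat_kernel tau (x - y) * L x) = \int[mu]_x (kap * \int[mu]_z F (x, z)).
  apply: eq_Rintegral => x _; rewrite /F/= RintegralZl//; first by rewrite /frac_multiplier mulrCA.
  exact: integrable_frac_integrand.
rewrite RintegralZl//; last exact: (integrable_Rintegral_param mF bF).
rewrite Rintegral_fubini//; congr (_ * _); apply: eq_Rintegral => z _.
rewrite /F/= -heat_cos_transform// -RintegralZl//.
  by apply: eq_Rintegral => x _; rewrite mulrCA.
have [C' C'0 h'] := cos_transform_decay fs.
apply: (integrable_le _ _ (integrableZr measurableT (C' * (frequency_weight z)^-1 ^+ 2) Ihk)).
  apply: measurable_funM => //; apply: measurable_cos_transform => //.
  apply: measurable_funN; apply: measurable_funD; last exact: measurable_cst.
  by apply: measurable_dot; [exact: measurable_cst|exact: measurable_id].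
by move=> x; rewrite normrM (ger0_norm (heat_kernel_ge0 _ _)) ler_wpM2l ?heat_kernel_ge0.
Qed.

Lemma measurable_heat_kernel_pair y :
  measurable_fun setT (fun p : measurableTypeR R * 'rV[R]_n => expR (s * p.1) * heat_kernel p.1 (p.2 - y)).
Proof.
apply: measurable_funM; first by mfun.
apply: measurable_heat_kernel; first exact: measurable_fst.
by apply: measurable_subrV; [exact: measurable_snd|exact: measurable_cst].
Qed.

(** Integrate heat_frac_multiplier in time: on the frequency side the time integral of
    t^(s-1) exp(-t |zeta|^2) is Gamma s |zeta|^-2s, which cancels the symbol, and Fourier inversion
    remains. *)
Lemma riesz_frac_multiplier y : y != 0 ->
  \int[mu]_x (fine (heat_integral s (x - y)) * L x) = Gamma s * f y.
Proof.
move=> y0.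
have Q0 : 0 < n%:R - 2 * s by rewrite subr_gt0.
pose a := (n%:R - 2 * s) / 2; have a0 : 0 < a by rewrite divr_gt0.
have aQ : a < n%:R - 2 * s by rewrite /a; lra.
have [C C0 hC] := frac_multiplier_le_power s01 fs a0 aQ.
have mK := measurable_heat_kernel_pair y.
pose F (p : measurableTypeR R * 'rV[R]_n) : R := (expR (s * p.1) * heat_kernel p.1 (p.2 - y)) * L p.2.
have mF : measurable_fun setT F.
  by apply: measurable_funM => //; exact: measurableT_comp mL (@measurable_snd _ _ _ _).
have hkE x : (\int[leb]_tau (expR (s * tau) * heat_kernel tau (x - y))%:E = heat_integral s (x - y))%E by [].
have mKx x : measurable_fun setT (fun tau : measurableTypeR R => expR (s * tau) * heat_kernel tau (x - y)).
  exact: measurableT_comp mK (measurable_pair2 x).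
have hhk x tau : 0 <= expR (s * tau) * heat_kernel tau (x - y).
  by rewrite mulr_ge0 ?expR_ge0 ?heat_kernel_ge0.
have bF' : (\int[mu]_x \int[leb]_tau `|F (tau, x)|%:E < +oo)%E.
  have E x : (\int[leb]_tau `|F (tau, x)|%:E = heat_integral s (x - y) * `|L x|%:E)%E.
    rewrite -hkE muleC -ge0_integralZl_real//.
    by apply: eq_integral => tau _; rewrite /F/= normrM (ger0_norm (hhk _ _)) mulrC.
  under eq_integral do rewrite E.
  apply: (@le_lt_trans _ _ (\int[mu]_x (C%:E * (heat_integral s (y - x) * (enorm x `^ (- (2 * s + a)))%:E)))%E).
    apply: ae_ge0_le_integral => //.
    - by move=> x _; rewrite mule_ge0 ?heat_integral_ge0.
    - apply: emeasurable_funM; last by apply/measurable_EFinP; exact: measurableT_comp.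
      apply: measurable_heat_integral.
      by apply: measurable_subrV; [exact: measurable_id|exact: measurable_cst].
    - by move=> x _; rewrite !mule_ge0 ?lee_fin ?heat_integral_ge0 ?powR_ge0.
    - apply: emeasurable_funM; first exact: measurable_cst.
      apply: measurable_riesz_integrand; exact: measurable_enorm_powR.
    apply: filterS (ae_neq 0) => x x0 _.
    rewrite muleCA (_ : heat_integral s (y - x) = heat_integral s (x - y)); last first.
      by apply/le_anti/andP; split; apply: heat_integral_le; rewrite dotBC.
    by rewrite lee_wpmul2l ?heat_integral_ge0// -EFinM lee_fin hC.
  rewrite ge0_integralZl//; last 2 first.
  - apply: measurable_riesz_integrand; exact: measurable_enorm_powR.
  - by move=> x _; rewrite mule_ge0 ?heat_integral_ge0 ?lee_fin ?powR_ge0.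
  by rewrite riesz_potential_power// -EFinM ltry.
have bF : (\int[leb]_tau \int[mu]_x `|F (tau, x)|%:E < +oo)%E.
  rewrite (@fubini_tonelli _ _ _ _ R leb mu (fun p => `|F p|%:E))//.
  by apply/measurable_EFinP; exact: measurableT_comp.
have -> : \int[mu]_x (fine (heat_integral s (x - y)) * L x) = \int[mu]_x \int[leb]_tau F (tau, x).
  apply: eq_Rintegral => x _; rewrite -hkE.
  by rewrite /F/= ge0_RintegralZr.
rewrite -Rintegral_fubini//.
(* the time integral is now taken first, at each frequency *)
pose W z := cos_transform f z (- (dot z y + 0)).
have mW : measurable_fun setT W by exact: measurable_cos_transform (measurable_phase y 0) (@measurable_id _ _ setT).
have IW : mu.-integrable setT (EFin \o W) by exact: integrable_cos_transform (measurable_phase y 0).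
pose H (p : measurableTypeR R * 'rV[R]_n) : R := (enorm p.2 `^ (2 * s) * expR (s * p.1 - dot p.2 p.2 * expR p.1)).
have H0 p : 0 <= H p by rewrite mulr_ge0 ?powR_ge0 ?expR_ge0.
have md : measurable_fun setT (fun p : measurableTypeR R * 'rV[R]_n => dot p.2 p.2).
  by apply: measurable_dot; exact: measurable_snd.
have me : measurable_fun setT (fun p : measurableTypeR R * 'rV[R]_n => enorm p.2).
  by apply: measurable_enorm; exact: measurable_snd.
have mH : measurable_fun setT H by rewrite /H; mfun.
pose G (p : measurableTypeR R * 'rV[R]_n) : R := H p * W p.2.
have mG : measurable_fun setT G.
  by apply: measurable_funM => //; exact: measurableT_comp mW (@measurable_snd _ _ _ _).
have HE z : z != 0 -> (\int[leb]_tau (H (tau, z))%:E = (Gamma s)%:E)%E.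
  move=> z0; rewrite /H/= ge0_integralZl_real ?powR_ge0//; last by mfun.
  have dz0 : 0 < dot z z by rewrite -sqr_enorm exprn_gt0// enorm_gt0.
  rewrite Gamma_log_scale// -EFinM enorm_powR2 mulrA powRN divff ?mul1r//.
  by rewrite gt_eqF// powR_gt0.
have bG : (\int[leb]_tau \int[mu]_z `|G (tau, z)|%:E < +oo)%E.
  rewrite (@fubini_tonelli _ _ _ _ R leb mu (fun p => `|G p|%:E)); last 2 first.
  - by apply/measurable_EFinP; exact: measurableT_comp.
  - by move=> q; exact: normr_ge0.
  have /integrableP[_] := integrableZl measurableT (Gamma s) IW.
  apply: le_lt_trans; rewrite le_eqVlt; apply/orP; left; apply/eqP.
  apply: ae_eq_integral => //.
  - apply: (@measurable_integral_param _ _ _ _ R leb (fun p : 'rV[R]_n * measurableTypeR R => `|G (p.2, p.1)|%:E)).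
    apply/measurable_EFinP; apply: measurableT_comp => //; apply: (measurableT_comp mG); exact: measurable_swap.
  - apply/measurable_EFinP; apply: measurableT_comp => //.
    by apply: measurable_funM => //; exact: measurable_cst.
  apply: filterS (ae_neq 0) => z z0 _ /=.
  rewrite [in RHS]normrM [X in (X * _)%R]ger0_norm; last by rewrite ltW// Gamma_gt0.
  rewrite mulrC EFinM -(HE z z0) -ge0_integralZl_real//.
    by apply: eq_integral => tau _; rewrite /G/= normrM (ger0_norm (H0 _)) mulrC.
  exact: measurableT_comp mH (measurable_pair2 z).
have Ftau tau : \int[mu]_x F (tau, x) = kap * \int[mu]_z G (tau, z).
  rewrite /F/=; under eq_Rintegral do rewrite -mulrA.
  have Ihk : mu.-integrable setT (EFin \o (fun x => heat_kernel tau (x - y) * L x)).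
    have [C' C'0 h'] := frac_multiplier_bounded s01 fs.
    have mhk : measurable_fun setT (fun x : 'rV[R]_n => heat_kernel tau (x - y)).
      apply: measurable_heat_kernel; first exact: measurable_cst.
      by apply: measurable_subrV; [exact: measurable_id|exact: measurable_cst].
    have I1 : mu.-integrable setT (EFin \o (fun x => heat_kernel tau (x - y))).
      apply: ge0_integrable => //; first by move=> x; exact: heat_kernel_ge0.
      by rewrite integral_gauss_kernel ?ltry// divr_gt0// expR_gt0.
    apply: (integrable_le _ _ (integrableZr measurableT C' I1)); first exact: measurable_funM.
    by move=> x; rewrite normrM (ger0_norm (heat_kernel_ge0 _ _)) ler_wpM2l ?heat_kernel_ge0.
  rewrite RintegralZl// heat_frac_multiplier mulrCA; congr (_ * _).
  rewrite -RintegralZl//.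
    by apply: eq_Rintegral => z _; rewrite /G /H /W /= expRD [dot z z * _]mulrC; ring.
  apply: (integrable_le _ _ (integrable_norm (integrable_frac_integrand s01 fs y 0))).
    apply: measurable_funM.
      exact: measurableT_comp (measurable_powR _) (measurable_enorm (@measurable_id _ _ setT)).
    by apply: measurable_funM => //; apply: measurable_gauss_rV; exact: measurable_id.
  move=> z; rewrite mulrCA normrM (ger0_norm (expR_ge0 _)) ler_piMl//.
  by rewrite -expR0 ler_expR oppr_le0 mulr_ge0 ?expR_ge0 ?dot_ge0.
under eq_Rintegral do rewrite Ftau.
rewrite RintegralZl//; last exact: (integrable_Rintegral_param mG bG).
rewrite Rintegral_fubini//.
rewrite (@ae_eq_Rintegral _ _ R mu _ (fun z => Gamma s * W z)).
- by rewrite RintegralZl// mulrCA cos_transform_inversion// cos0 mul1r.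
- apply: (@measurable_Rintegral_param _ _ _ _ R leb (fun p : 'rV[R]_n * measurableTypeR R => G (p.2, p.1))).
  by apply: (measurableT_comp mG); exact: measurable_swap.
- by apply: measurable_funM => //; exact: measurable_cst.
apply: filterS (ae_neq 0) => z z0.
have mHz : measurable_fun setT (fun tau : measurableTypeR R => H (tau, z)).
  exact: measurableT_comp mH (measurable_pair2 z).
have E := ge0_RintegralZr leb (W z) mHz (fun tau => H0 (tau, z)).
by rewrite [LHS]E /Rintegral HE.
Qed.

(** Only the scaling of the symbol is used: after the substitution t |zeta|^2 -> r it leaves the
    factor t^-s, which is what makes the mass of the fractional Laplacian vanish below. *)
Lemma enorm_powR_gauss_le (t : R) z : 0 < t ->
  enorm z `^ (2 * s) * expR (- (t * dot z z)) <= t `^ (- s) * (2 * expR (- (t / 2 * dot z z))).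
Proof.
move=> t0; have -> : t / 2 * dot z z = t * dot z z / 2 by rewrite mulrAC.
have -> : enorm z `^ (2 * s) = t `^ (- s) * (t * dot z z) `^ s.
  rewrite enorm_powR2 powRM ?dot_ge0 ?(ltW t0)// mulrA powRN mulVf ?mul1r//.
  by rewrite gt_eqF// powR_gt0.
have := mulr_ge0 (ltW t0) (dot_ge0 z); move: (t * dot z z) => r r0.
rewrite -mulrA ler_wpM2l ?powR_ge0//.
have rs1 : r `^ s <= 1 + r.
  have [r1|r1] := leP r 1.
    apply: (@le_trans _ _ 1); last by rewrite lerDl.
    have := @ge0_ler_powR R s (ltW s0) r 1; rewrite powR1 !nnegrE; exact.
  apply: (@le_trans _ _ r); last by rewrite lerDr.
  rewrite -[leRHS]powRr1//; apply: ler_powR; first exact: ltW.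
  by case/andP: s01 => _ /ltW.
have -> : expR (- r) = expR (- (r / 2)) * expR (- (r / 2)) by rewrite -expRD; congr expR; field.
rewrite mulrA ler_wpM2r ?expR_ge0// expRN ler_pdivrMr ?expR_gt0//.
by apply: (le_trans rs1); have := expR_ge1Dx (r / 2); lra.
Qed.

Let heat_frequency_integral (t : R) : R :=
  \int[mu]_z (enorm z `^ (2 * s) * (expR (- (t * dot z z)) * cos_transform f z (- (dot z 0 + 0)))).

Let heat_frequency_integral_le : exists2 C, 0 <= C & forall t, 0 < t ->
  `|heat_frequency_integral t| <= C * t `^ (- s) * Num.sqrt (pi / (t / 2)) ^+ n.
Proof.
have [C C0 hC] := cos_transform_decay fs.
have hC1 z th : `|cos_transform f z th| <= C.
  apply: (le_trans (hC z th)); rewrite ler_piMr// exprn_ile1//; first by rewrite invr_ge0 ltW// frequency_weight_gt0.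
  by rewrite invf_le1 ?frequency_weight_gt0// (le_trans _ (dot_le_frequency_weight z))// lerDl dot_ge0.
exists (2 * C) => [|t t0]; first by rewrite mulr_ge0.
have t2 : 0 < t / 2 by rewrite divr_gt0.
have mg : measurable_fun setT (fun z : 'rV[R]_n => expR (- (t / 2 * dot (z - 0) (z - 0)))).
  by have /integrableP[/measurable_EFinP] := @integrable_gauss_rV R n (t / 2) 0 t2.
have k0 : 0 <= 2 * C * t `^ (- s) by rewrite !mulr_ge0 ?powR_ge0.
have mint : measurable_fun setT (fun z : 'rV[R]_n => enorm z `^ (2 * s) * (expR (- (t * dot z z)) * cos_transform f z (- (dot z 0 + 0)))).
  apply: measurable_funM.
    exact: measurableT_comp (measurable_powR _) (measurable_enorm (@measurable_id _ _ setT)).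
  apply: measurable_funM; first by apply: measurable_gauss_rV; exact: measurable_id.
  exact: measurable_cos_transform (measurable_phase 0 0) (@measurable_id _ _ setT).
apply: normr_Rintegral_le; first exact: mint.
rewrite EFinM -(integral_gauss_rV 0 t2) -ge0_integralZl_real//.
apply: ge0_le_integral => //.
- by apply/measurable_EFinP; exact: measurableT_comp.
- by apply/measurable_EFinP; apply: measurable_funM => //; exact: measurable_cst.
move=> z _; rewrite lee_fin subr0 mulrA normrM.
rewrite (_ : 2 * C * _ * _ = t `^ (- s) * (2 * expR (- (t / 2 * dot z z))) * C); last by ring.
apply: ler_pM; [exact: normr_ge0|exact: normr_ge0| |exact: hC1].
by rewrite ger0_norm ?enorm_powR_gauss_le// mulr_ge0 ?powR_ge0 ?expR_ge0.
Qed.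

Let gauss_mass (tau : R) : R := \int[mu]_x (expR (- (expR (- tau) / 4 * dot x x)) * L x).

(** The normalisations of the Gaussian in space and in frequency compensate up to a constant, and
    the factor t^-s remains. *)
Let gauss_mass_le : exists2 D, 0 <= D & forall tau, `|gauss_mass tau| <= D * expR tau `^ (- s).
Proof.
have IL := integrable_frac_multiplier s01 sn fs.
have p0 := pi_gt0 R.
have [C C0 hC] := heat_frequency_integral_le.
exists (kap * (C * Num.sqrt (8 * pi ^+ 2) ^+ n)).
  by rewrite mulr_ge0 ?fourier_const_ge0// mulr_ge0// exprn_ge0// sqrtr_ge0.
move=> tau; have := hC _ (expR_gt0 tau).
pose a : R := expR (- tau) / 4; have a0 : 0 < a by rewrite divr_gt0// expR_gt0.
pose N1 := Num.sqrt (a / pi) ^+ n.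
have N10 : 0 < N1 by rewrite exprn_gt0// sqrtr_gt0 divr_gt0.
have IE : N1 * gauss_mass tau = kap * heat_frequency_integral (expR tau).
  rewrite -heat_frac_multiplier /gauss_mass -RintegralZl//.
    by apply: eq_Rintegral => x _; rewrite subr0 mulrA.
  apply: (integrable_le _ _ (integrable_norm IL)).
    by apply: measurable_funM => //; apply: measurable_gauss_rV; exact: measurable_id.
  move=> x; rewrite normrM (ger0_norm (expR_ge0 _)) ler_piMl//.
  by rewrite -expR0 ler_expR oppr_le0 mulr_ge0 ?dot_ge0// ltW.
have NE : Num.sqrt (pi / (expR tau / 2)) ^+ n = N1 * Num.sqrt (8 * pi ^+ 2) ^+ n.
  rewrite /N1 -exprMn -(@sqrtrM R (a / pi)); last by rewrite ltW// divr_gt0.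
  congr (Num.sqrt _ ^+ _).
  by rewrite /a expRN; move: (gt_eqF (expR_gt0 tau)) (gt_eqF p0); move: (pi) (expR tau) => q u ? ?; field; apply/andP; split; apply/negbT.
move: IE NE; move: (heat_frequency_integral _) (gauss_mass _) (expR tau `^ _) (Num.sqrt (pi / _) ^+ n) (Num.sqrt (8 * _) ^+ n).
move=> H m T S1 S2 IE -> hH; rewrite -(ler_pM2l N10).
have <- : `|N1 * m| = N1 * `|m| by rewrite normrM gtr0_norm.
rewrite IE normrM (ger0_norm fourier_const_ge0).
apply: (le_trans (ler_wpM2l fourier_const_ge0 hH)).
by rewrite le_eqVlt; apply/orP; left; apply/eqP; ring.
Qed.

(** The symbol of the fractional Laplacian vanishes at frequency 0: testing against wider and wider
    Gaussians, the mass that they see tends to 0. *)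
Lemma integral_frac_multiplier : \int[mu]_x L x = 0.
Proof.
have IL := integrable_frac_multiplier s01 sn fs.
have geometric (c : R) : 0 < c -> expR (- c) ^+ k @[k --> \oo] --> (0 : R).
  by move=> c0; apply: cvg_expr; rewrite ger0_norm ?expR_ge0// expRN invf_lt1 ?expR_gt0// expR_gt1.
have c1 : gauss_mass k%:R @[k --> \oo] --> \int[mu]_x L x.
  apply: (@Rintegral_dominated_cvg _ _ R mu (fun k x => expR (- (expR (- k%:R) / 4 * dot x x)) * L x) L (fun x => `|L x|)) => //.
  - by move=> k; apply: measurable_funM => //; apply: measurable_gauss_rV; exact: measurable_id.
  - move=> x; rewrite -[X in _ --> X]mul1r; apply: cvgM; last exact: cvg_cst.
    suff h0 : - (expR (- k%:R) / 4 * dot x x) @[k --> \oo] --> (0 : R).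
      by have := cvg_comp _ _ h0 (@continuous_expR R 0); rewrite expR0.
    rewrite -oppr0; apply: cvgN; rewrite -[X in _ --> X](mul0r (dot x x)).
    apply: cvgM; last exact: cvg_cst.
    rewrite -[X in _ --> X](mul0r (4^-1)); apply: cvgM; last exact: cvg_cst.
    rewrite (_ : (fun k => expR (- k%:R)) = (fun k => expR (- 1) ^+ k)); first exact: geometric.
    by apply/funext => k; rewrite -expRM_natl mulrN1.
  - exact: integrable_norm.
  - move=> k x; rewrite normrM (ger0_norm (expR_ge0 _)) ler_piMl//.
    by rewrite -expR0 ler_expR oppr_le0 mulr_ge0 ?dot_ge0// divr_ge0// expR_ge0.
have [D D0 hD] := gauss_mass_le.
have c2 : gauss_mass k%:R @[k --> \oo] --> (0 : R).
  apply/norm_cvg0P; apply: (@squeeze_cvgr _ _ _ _ (cst 0) (fun k => D * expR (- s) ^+ k)).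
  - apply: nearW => k; rewrite normr_ge0/= (le_trans (hD _))// ler_wpM2l//.
    by rewrite -expRM_natl /powR gt_eqF ?expR_gt0// expRK mulrC.
  - exact: cvg_cst.
  rewrite -[X in _ --> X](mulr0 D); apply: cvgM; first exact: cvg_cst.
  exact: geometric.
by rewrite -[LHS](cvg_lim (@Rhausdorff R) c1) (cvg_lim (@Rhausdorff R) c2).
Qed.

Lemma fraclapE x : fraclap s f x = ((L x)%:C)%C.
Proof.
have p0 : 0 < 2 * pi :> R by rewrite mulr_gt0// pi_gt0.
pose k : R := (2 * pi) `^ (- (n%:R / 2)).
have kE : k * k = kap.
  rewrite /k -powRD; last by apply/implyP => _; exact: lt0r_neq0.
  rewrite -opprD -splitr powRN powR_mulrn ?ltW// /fourier_const exprVn.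
  by [].
have FE z : fourier f z = ((k * cos_transform f z 0) +i* (k * cos_transform f z (pi / 2)))%C.
  rewrite /fourier /cintegral -/k; apply/eqP; rewrite eq_complex /= !mul0r subr0 addr0.
  apply/andP; split; apply/eqP; congr (_ * _); apply: eq_Rintegral => y _.
    by rewrite mulr0 subr0 cosN addr0 mulrC.
  by rewrite mulr0 add0r sinN cosD cos_pihalf sin_pihalf; ring.
have I theta := integrable_frac_integrand s01 fs x theta.
pose r1 z := k * (enorm z `^ (2 * s) * cos_transform f z (- (dot z x + 0))).
pose r2 z := k * (enorm z `^ (2 * s) * cos_transform f z (- (dot z x + - (pi / 2)))).
have E z : (((enorm z `^ (2 * s))%:C)%C * fourier f z * expi (dot z x) = (r1 z +i* r2 z)%C)%R.
  rewrite FE /r1 /r2 (cos_transform_phase z (- _) fs) (cos_transform_phase z (- (_ + - _)) fs).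
  rewrite addr0 opprB cosB sinB !cosN !sinN cos_pihalf sin_pihalf.
  by apply/eqP; rewrite eq_complex /=; apply/andP; split; apply/eqP; ring.
have -> : fraclap s f x = ((k%:C)%C * (\int[mu]_z r1 z +i* \int[mu]_z r2 z)%C)%R.
  by rewrite /fraclap /cintegral; congr (_ * Complex _ _); apply: eq_Rintegral => z _; rewrite E.
have S0 : frac_multiplier s f x (- (pi / 2)) = 0.
  rewrite frac_multiplier_heat// cosN cos_pihalf.
  by under eq_Rintegral do rewrite mul0r mulr0; rewrite Rintegral_cst// mul0r mulr0.
have mulcE (X Y : R) : ((k%:C)%C * (X +i* Y)%C)%R = ((k * X) +i* (k * Y))%C.
  by apply/eqP; rewrite eq_complex /= !mul0r subr0 addr0 !eqxx.
have rE theta : k * \int[mu]_z (k * (enorm z `^ (2 * s) * cos_transform f z (- (dot z x + theta)))) = frac_multiplier s f x theta.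
  by rewrite (RintegralZl k measurableT (I theta)) mulrA kE.
by rewrite mulcE; congr Complex; [exact: rE|exact: etrans (rE _) S0].
Qed.

End fractional_duality.

(** * The equation in the sense of distributions *)

Section test_functions_in_balls.
Context {R : realType} {n' : nat}.
Local Notation n := n'.+1.
Implicit Types (x y : 'rV[R]_n) (phi : 'rV[R]_n -> R).

Lemma test_function_smooth_boxed (G : set 'rV[R]_n) phi : test_function G phi -> smooth_boxed phi.
Proof.
move=> [sphi cphi _]; split => //.
have /compact_bounded[B [_ /(_ (B + 1))]] := cphi; rewrite ltrDl ltr01 => /(_ isT) hB.
exists (B + 1) => x i xi; apply/eqP; apply: contraTT xi => phix; rewrite -leNgt.
have /hB /= : supp phi x by apply: subset_closure.
by apply: le_trans; rewrite [leRHS]mx_normrE; apply/bigmax_geP; right; exists (ord0, i).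
Qed.

End test_functions_in_balls.

Section riesz_pairing.
Context {R : realType} {n' : nat}.
Local Notation n := n'.+1.
Local Notation mu := (lebesgue_rV R n).
#[local] Arguments lebesgue_rV : simpl never.
Implicit Types x y : 'rV[R]_n.

Lemma heat_integral_fineK (s : R) x y : 2 * s < n%:R -> x != y ->
  (fine (heat_integral s (x - y)))%:E = heat_integral s (x - y).
Proof.
move=> sn xy; rewrite fineK// heat_integralE//; last by rewrite subr_eq0.
by rewrite ltr_pdivlMr// mulrC.
Qed.

Lemma measurable_fine_heat_integral d (T : measurableType d) (s : R) (g : T -> 'rV[R]_n) :
  measurable_fun setT g -> measurable_fun setT (fun t => fine (heat_integral s (g t))).
Proof. by move=> mg; apply: (measurableT_comp (@fine_measurable _ setT measurableT)); exact: measurable_heat_integral. Qed.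

Lemma integrable_riesz_frac_multiplier (s : R) f y : 0 < s < 1 -> 2 * s < n%:R -> smooth_boxed f -> y != 0 ->
  mu.-integrable setT (EFin \o (fun x => fine (heat_integral s (x - y)) * frac_multiplier s f x 0)).
Proof.
move=> s01 sn fs y0; have /andP[s0 _] := s01.
have Q0 : 0 < n%:R - 2 * s by rewrite subr_gt0.
pose a := (n%:R - 2 * s) / 2; have a0 : 0 < a by rewrite divr_gt0.
have aQ : a < n%:R - 2 * s by rewrite /a; lra.
have [C C0 hC] := frac_multiplier_le_power s01 fs a0 aQ.
have K0 x : 0 <= fine (heat_integral s (x - y)) by rewrite fine_ge0// heat_integral_ge0.
have mK : measurable_fun setT (fun x => fine (heat_integral s (x - y))).
  apply: measurable_fine_heat_integral.
  by apply: measurable_subrV; [exact: measurable_id|exact: measurable_cst].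
have mL : measurable_fun setT (fun x => frac_multiplier s f x 0) by exact: measurable_frac_multiplier.
apply/integrableP; split; first by apply/measurable_EFinP; exact: measurable_funM.
apply: (@le_lt_trans _ _ (\int[mu]_x (C%:E * (heat_integral s (y - x) * (enorm x `^ (- (2 * s + a)))%:E)))%E).
  apply: ae_ge0_le_integral => //.
  - by apply/measurable_EFinP; apply: measurableT_comp => //; exact: measurable_funM.
  - by move=> x _; rewrite !mule_ge0 ?lee_fin ?heat_integral_ge0 ?powR_ge0.
  - apply: emeasurable_funM; first exact: measurable_cst.
    apply: measurable_riesz_integrand; exact: measurable_enorm_powR.
  apply: filterS2 (ae_neq 0) (ae_neq y) => x x0 xy _ /=.
  rewrite (_ : heat_integral s (y - x) = heat_integral s (x - y)); last first.
    by apply/le_anti/andP; split; apply: heat_integral_le; rewrite dotBC.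
  rewrite -heat_integral_fineK// -!EFinM lee_fin normrM (ger0_norm (K0 x)) mulrCA ler_wpM2l//.
  exact: hC.
rewrite ge0_integralZl//; last 2 first.
- apply: measurable_riesz_integrand; exact: measurable_enorm_powR.
- by move=> x _; rewrite mule_ge0 ?heat_integral_ge0 ?lee_fin ?powR_ge0.
by rewrite riesz_potential_power// -EFinM ltry.
Qed.

End riesz_pairing.

Section hardy_solution_properties.
Context {R : realType} {n' : nat}.
Local Notation n := n'.+1.
Local Notation mu := (lebesgue_rV R n).
Implicit Types (x y : 'rV[R]_n).
#[local] Arguments lebesgue_rV : simpl never.
Variables (s gam p r : R) (u : 'rV[R]_n -> R).
Hypotheses (s01 : 0 < s < 1) (sn : 2 * s < n%:R) (gam0 : 0 <= gam).
Variables (eps a M : R).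
Hypotheses (eps0 : 0 < eps) (a0 : 0 < a) (aQ : a < n%:R - 2 * s) (M0 : 0 <= M).
Hypotheses (mu_u : measurable_fun setT u) (u_0 : u 0 = 1) (u_ge : forall x, x != 0 -> eps <= u x).
Local Notation S := (hardy_source s gam p r u).
Hypothesis S_le : forall y, y != 0 -> S y <= M * enorm y `^ (- (2 * s + a)).
Hypothesis uE : forall x, x != 0 -> (u x)%:E = (eps%:E + (Gamma s)^-1%:E * riesz_potential s S x)%E.
Local Notation rf := (@riesz_factor R n').
Local Notation B := (@eball R n r).
Local Notation V := (fun x => gam * enorm x `^ (- (2 * s)) * u x).

Let s0 : 0 < s. Proof. by case/andP: s01. Qed.

Lemma hardy_u_gt0 x : 0 < u x.
Proof.
have [->|x0] := eqVneq x 0; first by rewrite u_0.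
exact: lt_le_trans (u_ge x0).
Qed.
Let u_gt0 := hardy_u_gt0.

Let S0 y : 0 <= S y.
Proof. by apply: hardy_source_ge0 => // _; rewrite ltW// u_gt0. Qed.

Let mS : measurable_fun setT S. Proof. exact: measurable_hardy_source. Qed.

Let mB : measurable B.
Proof.
rewrite /eball -[X in measurable X]setTI.
apply: (measurable_fun_ltr (measurable_enorm (@measurable_id _ 'rV[R]_n setT)) (measurable_cst r)) => //.
Qed.

Let potential_le x : x != 0 -> (riesz_potential s S x <= (M * rf s a * enorm x `^ (- a))%:E)%E.
Proof. by move=> x0; apply: riesz_potential_le_power. Qed.

Let G0 : 0 < Gamma s. Proof. exact: Gamma_gt0. Qed.

Lemma hardy_u_le : exists2 K, 0 <= K & forall x, x != 0 -> u x <= eps + K * enorm x `^ (- a).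
Proof.
have rf0 := riesz_factor_gt0 s0 a0 aQ.
exists ((Gamma s)^-1 * (M * rf s a)).
  by apply: mulr_ge0; [rewrite invr_ge0 ltW|apply: mulr_ge0 => //; exact: ltW].
move=> x x0; rewrite -lee_fin uE// EFinD leeD2l// -mulrA EFinM lee_wpmul2l ?potential_le//.
by rewrite lee_fin invr_ge0 ltW.
Qed.

(** The weight of the space L1s decays like the fractional Laplacian of a test function, so the same
    lemma applies to it. *)
Lemma hardy_u_L1s : L1s s u.
Proof.
split => //; have [K K0 uK] := hardy_u_le.
pose g x := (1 + enorm x `^ (n%:R + 2 * s))^-1.
have g_gt0 x : 0 < g x by rewrite invr_gt0 ltr_pwDl// powR_ge0.
have mg : measurable_fun setT g.
  rewrite (_ : g = (fun x => (1 + enorm x `^ (n%:R + 2 * s)) `^ (-1))).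
    have me := measurable_enorm (@measurable_id _ 'rV[R]_n setT).
    by mfun.
  by apply/funext => x; rewrite powR_inv1// addr_ge0// powR_ge0.
have gb : exists2 C, 0 <= C & forall x, g x <= C.
  exists 1 => // x; rewrite /g invf_le1; first by rewrite lerDl powR_ge0.
  by rewrite ltr_pwDl// powR_ge0.
have gf : exists rho C, [/\ 1 <= rho, 0 <= C & forall x, rho <= enorm x -> g x <= C * enorm x `^ (- (n%:R + 2 * s))].
  exists 1, 1; split => // x x1; rewrite mul1r powRN /g lef_pV2 ?posrE ?lerDr//.
    by rewrite ltr_pwDl// powR_ge0.
  by rewrite powR_gt0// (lt_le_trans _ x1).
have I b : 0 <= b -> b < n%:R - 2 * s -> (\int[mu]_x (g x * enorm x `^ (- b))%:E < +oo)%E.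
  by move=> b0 bQ; apply: (@integral_decaying_power _ _ s g) => // x; exact: ltW.
apply: (@le_lt_trans _ _ (\int[mu]_x ((eps * (g x * enorm x `^ (- 0)))%:E + (K * (g x * enorm x `^ (- a)))%:E))%E).
  apply: ae_ge0_le_integral => //.
  - by move=> x _; rewrite lee_fin divr_ge0// ltW// -invr_gt0 g_gt0.
  - apply/measurable_EFinP; apply: measurable_funM => //; exact: measurableT_comp.
  - by move=> x _; rewrite -EFinD lee_fin addr_ge0// mulr_ge0 ?mulr_ge0 ?powR_ge0// ltW.
  - by apply: emeasurable_funD; apply/measurable_EFinP; apply: measurable_funM; rewrite ?measurable_cst//;
      (try exact: measurable_cst); apply: measurable_funM => //; exact: measurable_enorm_powR.
  apply: filterS (ae_neq 0) => x x0 _; rewrite -EFinD lee_fin -/(g x) ger0_norm ?(ltW (u_gt0 _))//.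
  rewrite oppr0 powRr0 mulr1 [leRHS](_ : _ = (eps + K * enorm x `^ (- a)) * g x); last by ring.
  by rewrite ler_wpM2r ?uK// ltW.
have mf b : measurable_fun setT (fun x : 'rV[R]_n => g x * enorm x `^ (- b)).
  by apply: measurable_funM => //; exact: measurable_enorm_powR.
have f0 b x : 0 <= g x * enorm x `^ (- b) by rewrite mulr_ge0 ?powR_ge0// ltW.
rewrite ge0_integralD//; last 4 first.
- by move=> x _; rewrite lee_fin mulr_ge0// ltW.
- by apply/measurable_EFinP; apply: measurable_funM => //; exact: measurable_cst.
- by move=> x _; rewrite lee_fin mulr_ge0.
- by apply/measurable_EFinP; apply: measurable_funM => //; exact: measurable_cst.
have fin b c : 0 <= b -> b < n%:R - 2 * s -> 0 <= c -> (\int[mu]_x (c * (g x * enorm x `^ (- b)))%:E < +oo)%E.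
  move=> b0 bQ c0; rewrite ge0_integralZl_real//.
  have Ib : (0 <= \int[mu]_x (g x * enorm x `^ (- b))%:E)%E by apply: integral_ge0 => x _; rewrite lee_fin.
  by apply: lte_mul_pinfty; rewrite ?lee_fin ?I.
apply: lte_add_pinfty; apply: fin => //; first by rewrite subr_gt0.
  exact: ltW.
exact: ltW.
Qed.

(** The terms of the equation are dominated on the ball by the bound of the source; the Gaussian
    only serves at the origin, where the convention on powers makes that bound vanish. *)
Let dom y : R := M * (if enorm y < r then enorm y `^ (- (2 * s + a)) else 0) + expR (- dot y y).

Let dom_ge0 y : 0 <= dom y.
Proof. by rewrite addr_ge0 ?expR_ge0// mulr_ge0//; case: ifP => // _; exact: powR_ge0. Qed.

Let split_source y : y != 0 -> B y -> S y = V y + u y `^ p.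
Proof. by rewrite -enorm_gt0 /hardy_source /eball/= => -> ->. Qed.

Let V_ge0 y : 0 <= V y.
Proof. by rewrite !mulr_ge0 ?powR_ge0// ltW// u_gt0. Qed.

Let terms_le_dom y : B y -> V y <= dom y /\ u y `^ p <= dom y.
Proof.
move=> yB; have [->|y0] := eqVneq y 0.
  have e0 : @enorm R n 0 = 0 by apply/eqP; rewrite enorm_eq0.
  have d0 : dot (0 : 'rV[R]_n) 0 = 0 by rewrite /dot big1// => i _; rewrite mxE mul0r.
  have h : 1 <= dom 0.
    by rewrite /dom d0 oppr0 expR0 lerDr mulr_ge0//; case: ifP => // _; exact: powR_ge0.
  rewrite u_0 powR1; split => //; rewrite e0 powR0 ?mulr0 ?mul0r//.
  by rewrite oppr_eq0 mulf_neq0// gt_eqF.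
have SV := split_source y0 yB; have := S_le y0.
have h : M * enorm y `^ (- (2 * s + a)) <= dom y.
  by rewrite /dom (_ : (enorm y < r) = true)// lerDl expR_ge0.
rewrite SV => h1; have h2 := le_trans h1 h; split; apply: le_trans h2.
  by rewrite lerDl powR_ge0.
by rewrite lerDr V_ge0.
Qed.

Let measurable_dom : measurable_fun setT dom.
Proof.
apply: measurable_funD; last first.
  by have /integrableP[/measurable_EFinP] := @integrable_gauss0 R n.
apply: measurable_funM; first exact: measurable_cst.
apply: measurable_fun_ifT; [|exact: measurable_enorm_powR|exact: measurable_cst].
apply: measurable_fun_ltr; last exact: measurable_cst.
exact: (measurable_enorm (@measurable_id _ 'rV[R]_n setT)).
Qed.

Let integrable_dom : mu.-integrable setT (EFin \o dom).
Proof.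
pose t := Num.max 1 r; have t1 : 1 <= t by rewrite le_max lexx.
have t0 : 0 < t by exact: lt_le_trans t1.
pose Q := n%:R - 2 * s; have Q0 : 0 <= Q by rewrite subr_ge0 ltW.
have Iw : mu.-integrable setT (EFin \o @riesz_weight R n' s a).
  apply: ge0_integrable; [exact: measurable_riesz_weight|by move=> y; exact: riesz_weight_ge0|].
  exact: integral_riesz_weight.
have I1 : mu.-integrable setT (EFin \o (fun y : 'rV[R]_n => if enorm y < r then enorm y `^ (- (2 * s + a)) else 0)).
  apply: (integrable_le _ _ (integrableZl measurableT ((2 * t) `^ Q) Iw)).
    apply: measurable_fun_ifT; [|exact: measurable_enorm_powR|exact: measurable_cst].
    apply: measurable_fun_ltr; last exact: measurable_cst.
    exact: (measurable_enorm (@measurable_id _ 'rV[R]_n setT)).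
  move=> y; case: ifPn => yr; last by rewrite normr0 mulr_ge0 ?powR_ge0 ?riesz_weight_ge0.
  rewrite ger0_norm ?powR_ge0// /riesz_weight mulrCA ler_peMr ?powR_ge0// -/Q powRN.
  have q0 : 0 < Num.sqrt (2 + 2 * dot y y) by rewrite sqrtr_gt0 ltr_pwDl// mulr_ge0// dot_ge0.
  rewrite ler_pdivlMr ?powR_gt0// mul1r.
  apply: ge0_ler_powR => //; rewrite ?nnegrE ?sqrtr_ge0//.
    by rewrite mulr_ge0// ltW.
  by apply: sqrt_weight_le => //; rewrite le_max (ltW yr) orbT.
exact: (integrableD measurableT (integrableZl measurableT M I1) (@integrable_gauss0 R n)).
Qed.

Let dom_fin : (\int[mu]_x (dom x)%:E < +oo)%E.
Proof.
have /integrableP[_] := integrable_dom.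
by apply: le_lt_trans; rewrite le_eqVlt; apply/orP; left; apply/eqP; apply: eq_integral => x _; rewrite /= ger0_norm.
Qed.

Let mV : measurable_fun setT V.
Proof.
apply: measurable_funM => //; apply: measurable_funM; first exact: measurable_cst.
exact: measurable_enorm_powR.
Qed.

Let mup : measurable_fun setT (fun x => u x `^ p).
Proof. exact: measurableT_comp (measurable_powR _) mu_u. Qed.

Let integral_dominated_lt (K : set 'rV[R]_n) (f : 'rV[R]_n -> R) : measurable K -> measurable_fun setT f ->
  (forall x, K x -> 0 <= f x <= dom x) -> (\int[mu]_(x in K) (f x)%:E < +oo)%E.
Proof.
move=> mK mf fd; apply: (@le_lt_trans _ _ (\int[mu]_(x in K) (dom x)%:E)%E).
  apply: ge0_le_integral => //.
  - by move=> x /fd/andP[f0 _]; rewrite lee_fin.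
  - by apply/measurable_EFinP; exact: measurable_funTS.
  - by apply/measurable_EFinP; exact: measurable_funTS.
  - by move=> x /fd/andP[_ h]; rewrite lee_fin.
apply: le_lt_trans dom_fin; apply: ge0_subset_integral => //.
  exact/measurable_EFinP.
by move=> x _; rewrite lee_fin.
Qed.

Lemma hardy_u_Lp : Lp_on B p u.
Proof.
split; first exact: measurable_funTS.
apply: (@integral_dominated_lt B (fun x => `|u x| `^ p)) => //.
  by apply: (measurableT_comp (measurable_powR _)); exact: measurableT_comp.
move=> x /terms_le_dom[_]; rewrite ger0_norm ?(ltW (u_gt0 _))// => ->.
by rewrite powR_ge0.
Qed.

Lemma hardy_V_L1loc : L1loc B V.
Proof.
split; first exact: measurable_funTS.
move=> K KB cK; apply: (@integral_dominated_lt K (fun x => `|V x|)).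
- exact: compact_measurable_rV.
- exact: measurableT_comp.
- by move=> x /KB/terms_le_dom[h _]; rewrite normr_ge0 ger0_norm.
Qed.

Section duality.
Variable phi : 'rV[R]_n -> R.
Hypothesis phi_test : test_function B phi.
Local Notation L := (fun x => frac_multiplier s phi x 0).

Let fs : smooth_boxed phi. Proof. exact: test_function_smooth_boxed phi_test. Qed.
Let mphi : measurable_fun setT phi. Proof. exact: continuous_measurable_rV (smooth_boxed_continuous fs). Qed.
Let mL : measurable_fun setT L. Proof. exact: measurable_frac_multiplier. Qed.

(** Self-adjointness of the Riesz potential, by Fubini; its integrals converge because the potential
    of the source is at most a multiple of |x|^-a, against which L is integrable. *)
Lemma integral_hardy_u_frac : \int[mu]_x (u x * L x) = \int[mu]_y (S y * phi y).
Proof.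
have rf0 := riesz_factor_gt0 s0 a0 aQ.
have mK : measurable_fun setT (fun q : 'rV[R]_n * 'rV[R]_n => fine (heat_integral s (q.1 - q.2))).
  by apply: measurable_fine_heat_integral; apply: measurable_subrV; [exact: measurable_fst|exact: measurable_snd].
have mS2 : measurable_fun setT (fun q : 'rV[R]_n * 'rV[R]_n => S q.2) by exact: measurableT_comp mS (@measurable_snd _ _ _ _).
pose F (q : 'rV[R]_n * 'rV[R]_n) : R := fine (heat_integral s (q.1 - q.2)) * S q.2 * L q.1.
have mF : measurable_fun setT F.
  apply: measurable_funM; first exact: measurable_funM.
  exact: measurableT_comp mL (@measurable_fst _ _ _ _).
have K0 x y : 0 <= fine (heat_integral s (x - y)) by rewrite fine_ge0// heat_integral_ge0.
have Kfin x y : y != x -> (fine (heat_integral s (x - y)))%:E = heat_integral s (x - y).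
  by move=> yx; rewrite heat_integral_fineK// eq_sym.
have potE x : riesz_potential s S x = (\int[mu]_y (fine (heat_integral s (x - y)) * S y)%:E)%E.
  apply: ae_eq_integral => //.
  - exact: measurable_riesz_integrand.
  - apply/measurable_EFinP; apply: measurable_funM => //.
    exact: measurableT_comp mK (measurable_pair1 x).
  - by apply: filterS (ae_neq x) => y yx _; rewrite EFinM Kfin.
have bF : (\int[mu]_x \int[mu]_y `|F (x, y)|%:E < +oo)%E.
  have Lfin := integral_frac_multiplier_power s01 sn fs (ltW a0) aQ.
  pose C := M * rf s a; have C0 : 0 <= C by rewrite mulr_ge0// ltW.
  apply: (@le_lt_trans _ _ (\int[mu]_x (C * (`|L x| * enorm x `^ (- a)))%:E)%E).
    apply: ae_ge0_le_integral => //.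
    - by move=> x _; apply: integral_ge0.
    - apply: (@measurable_integral_param _ _ _ _ R mu (fun q => `|F q|%:E)).
      by apply/measurable_EFinP; exact: measurableT_comp.
    - by move=> x _; rewrite lee_fin mulr_ge0// mulr_ge0 ?powR_ge0.
    - apply/measurable_EFinP; apply: measurable_funM; first exact: measurable_cst.
      by apply: measurable_funM; [exact: measurableT_comp|exact: measurable_enorm_powR].
    apply: filterS (ae_neq 0) => x x0 _.
    have -> : (\int[mu]_y `|F (x, y)|%:E = `|L x|%:E * riesz_potential s S x)%E.
      rewrite potE -ge0_integralZl_real//.
      + by apply: eq_integral => y _; rewrite /F/= !normrM (ger0_norm (K0 _ _)) (ger0_norm (S0 _)) mulrC.
      + apply: measurable_funM => //; exact: measurableT_comp mK (measurable_pair1 x).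
      + by move=> y; rewrite mulr_ge0.
    rewrite mulrCA [X in (_ <= X)%E]EFinM lee_wpmul2l ?lee_fin//.
    exact: potential_le.
  rewrite ge0_integralZl_real//.
  - have I0 : (0 <= \int[mu]_x (`|L x| * enorm x `^ (- a))%:E)%E.
      by apply: integral_ge0 => x _; rewrite lee_fin mulr_ge0 ?powR_ge0.
    by apply: lte_mul_pinfty; rewrite ?lee_fin.
  - by apply: measurable_funM; [exact: measurableT_comp|exact: measurable_enorm_powR].
  - by move=> x; rewrite mulr_ge0 ?powR_ge0.
have IL := integrable_frac_multiplier s01 sn fs.
have IF := integrable_Rintegral_param mF bF.
have Fx x : \int[mu]_y F (x, y) = fine (riesz_potential s S x) * L x.
  rewrite /F/= (@ge0_RintegralZr _ _ R mu (fun y => fine (heat_integral s (x - y)) * S y)).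
  - by rewrite potE.
  - apply: measurable_funM => //; exact: measurableT_comp mK (measurable_pair1 x).
  - by move=> y; rewrite mulr_ge0.
rewrite (@ae_eq_Rintegral _ _ R mu _ (fun x => eps * L x + (Gamma s)^-1 * \int[mu]_y F (x, y))).
- rewrite RintegralD//; last 2 first.
  + exact: (integrableZl measurableT eps IL).
  + exact: (integrableZl measurableT (Gamma s)^-1 IF).
  rewrite [X in X + _ = _](RintegralZl eps measurableT IL) [X in _ + X = _](RintegralZl (Gamma s)^-1 measurableT IF).
  rewrite integral_frac_multiplier// mulr0 add0r Rintegral_fubini//.
  rewrite [X in _ * X = _](@ae_eq_Rintegral _ _ R mu _ (fun y => Gamma s * (S y * phi y))).
  + rewrite RintegralZl//; last first.
      have [Mb phiM] := fs.2; have [Cp Cp0 hp] := box_supported_gauss (smooth_boxed_continuous fs) phiM.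
      apply: (integrable_le _ _ (integrableZl measurableT Cp (integrableD measurableT integrable_dom integrable_dom))).
        exact: measurable_funM.
      move=> y /=; rewrite normrM (ger0_norm (S0 _)) [leRHS]mulrC.
      apply: ler_pM => //.
        have [yr|yr] := boolP (enorm y < r); last first.
          by rewrite /hardy_source (negbTE yr) andbF addr_ge0.
        rewrite /hardy_source yr andbT; case: ifPn => _; last by rewrite addr_ge0.
        by have [h1 h2] := terms_le_dom (yr : B y); exact: lerD.
      by apply: (le_trans (hp y)); rewrite ler_piMr// -expR0 ler_expR oppr_le0 dot_ge0.
    by rewrite mulKf// gt_eqF.
  + apply: (@measurable_Rintegral_param _ _ _ _ R mu (fun q => F (q.2, q.1))).
    by apply: (measurableT_comp mF); exact: measurable_swap.
  + by apply: measurable_funM; [exact: measurable_cst|exact: measurable_funM].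
  apply: filterS (ae_neq 0) => y y0.
  rewrite mulrCA -(riesz_frac_multiplier s01 sn fs y0).
  rewrite /F/=; under eq_Rintegral do rewrite mulrAC mulrC.
  by rewrite RintegralZl//; exact: integrable_riesz_frac_multiplier.
- exact: measurable_funM.
- apply: measurable_funD.
    by apply: measurable_funM; [exact: measurable_cst|exact: mL].
  apply: measurable_funM; first exact: measurable_cst.
  by have /integrableP[/measurable_EFinP] := IF.
apply: filterS (ae_neq 0) => x x0; rewrite Fx [(Gamma s)^-1 * _]mulrA -mulrDl; congr (_ * _).
have pf : riesz_potential s S x \is a fin_num.
  rewrite ge0_fin_numE ?riesz_potential_ge0//; exact: le_lt_trans (potential_le x0) (ltry _).
by apply/EFin_inj; rewrite uE// EFinD EFinM fineK.
Qed.

Lemma hardy_equation :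
  distr_fraclap s u phi - distr_fun B V phi = distr_fun B (fun x => u x `^ p) phi.
Proof.
have on_ball (g : 'rV[R]_n -> R) : \int[mu]_(x in B) (g x * phi x) =
    \int[mu]_x ((if enorm x < r then g x else 0) * phi x).
  rewrite Rintegral_mkcond; apply: eq_Rintegral => x _; rewrite patchE.
  rewrite (_ : (x \in B) = (enorm x < r)); last by apply/idP/idP => h; [exact: set_mem h|exact: mem_set].
  by case: ifP => // _; rewrite mul0r.
have mball (g : 'rV[R]_n -> R) : measurable_fun setT g ->
    measurable_fun setT (fun x => (if enorm x < r then g x else 0) * phi x).
  move=> mg; apply: measurable_funM => //; apply: measurable_fun_ifT => //.
  apply: measurable_fun_ltr; last exact: measurable_cst.
  exact: (measurable_enorm (@measurable_id _ 'rV[R]_n setT)).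
have Iball (g : 'rV[R]_n -> R) : measurable_fun setT g -> (forall x, B x -> 0 <= g x <= dom x) ->
    mu.-integrable setT (EFin \o (fun x => (if enorm x < r then g x else 0) * phi x)).
  move=> mg gd; have [Mb phiM] := fs.2.
  have [Cp Cp0 hp] := box_supported_gauss (smooth_boxed_continuous fs) phiM.
  apply: (integrable_le _ _ (integrableZl measurableT Cp integrable_dom)); first exact: mball.
  move=> x /=; rewrite normrM mulrC; apply: ler_pM => //.
    by apply: (le_trans (hp x)); rewrite ler_piMr// -expR0 ler_expR oppr_le0 dot_ge0.
  case: ifPn => xr; last by rewrite normr0.
  by have /andP[h1 h2] := gd x xr; rewrite ger0_norm.
have IV := Iball _ mV (fun x xB => introT andP (conj (V_ge0 x) (terms_le_dom xB).1)).
have Iu := Iball _ mup (fun x xB => introT andP (conj (powR_ge0 _ _) (terms_le_dom xB).2)).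
have key : \int[mu]_x (u x * L x) = \int[mu]_(x in B) (V x * phi x) + \int[mu]_(x in B) (u x `^ p * phi x).
  rewrite integral_hardy_u_frac !on_ball -RintegralD//.
  apply: ae_eq_Rintegral.
  - exact: measurable_funM.
  - by apply: measurable_funD; exact: mball.
  apply: filterS (ae_neq 0) => y y0; rewrite -mulrDl; congr (_ * _).
  rewrite /hardy_source; move: y0; rewrite -enorm_gt0 => ->/=.
  by case: ifP => // _; rewrite addr0.
have -> : distr_fraclap s u phi = ((\int[mu]_x (u x * L x))%:C)%C.
  rewrite /distr_fraclap /cintegral; apply/eqP; rewrite eq_complex; apply/andP; split; apply/eqP.
    by apply: eq_Rintegral => x _; rewrite fraclapE//= mulr0 subr0.
  transitivity (\int[mu]_x (0 : R)); last by rewrite /= /Rintegral integral0.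
  by apply: eq_Rintegral => x _; rewrite fraclapE//= mulr0 mul0r addr0.
rewrite key /distr_fun; apply/eqP; rewrite eq_complex /= subr0 eqxx andbT.
by rewrite addrAC subrr add0r.
Qed.

End duality.

End hardy_solution_properties.

Section hardy_problem_solutions.
Context {R : realType} {n' : nat}.

Lemma hardy_problem (s gam p r : R) (u : 'rV[R]_n'.+1 -> R) : 0 < s < 1 -> 2 * s < n'.+1%:R -> 0 <= gam ->
  riesz_hardy_solution s gam p r u ->
  let B := @eball R n'.+1 r in
  [/\ L1s s u, Lp_on B p u, (forall x, B x -> 0 < u x) &
    let V := fun x => gam * enorm x `^ (- (2 * s)) * u x in
    L1loc B V /\
    forall phi, test_function B phi ->
      distr_fraclap s u phi - distr_fun B V phi = distr_fun B (fun x => u x `^ p) phi].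
Proof.
move=> s01 sn gam0 [eps [a [M [[eps0 [/andP[a0 aQ] M0]] mu_u [u0 uge] Sle uE]]]] B.
split.
- exact: (hardy_u_L1s s01 sn gam0 eps0 a0 aQ M0 mu_u u0 uge Sle uE).
- exact: (hardy_u_Lp s01 sn gam0 eps0 a0 aQ M0 mu_u u0 uge Sle).
- by move=> x _; exact: (hardy_u_gt0 eps0 u0 uge).
move=> V; split; first exact: (hardy_V_L1loc s01 sn gam0 eps0 a0 aQ M0 mu_u u0 uge Sle).
by move=> phi tphi; exact: (hardy_equation s01 sn gam0 eps0 a0 aQ M0 mu_u u0 uge Sle uE tphi).
Qed.

End hardy_problem_solutions.

Theorem theorem0p1 (R : realType) (s : R) (N : nat) (r alpha p : R)
    (hs : 0 < s < 1) (hN : (1 <= N)%N) (hNs : 2 * s < N%:R) (hr : 0 < r)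
    (halpha : 0 <= alpha <= (N%:R - 2 * s) / 2)
    (hp : 1 < p)
    (hp' : alpha < (N%:R - 2 * s) / 2 ->
           p < (N%:R + 2 * s - 2 * alpha) / (N%:R - 2 * s - 2 * alpha)) :
  let B : set 'rV[R]_N := eball r in
  exists u : 'rV[R]_N -> R,
    [/\ L1s s u, Lp_on B p u, (forall x, B x -> 0 < u x) &
      let V := fun x => hardy_gamma N s alpha * enorm x `^ (- (2 * s)) * u x in
      L1loc B V /\
      forall phi, test_function B phi ->
        distr_fraclap s u phi - distr_fun B V phi =
        distr_fun B (fun x => u x `^ p) phi].
Proof.
move=> B; case: N hN hNs halpha hp' @B => // n' _ hNs /andP[al0 alQ] hp' B.
have s0 : 0 < s by case/andP: hs.
move: alQ; rewrite le_eqVlt => /orP[/eqP alE|al].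
  have gE : hardy_gamma n'.+1 s alpha = 0 by rewrite /hardy_gamma alE eqxx.
  have [u uS] := riesz_hardy_solution_gamma0 s0 hNs hp hr.
  by exists u; rewrite gE; exact: hardy_problem.
have [u uS] := riesz_hardy_solution_pos s0 al0 al hp (hp' al) hr.
exists u; apply: hardy_problem => //.
by apply: hardy_gamma_ge0 => //; rewrite al0 ltW.
Qed.
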